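(* Let $G$ be a Lie group of dimension $n$ that is a closed embedded submanifold of a Euclidean space, with identity $e$ and $\mathfrak{g}=T_eG$. Let $\mathbb{I}$ be an inner product on $\mathfrak{g}$, let $R$ be an endomorphism of $\mathfrak{g}$ that is symmetric and positive-semidefinite with respect to $\mathbb{I}$ (possibly $R=0$), and let $\psi\colon G\to\mathbb{R}$ be smooth. Let $T>0$ and let $\boldsymbol{u}=(u^1,\ldots,u^n)\colon\mathbb{R}\to\mathbb{R}^n$ be measurable, bounded, $T$-periodic and zero-mean, such that the component functions $U^1,\ldots,U^n$ of its zero-mean antiderivative $\boldsymbol{U}$ satisfy $\frac1T\int_0^TU^i(\tau)U^j(\tau)\,\mathrm{d}\tau=1$ if $i=j$ and $=0$ if $i\neq j$. Let $\alpha\colon\mathbb{R}\to\mathbb{R}$ be a smooth function such that $\alpha\alpha'$ is strictly increasing and attains only positive values. Let $a,\lambda,b,\kappa,h>0$ with $a\lambda-b\kappa>0$. Let $(e_1,\ldots,e_n)$ be an orthonormal basis of $(\mathfrak{g},\mathbb{I})$. On the state manifold $M=G\times\mathfrak{g}\times\mathbb{R}^n\times\mathbb{R}$ consider, for $\omega>0$, the closed-loop system $$\begin{aligned} \dot g&=T_eL_g(v),\\ \dot v+\stackrel{\mathfrak{g}}{\nabla}_v v&=-Rv-b\big(w-\kappa\,\alpha(\psi(g)-\eta)\,U(\omega t)\big)+\lambda\,\alpha(\psi(g)-\eta)\,\omega\,u(\omega t)+\lambda^2\alpha^2(\psi(g)-\eta)\,\mu,\\ \dot{\boldsymbol{w}}&=-a\big(\boldsymbol{w}-\kappa\,\alpha(\psi(g)-\eta)\,\boldsymbol{U}(\omega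 t)\big)+\kappa\,\alpha(\psi(g)-\eta)\,\omega\,\boldsymbol{u}(\omega t),\\ \dot\eta&=-h\eta+h\psi(g) \end{aligned}$$ and the change of variables $$\tilde g=g,\quad \tilde v=v-\lambda\,\alpha(\psi(g)-\eta)\,U(\omega t),\quad \tilde{\boldsymbol{w}}=\boldsymbol{w}-\kappa\,\alpha(\psi(g)-\eta)\,\boldsymbol{U}(\omega t),\quad \tilde\eta=\eta.$$ Suppose that $\psi$ attains a local minimum value at some point $g_\ast\in G$ and that the Hessian of $\psi$ at $g_\ast$ is positive definite. Then the point $(g_\ast,0,\boldsymbol{0},\psi(g_\ast))$ of $M$ is locally practically uniformly asymptotically stable for the closed-loop system in these variables.
   Context: **Notation for the closed-loop system.** $L_g$ is left translation by $g$ and $T_eL_g\colon\mathfrak{g}\to T_gG$ its tangent map at the identity. For $v\in\mathfrak{g}$, $v^{\mathrm L}(g)=T_eL_g(v)$ is the corresponding left-invariant vector field. $\nabla$ is the Levi-Civita connection of the left-invariant Riemannian metric on $G$ induced by $\mathbb{I}$, and $\stackrel{\mathfrak{g}}{\nabla}\colon\mathfrak{g}\times\mathfrak{g}\to\mathfrak{g}$ is the bilinear map determined by $T_eL_g(\stackrel{\mathfrak{g}}{\nabla}_v w)=(\nabla_{v^{\mathrm L}}w^{\mathrm L})(g)$ for all $g\in G$, $v,w\in\mathfrak{g}$. Set $\mu:=\sum_{i=1}^n\stackrel{\mathfrak{g}}{\nabla}_{e_i}e_i\in\mathfrak{g}$. Boldface/lightface convention: vectors $\boldsymbol{w}=(w^1,\ldots,w^n)\in\mathbb{R}^n$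 and $w=\sum_iw^ie_i\in\mathfrak{g}$ correspond to each other; likewise $u=\sum_iu^ie_i$ and $U=\sum_iU^ie_i$ are the $\mathfrak{g}$-valued maps corresponding to $\boldsymbol{u}$ and $\boldsymbol{U}$. The zero-mean antiderivative $\boldsymbol{U}$ of $\boldsymbol{u}$ is the $T$-periodic antiderivative with $\int_0^T\boldsymbol{U}=0$. Solutions are understood in the Carathéodory sense. **Stability notions.** $M$ is regarded as an embedded submanifold of Euclidean space with Euclidean norm $|\cdot|$. For $\omega>0$ let $\dot x=f^\omega(t,x)$ be a time-dependent system on $M$ with unique maximal solutions, and for $\omega>0,t\in\mathbb{R}$ let $\phi^\omega_t\colon M\to M$ be bijective, giving the change of variables $\tilde x=\phi^\omega_t(x)$. Let $x_\ast\in M$ and let $S$ be a neighborhood of $x_\ast$ in $M$. - $x_\ast$ is *practically uniformly stable* (in the variables $\tilde x$) if for every $\varepsilon>0$ there exist $\omega_0,\delta>0$ such that for every $\omega\ge\omega_0$, $t_0\in\mathbb{R}$ and $\tilde x_0\in M$ with $|\tilde x_0-x_\ast|\le\delta$, the maximal solution $x$ with $x(t_0)=(\phi^\omega_{t_0})^{-1}(\tilde x_0)$ satisfies (in particular, exists with) $|\phi^\omega_t(x(t))-x_\ast|\le\varepsilon$ for every $t\ge t_0$. - $x_\ast$ is *$S$-practically uniformly attractive* (in the variables $\tilde x$) if for all $r,\varepsilon>0$ there exist $\omega_0,\Delta,\rho>0$ such that for every $\omega\ge\omega_0$, $t_0\in\mathbb{R}$ and $\tilde x_0\in S$ with $|\tilde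 x_0-x_\ast|\le r$, the maximal solution $x$ with $x(t_0)=(\phi^\omega_{t_0})^{-1}(\tilde x_0)$ satisfies $|\phi^\omega_t(x(t))-x_\ast|\le\rho$ for every $t\ge t_0$ and $|\phi^\omega_t(x(t))-x_\ast|\le\varepsilon$ for every $t\ge t_0+\Delta$. - $x_\ast$ is *$S$-practically uniformly asymptotically stable* (in the variables $\tilde x$) if both properties hold; it is *locally practically uniformly asymptotically stable* if this is true for some neighborhood $S$ of $x_\ast$ in $M$. *)

(* Defs.v *)
From HB Require Import structures.
From mathcomp Require Import all_boot all_order all_algebra.
From mathcomp Require Import all_classical all_reals all_analysis.

Set Implicit Arguments.
Unset Strict Implicit.
Unset Printing Implicit Defensive.

Import Order.TTheory GRing.Theory Num.Theory.
Import numFieldNormedType.Exports.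

Local Open Scope classical_set_scope.
Local Open Scope ring_scope.

Fixpoint cont_diff (R : realType) (V W : normedModType R) (k : nat)
    (O : set V) (f : V -> W) : Prop :=
  match k with
  | 0%N => forall x, O x -> {for x, continuous f}
  | k'.+1 => (forall x, O x -> differentiable f x) /\
             (forall v, cont_diff k' O ('D_v f))
  end.

Definition smooth (R : realType) (V W : normedModType R) (O : set V)
    (f : V -> W) : Prop := forall k, cont_diff k O f.

(* Smoothness on an arbitrary subset S of a vector space: near each point of S,
   f coincides on S with a smooth map defined on an open set.  The values of f
   outside S are irrelevant. *)
Definition smooth_on (R : realType) (V W : normedModType R) (S : set V)
    (f : V -> W) : Prop :=
  forall x, S x -> exists (O : set V) (F : V -> W),
    [/\ open O, O x, smooth O F & forall y, O y -> S y -> F y = f y].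

(* S is locally diffeomorphic to open subsets of R^n, for the subspace topology
   and the smoothness notion inherited from R^N. *)
Definition embedded_submanifold (R : realType) (N n : nat)
    (S : set 'rV[R]_N) : Prop :=
  forall x, S x -> exists (O : set 'rV[R]_N) (W : set 'rV[R]_n)
      (phi : 'rV[R]_n -> 'rV[R]_N) (chi : 'rV[R]_N -> 'rV[R]_n),
    [/\ open O /\ O x, open W, smooth W phi /\ smooth_on (O `&` S) chi,
        set_bij W (O `&` S) phi & forall y, W y -> chi (phi y) = y].

Definition curve_through (R : realType) (N : nat) (S : set 'rV[R]_N)
    (x v : 'rV[R]_N) (c : R -> 'rV[R]_N) : Prop :=
  [/\ exists O : set R, [/\ open O, O 0, smooth O c & forall t, O t -> S (c t)],
      c 0 = x & is_derive (0 : R) 1 c v].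

Definition tangent_space (R : realType) (N : nat) (S : set 'rV[R]_N)
    (x : 'rV[R]_N) : set 'rV[R]_N :=
  [set v | exists c, curve_through S x v c].

(* The differential at x of f : S -> W, applied to v in T_x S.  For f smooth on
   an embedded submanifold S the derivative of f along a curve depends only on
   the velocity v of the curve; the value is 0 when v is not tangent. *)
Definition dmap (R : realType) (N : nat) (W : normedModType R)
    (S : set 'rV[R]_N) (f : 'rV[R]_N -> W) (x v : 'rV[R]_N) : W :=
  xget 0 [set w | exists c, curve_through S x v c /\
                            is_derive (0 : R) 1 (f \o c) w].

Definition vector_field (R : realType) (N : nat) (S : set 'rV[R]_N)
    (X : 'rV[R]_N -> 'rV[R]_N) : Prop :=
  smooth_on S X /\ forall x, S x -> tangent_space S x (X x).

Definition deriv_along (R : realType) (N : nat) (S : set 'rV[R]_N)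
    (X : 'rV[R]_N -> 'rV[R]_N) (f : 'rV[R]_N -> R) : 'rV[R]_N -> R :=
  fun x => dmap S f x (X x).

Definition is_lie_bracket (R : realType) (N : nat) (S : set 'rV[R]_N)
    (X Y Z : 'rV[R]_N -> 'rV[R]_N) : Prop :=
  forall (f : 'rV[R]_N -> R), smooth_on S f -> forall x, S x ->
    deriv_along S Z f x = deriv_along S X (deriv_along S Y f) x
                        - deriv_along S Y (deriv_along S X f) x.

Record affine_connection (R : realType) (N : nat) (S : set 'rV[R]_N)
    (nabla : ('rV[R]_N -> 'rV[R]_N) -> ('rV[R]_N -> 'rV[R]_N) ->
             ('rV[R]_N -> 'rV[R]_N)) : Prop := {
  conn_field : forall X Y, vector_field S X -> vector_field S Y ->
    vector_field S (nabla X Y);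
  conn_linl : forall (f : 'rV[R]_N -> R) X X' Y, smooth_on S f ->
    vector_field S X -> vector_field S X' -> vector_field S Y ->
    forall x, S x ->
      nabla (fun y => f y *: X y + X' y) Y x
      = f x *: nabla X Y x + nabla X' Y x;
  conn_addr : forall X Y Y', vector_field S X -> vector_field S Y ->
    vector_field S Y' -> forall x, S x ->
      nabla X (fun y => Y y + Y' y) x = nabla X Y x + nabla X Y' x;
  conn_leibniz : forall (f : 'rV[R]_N -> R) X Y, smooth_on S f ->
    vector_field S X -> vector_field S Y -> forall x, S x ->
      nabla X (fun y => f y *: Y y) x
      = deriv_along S X f x *: Y x + f x *: nabla X Y x
}.

(* [met x v w] is the value of the Riemannian metric at x on v, w in T_x S. *)
Record levi_civita (R : realType) (N : nat) (S : set 'rV[R]_N)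
    (met : 'rV[R]_N -> 'rV[R]_N -> 'rV[R]_N -> R)
    (nabla : ('rV[R]_N -> 'rV[R]_N) -> ('rV[R]_N -> 'rV[R]_N) ->
             ('rV[R]_N -> 'rV[R]_N)) : Prop := {
  lc_connection : affine_connection S nabla;
  lc_torsion_free : forall X Y, vector_field S X -> vector_field S Y ->
    is_lie_bracket S X Y (fun x => nabla X Y x - nabla Y X x);
  lc_metric : forall X Y Z, vector_field S X -> vector_field S Y ->
    vector_field S Z -> forall x, S x ->
      deriv_along S X (fun y => met y (Y y) (Z y)) x
      = met x (nabla X Y x) (Z x) + met x (Y x) (nabla X Z x)
}.

Definition hessian (R : realType) (N : nat) (S : set 'rV[R]_N)
    (nabla : ('rV[R]_N -> 'rV[R]_N) -> ('rV[R]_N -> 'rV[R]_N) ->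
             ('rV[R]_N -> 'rV[R]_N))
    (f : 'rV[R]_N -> R) (X Y : 'rV[R]_N -> 'rV[R]_N) : 'rV[R]_N -> R :=
  fun x => deriv_along S X (deriv_along S Y f) x
           - deriv_along S (nabla X Y) f x.

(* The Hessian is tensorial, so positive definiteness on T_x S is tested on
   arbitrary vector fields extending the tangent vectors at x. *)
Definition hessian_posdef_at (R : realType) (N : nat) (S : set 'rV[R]_N)
    (nabla : ('rV[R]_N -> 'rV[R]_N) -> ('rV[R]_N -> 'rV[R]_N) ->
             ('rV[R]_N -> 'rV[R]_N))
    (f : 'rV[R]_N -> R) (x : 'rV[R]_N) : Prop :=
  forall X, vector_field S X -> X x != 0 -> 0 < hessian S nabla f X X x.

(* The operations are total on the ambient space; only their restrictions to
   the carrier are meaningful. *)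
Record closedLieGroup (R : realType) (N n : nat) := ClosedLieGroup {
  lg_set :> set 'rV[R]_N;
  lg_one : 'rV[R]_N;
  lg_mul : 'rV[R]_N -> 'rV[R]_N -> 'rV[R]_N;
  lg_inv : 'rV[R]_N -> 'rV[R]_N;
  lg_closed : closed lg_set;
  lg_submanifold : embedded_submanifold n lg_set;
  lg_oneP : lg_set lg_one;
  lg_mulP : forall x y, lg_set x -> lg_set y -> lg_set (lg_mul x y);
  lg_invP : forall x, lg_set x -> lg_set (lg_inv x);
  lg_mulA : forall x y z, lg_set x -> lg_set y -> lg_set z ->
    lg_mul x (lg_mul y z) = lg_mul (lg_mul x y) z;
  lg_mul1 : forall x, lg_set x -> lg_mul lg_one x = x;
  lg_mulr1 : forall x, lg_set x -> lg_mul x lg_one = x;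
  lg_mulV : forall x, lg_set x -> lg_mul (lg_inv x) x = lg_one;
  lg_mulrV : forall x, lg_set x -> lg_mul x (lg_inv x) = lg_one;
  lg_mul_smooth : smooth_on (lg_set `*` lg_set)
    (fun p : 'rV[R]_N * 'rV[R]_N => lg_mul p.1 p.2);
  lg_inv_smooth : smooth_on lg_set lg_inv
}.

Definition lie_algebra (R : realType) (N n : nat) (G : closedLieGroup R N n) :
    set 'rV[R]_N := tangent_space G (lg_one G).

Definition dleft (R : realType) (N n : nat) (G : closedLieGroup R N n)
    (g x v : 'rV[R]_N) : 'rV[R]_N := dmap G (lg_mul G g) x v.

Definition left_field (R : realType) (N n : nat) (G : closedLieGroup R N n)
    (v : 'rV[R]_N) : 'rV[R]_N -> 'rV[R]_N := fun g => dleft G g (lg_one G) v.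

Record inner_product_on (R : realType) (N : nat) (E : set 'rV[R]_N)
    (ip : 'rV[R]_N -> 'rV[R]_N -> R) : Prop := {
  ip_sym : forall x y, E x -> E y -> ip x y = ip y x;
  ip_lin : forall (k : R) x y z, E x -> E y -> E z ->
    ip (k *: x + y) z = k * ip x z + ip y z;
  ip_pos : forall x, E x -> x != 0 -> 0 < ip x x
}.

Record sym_psd_endo (R : realType) (N : nat) (E : set 'rV[R]_N)
    (ip : 'rV[R]_N -> 'rV[R]_N -> R) (A : 'rV[R]_N -> 'rV[R]_N) : Prop := {
  endo_stable : forall x, E x -> E (A x);
  endo_lin : forall (k : R) x y, E x -> E y -> A (k *: x + y) = k *: A x + A y;
  endo_sym : forall x y, E x -> E y -> ip (A x) y = ip x (A y);
  endo_psd : forall x, E x -> 0 <= ip (A x) x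
}.

Definition orthonormal_basis (R : realType) (N n : nat) (E : set 'rV[R]_N)
    (ip : 'rV[R]_N -> 'rV[R]_N -> R) (e : 'I_n -> 'rV[R]_N) : Prop :=
  [/\ forall i, E (e i), forall i j, ip (e i) (e j) = (i == j)%:R
    & forall x, E x -> exists w : 'rV[R]_n, x = \sum_i w 0 i *: e i].

(* The left-invariant metric: <T_e L_g v, T_e L_g w>_g = ip v w. *)
Definition left_metric (R : realType) (N n : nat) (G : closedLieGroup R N n)
    (ip : 'rV[R]_N -> 'rV[R]_N -> R) : 'rV[R]_N -> 'rV[R]_N -> 'rV[R]_N -> R :=
  fun g x y => ip (dleft G (lg_inv G g) g x) (dleft G (lg_inv G g) g y).

Definition lie_algebra_connection (R : realType) (N n : nat)
    (G : closedLieGroup R N n)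
    (nabla : ('rV[R]_N -> 'rV[R]_N) -> ('rV[R]_N -> 'rV[R]_N) ->
             ('rV[R]_N -> 'rV[R]_N))
    (gnabla : 'rV[R]_N -> 'rV[R]_N -> 'rV[R]_N) : Prop :=
  forall v w, lie_algebra G v -> lie_algebra G w ->
    lie_algebra G (gnabla v w) /\
    forall g, lg_set G g -> dleft G g (lg_one G) (gnabla v w)
                     = nabla (left_field G v) (left_field G w) g.

Definition abs_continuous (R : realType) (V : normedModType R) (a b : R)
    (x : R -> V) : Prop :=
  forall eps : R, 0 < eps -> exists2 del : R, 0 < del &
    forall (m : nat) (l r : 'I_m -> R),
      (forall k, [/\ a <= l k, l k <= r k & r k <= b]) ->
      trivIset setT (fun k => `]l k, r k[%classic) ->
      \sum_k (r k - l k) < del -> \sum_k `|x (r k) - x (l k)| < eps.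

Definition solution (R : realType) (K : nat) (M : set 'rV[R]_K)
    (f : R -> 'rV[R]_K -> 'rV[R]_K) (t0 : R) (x0 : 'rV[R]_K)
    (J : set R) (x : R -> 'rV[R]_K) : Prop :=
  [/\ [/\ open J, is_interval J & J t0],
      forall t, J t -> M (x t),
      x t0 = x0,
      forall a b, a <= b -> `[a, b] `<=` J -> abs_continuous a b x
    & {ae lebesgue_measure, forall t, J t -> is_derive t 1 x (f t (x t))}].

Definition maximal_solution (R : realType) (K : nat) (M : set 'rV[R]_K)
    (f : R -> 'rV[R]_K -> 'rV[R]_K) (t0 : R) (x0 : 'rV[R]_K)
    (J : set R) (x : R -> 'rV[R]_K) : Prop :=
  solution M f t0 x0 J x /\
  forall (J' : set R) (y : R -> 'rV[R]_K), solution M f t0 x0 J' y ->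
    J `<=` J' -> (forall t, J t -> y t = x t) -> J' = J.

(* "The maximal solution with value x0 at time t0 satisfies P": there is exactly
   one maximal solution (J, x), where x only matters on J, and P J x holds. *)
Definition the_maximal_solution (R : realType) (K : nat) (M : set 'rV[R]_K)
    (f : R -> 'rV[R]_K -> 'rV[R]_K) (t0 : R) (x0 : 'rV[R]_K)
    (P : set R -> (R -> 'rV[R]_K) -> Prop) : Prop :=
  exists (J : set R) (x : R -> 'rV[R]_K),
    [/\ maximal_solution M f t0 x0 J x,
        forall (J' : set R) (y : R -> 'rV[R]_K),
          maximal_solution M f t0 x0 J' y ->
          J' = J /\ forall t, J t -> y t = x t
      & P J x].

(* The norm of 'rV[R]_K in the library is the maximum norm. *)
Definition enorm (R : realType) (K : nat) (x : 'rV[R]_K) : R :=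
  Num.sqrt (\sum_i x 0 i ^+ 2).

(* In the definitions below, [f om t x] is the vector field with parameter om
   and [phi om t] is a bijection of M giving the change of variables. *)
Section PracticalStability.
Context (R : realType) (K : nat) (M : set 'rV[R]_K)
  (f phi : R -> R -> 'rV[R]_K -> 'rV[R]_K) (xs : 'rV[R]_K).

(* [x0] is the preimage of [xt0] under the bijection [phi om t0] of M. *)
Definition from_transformed (om t0 : R) (xt0 : 'rV[R]_K)
    (P : set R -> (R -> 'rV[R]_K) -> Prop) : Prop :=
  exists x0, [/\ M x0, phi om t0 x0 = xt0 &
                 the_maximal_solution M (f om) t0 x0 P].

Definition practically_uniformly_stable : Prop :=
  forall eps : R, 0 < eps -> exists om0 del : R, [/\ 0 < om0, 0 < del &
    forall (om t0 : R) (xt0 : 'rV[R]_K), om0 <= om -> M xt0 ->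
      enorm (xt0 - xs) <= del ->
      from_transformed om t0 xt0 (fun J x => forall t, t0 <= t ->
        J t /\ enorm (phi om t (x t) - xs) <= eps)].

Definition practically_uniformly_attractive (S : set 'rV[R]_K) : Prop :=
  forall r eps : R, 0 < r -> 0 < eps -> exists om0 Del rho : R,
    [/\ 0 < om0, 0 < Del, 0 < rho &
    forall (om t0 : R) (xt0 : 'rV[R]_K), om0 <= om -> S xt0 ->
      enorm (xt0 - xs) <= r ->
      from_transformed om t0 xt0 (fun J x =>
        (forall t, t0 <= t -> J t /\ enorm (phi om t (x t) - xs) <= rho) /\
        (forall t, t0 + Del <= t -> enorm (phi om t (x t) - xs) <= eps))].

Definition practically_uniformly_asymptotically_stable (S : set 'rV[R]_K) :
    Prop :=
  practically_uniformly_stable /\ practically_uniformly_attractive S.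

Definition locally_practically_uniformly_asymptotically_stable : Prop :=
  exists S : set 'rV[R]_K, [/\ S `<=` M, S xs, within M (nbhs xs) S
    & practically_uniformly_asymptotically_stable S].

End PracticalStability.

(* Measurability and integrals of inputs are with respect to the Lebesgue
   (completed) sigma-algebra; [measurable_fun] on R itself would mean Borel. *)
Definition lebesgue_measurable_fun (R : realType) (f : R -> R) : Prop :=
  measurable_fun (T := caratheodory_type (mu_ext (@wlength R idfun)))
    (U := measurableTypeR R) setT f.

Definition lebesgue_integral_on (R : realType) (a b : R) (f : R -> R) : R :=
  Rintegral (@completed_lebesgue_measure R) `[a, b]%classic f.

Definition zero_mean_antiderivative (R : realType) (n : nat) (T : R)
    (u U : R -> 'rV[R]_n) : Prop :=
  [/\ forall t, U (t + T) = U t,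
      forall s t i, s <= t ->
        U t 0 i - U s 0 i = lebesgue_integral_on s t (fun x => u x 0 i)
    & forall i, lebesgue_integral_on 0 T (fun x => U x 0 i) = 0].

(* A state (g, v, w, eta) is stored as a row vector of R^N x R^N x R^n x R, the
   Lie algebra being the tangent space at the identity, a subspace of R^N. *)
Definition st (R : realType) (N n : nat) (g v : 'rV[R]_N) (w : 'rV[R]_n)
    (eta : R) : 'rV[R]_(N + N + (n + 1)) :=
  row_mx (row_mx g v) (row_mx w eta%:M).

Definition st_g (R : realType) (N n : nat) (x : 'rV[R]_(N + N + (n + 1))) :
  'rV[R]_N := lsubmx (lsubmx x).
Definition st_v (R : realType) (N n : nat) (x : 'rV[R]_(N + N + (n + 1))) :
  'rV[R]_N := rsubmx (lsubmx x).
Definition st_w (R : realType) (N n : nat) (x : 'rV[R]_(N + N + (n + 1))) :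
  'rV[R]_n := lsubmx (rsubmx x).
Definition st_eta (R : realType) (N n : nat) (x : 'rV[R]_(N + N + (n + 1))) :
  R := rsubmx (rsubmx x) 0 0.

Definition state_space (R : realType) (N n : nat) (G : closedLieGroup R N n) :
    set 'rV[R]_(N + N + (n + 1)) :=
  [set x | lg_set G (st_g x) /\ lie_algebra G (st_v x)].

Definition in_basis (R : realType) (N n : nat) (e : 'I_n -> 'rV[R]_N)
    (w : 'rV[R]_n) : 'rV[R]_N := \sum_i w 0 i *: e i.

Definition closed_loop (R : realType) (N n : nat) (G : closedLieGroup R N n)
    (gnabla : 'rV[R]_N -> 'rV[R]_N -> 'rV[R]_N) (Rd : 'rV[R]_N -> 'rV[R]_N)
    (e : 'I_n -> 'rV[R]_N) (psi : 'rV[R]_N -> R) (alpha : R -> R)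
    (u U : R -> 'rV[R]_n) (a lam b kap h : R) (om t : R)
    (x : 'rV[R]_(N + N + (n + 1))) : 'rV[R]_(N + N + (n + 1)) :=
  let g := st_g x in let v := st_v x in
  let w := st_w x in let eta := st_eta x in
  let A := alpha (psi g - eta) in
  let mu := \sum_i gnabla (e i) (e i) in
  st (dleft G g (lg_one G) v)
     (- gnabla v v - Rd v
      - b *: (in_basis e w - (kap * A) *: in_basis e (U (om * t)))
      + (lam * A * om) *: in_basis e (u (om * t))
      + (lam ^+ 2 * A ^+ 2) *: mu)
     (- (a *: (w - (kap * A) *: U (om * t))) + (kap * A * om) *: u (om * t))
     (- (h * eta) + h * psi g).

Definition change_of_variables (R : realType) (N n : nat)
    (e : 'I_n -> 'rV[R]_N) (psi : 'rV[R]_N -> R) (alpha : R -> R)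
    (U : R -> 'rV[R]_n) (lam kap : R) (om t : R)
    (x : 'rV[R]_(N + N + (n + 1))) : 'rV[R]_(N + N + (n + 1)) :=
  let g := st_g x in let v := st_v x in
  let w := st_w x in let eta := st_eta x in
  let A := alpha (psi g - eta) in
  st g (v - (lam * A) *: in_basis e (U (om * t)))
     (w - (kap * A) *: U (om * t)) eta.

(* Main.v *)
(* In the transformed variables the terms of order omega cancel, because U' = u, and in a chart of G
   around g_* the system takes the form z' = f0(z) + sum_k c_k(omega t) Y_k(z) with bounded periodic
   zero-mean coefficients c_k = U^i, U^i U^j - delta_ij.  The terms quadratic in U contribute to f0 a
   multiple of the gradient of psi, so that f0 linearizes at the origin to
     x' = v,  v' = - v R - b w - lam^2 beta x H,  w' = - a w - kap lam beta x H,  eta' = - h eta,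
   where H is the Hessian of psi at g_* and beta = alpha(0) alpha'(0) > 0.  A quadratic form V, whose
   construction uses a lam - b kap > 0, decays along this linear system, and
   V - omega^-1 sum_k C_k(omega t) DV.Y_k with C_k' = c_k decays, up to an error of order 1/omega, along
   the full system near the origin.  Picard iteration gives solutions in the chart; they are lifted
   to M and identified with the maximal solutions by uniqueness of Caratheodory solutions. *)
Require Import Defs.
From HB Require Import structures.
From mathcomp Require Import all_boot all_order all_algebra.
From mathcomp Require Import all_classical all_reals all_analysis.
From mathcomp Require Import measurable_realfun ring lra.

Set Implicit Arguments.
Unset Strict Implicit.
Unset Printing Implicit Defensive.

Import Order.TTheory GRing.Theory Num.Theory.
Import numFieldNormedType.Exports.

Local Open Scope classical_set_scope.
Local Open Scope ring_scope.

(** * Derivatives along a direction *)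

(** In the transformed variables time enters only through U, which is Lipschitz, so the chart
    solutions are classical and are differentiable at every time. The input u, merely measurable and
    bounded, returns when they are lifted to M: the lift is still Lipschitz in time and satisfies
    the equation at almost every time. Orthonormality of the U^i produces both means that matter.
    The mean of nabla_U U is mu, which the term in lam^2 alpha^2 mu compensates, and the mean of
    d(alpha)(U) U is what turns measurements of psi into its gradient. The primitives C_k are
    periodic, hence bounded for all times, which makes every estimate uniform in t0. Since R may
    vanish, the velocity may have no damping of its own. The filter variable w is the one that is
    damped in every case, and small cross terms in the Lyapunov form pass this damping on to g and
    v. Only the component in G needs a chart, because the Lie algebra is a linear space with
    coordinates given by the e_i. *)

Section is_derive_pointwise.
Context {R : realType} {V W : normedModType R}.
Implicit Types (f g : V -> W) (x v : V).

Lemma isd_add f g x v df dg : is_derive x v f df -> is_derive x v g dg ->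
  is_derive x v (fun y => f y + g y) (df + dg).
Proof. by move=> ? ?; exact: is_deriveD. Qed.

Lemma isd_opp f x v df : is_derive x v f df -> is_derive x v (fun y => - f y) (- df).
Proof. by move=> ?; exact: is_deriveN. Qed.

Lemma isd_sub f g x v df dg : is_derive x v f df -> is_derive x v g dg ->
  is_derive x v (fun y => f y - g y) (df - dg).
Proof. by move=> ? ?; exact: is_deriveB. Qed.

Lemma isd_scale f k x v df : is_derive x v f df ->
  is_derive x v (fun y => k *: f y) (k *: df).
Proof. by move=> ?; exact: is_deriveZ. Qed.

Lemma isd_cst (a : W) x v : is_derive x v (fun _ => a) 0.
Proof. exact: is_derive_cst. Qed.

Lemma isd_sum (I : Type) (r : seq I) (P : pred I) (F : I -> V -> W) (dF : I -> W) x v :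
  (forall i, P i -> is_derive x v (F i) (dF i)) ->
  is_derive x v (fun y => \sum_(i <- r | P i) F i y) (\sum_(i <- r | P i) dF i).
Proof.
move=> H; elim: r => [|i r IH].
  rewrite big_nil; under [X in is_derive _ _ X]eq_fun do rewrite big_nil.
  exact: isd_cst.
rewrite big_cons; under [X in is_derive _ _ X]eq_fun do rewrite big_cons.
by case: (boolP (P i)) => // Pi; apply: isd_add => //; exact: H.
Qed.

Lemma isd_eq f x v df df' : is_derive x v f df -> df = df' -> is_derive x v f df'.
Proof. by move=> ? <-. Qed.

Lemma isd_unique f x v df df' : is_derive x v f df -> is_derive x v f df' -> df = df'.
Proof. by move=> [_ <-] [_ <-]. Qed.

Lemma isd_near f g x v df : (\forall y \near x, f y = g y) -> is_derive x v f df ->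
  is_derive x v g df.
Proof. exact: near_eq_is_derive. Qed.

Lemma isd_diff f x v : differentiable f x -> is_derive x v f ('d f x v).
Proof. by move=> df; rewrite -deriveE//; apply/derivableP/diff_derivable. Qed.

Lemma isd_diffE f x v df : differentiable f x -> is_derive x v f df -> 'd f x v = df.
Proof. by move=> dfx; exact: isd_unique (isd_diff v dfx). Qed.

End is_derive_pointwise.

Section is_derive_mul.
Context {R : realType} {V W : normedModType R}.

Lemma isd_mul (f g : V -> R) x v df dg : is_derive x v f df -> is_derive x v g dg ->
  is_derive x v (fun y => f y * g y) (f x * dg + df * g x).
Proof.
move=> H1 H2; have H := @is_deriveM _ _ f g x v df dg H1 H2.
by rewrite [df * _]mulrC; exact H.
Qed.

Lemma isd_mull (k : R) (f : V -> R) x v df : is_derive x v f df ->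
  is_derive x v (fun y => k * f y) (k * df).
Proof. by move=> H; exact: isd_scale. Qed.

Lemma isd_id (x v : V) : is_derive x v (fun y => y) v.
Proof. exact: is_derive_id. Qed.

(** The inner map is only derivable in the direction [w], so the chain rule for differentiable maps
    is applied to its restriction [l] to a line, where derivable and differentiable agree. *)
Lemma isd_comp {U : normedModType R} (f : V -> W) (c : U -> V) (t w : U) (dc : V) :
  differentiable f (c t) -> is_derive t w c dc ->
  is_derive t w (fun s => f (c s)) ('d f (c t) dc).
Proof.
move=> df [dc1 dc2].
pose l (s : R) := c (s *: w + t).
have dl : differentiable l 0.
  apply/derivable1_diffP; move/derivable1P : dc1.
  by [].
have l0 : l 0 = c t by rewrite /l scale0r add0r.
have dl0 : 'D_1 l 0 = dc.
  rewrite -dc2 /derive /l; congr (lim (_ @ 0^')); apply/funext => h /=.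
  by rewrite /= addr0 scale0r add0r [h *: 1]mulr1.
have dfl : differentiable (f \o l) 0 by apply: differentiable_comp => //; rewrite l0.
have dfc : derivable (fun s => f (c s)) t w.
  apply/derivable1P; exact: diff_derivable.
apply: DeriveDef => //.
have -> : 'D_w (fun s => f (c s)) t = 'D_1 (f \o l) 0.
  rewrite /derive /l; congr (lim (_ @ 0^')); apply/funext => h /=.
  by rewrite /= addr0 scale0r add0r [h *: 1]mulr1.
rewrite deriveE// diff_comp ?l0//=.
by rewrite -dl0 deriveE.
Qed.

Lemma isd_continuous (f : R -> V) (t : R) df : is_derive t 1 f df -> {for t, continuous f}.
Proof. by move=> [+ _] => /derivable1_diffP; exact: differentiable_continuous. Qed.
End is_derive_mul.

Section is_derive_mx.
Context {R : realType} {V : normedModType R} {m n : nat}.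

Lemma isd_coord (M : V -> 'M[R]_(m, n)) t v dM i j : is_derive t v M dM ->
  is_derive t v (fun s => M s i j) (dM i j).
Proof.
move=> [dM1 dM2]; have /derivable_mxP/(_ i j) H := dM1.
by apply: DeriveDef => //; rewrite -dM2 derive_mx// mxE.
Qed.

Lemma isd_mx (M : V -> 'M[R]_(m, n)) t v (dM : 'M[R]_(m, n)) :
  (forall i j, is_derive t v (fun s => M s i j) (dM i j)) -> is_derive t v M dM.
Proof.
move=> H; have d : derivable M t v by apply/derivable_mxP => i j; case: (H i j).
by apply: DeriveDef => //; rewrite derive_mx//; apply/matrixP => i j; rewrite mxE; case: (H i j).
Qed.
End is_derive_mx.

Section is_derive_scalel.
Context {R : realType} {V W : normedModType R}.
Lemma isd_scalel (k : R -> R) (f : R -> W) (t : R) (dk : R) df :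
  is_derive t 1 k dk -> is_derive t 1 f df ->
  is_derive t 1 (fun y => k y *: f y) (k t *: df + dk *: f t).
Proof.
move=> [k1 k2] [f1 f2].
have cv : (fun h => h^-1 *: (k (h *: 1 + t) *: f (h *: 1 + t) - k t *: f t)) @ 0^'
    --> k t *: df + dk *: f t.
  have E h : h^-1 *: (k (h *: 1 + t) *: f (h *: 1 + t) - k t *: f t) =
      k (h *: 1 + t) *: (h^-1 *: (f (h *: 1 + t) - f t)) +
      (h^-1 *: (k (h *: 1 + t) - k t)) *: f t.
    rewrite [h^-1 *: (k _ - _)]/GRing.scale/= !scalerBr !scalerA mulrBr scalerBl.
    by rewrite (mulrC (k _) h^-1) addrA subrK.
  under eq_cvg do rewrite E.
  apply: cvgD.
    apply: cvgZ; last by rewrite -f2; exact: f1.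
    have ck : {for t, continuous k}.
      by apply: differentiable_continuous; apply/derivable1_diffP.
    have : (h *: 1 + t : R) @[h --> (0:R)^'] --> t.
      apply: cvg_within_filter.
      have : (h *: 1 + t : R) @[h --> (0:R)] --> (0 : R) *: (1:R) + t.
        apply: cvgD; last exact: cvg_cst.
        by apply: cvgZr_tmp; exact: cvg_id.
      by rewrite scale0r add0r.
    by move=> H; apply: (cvg_comp _ _ H).
  by apply: cvgZr_tmp; rewrite -k2; exact: k1.
apply: DeriveDef.
  by apply/cvg_ex; eexists; exact: cv.
by apply/cvg_lim => //.
Qed.
End is_derive_scalel.

(** * Integrals for the completed Lebesgue measure *)

Section completed_integral.
Context {R : realType}.
Notation cT := (caratheodory_type (mu_ext (@wlength R idfun))).
Notation mu := (@lebesgue_measure R).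
Notation cmu := (@completed_lebesgue_measure R).

Lemma borel_completed_measurable (A : set R) :
  (measurable (A : set (measurableTypeR R))) -> measurable (A : set cT).
Proof. exact: sub_caratheodory. Qed.

Lemma measurable_fun_id_completed :
  measurable_fun (T := cT) (U := measurableTypeR R) setT idfun.
Proof. by move=> _ A mA; rewrite setTI preimage_id; exact: borel_completed_measurable. Qed.

(** The identity is measurable from the completed to the Borel sigma-algebra and pushes the
    completed measure forward to Lebesgue measure. *)
Lemma ge0_completed_integral (D : set R) (f : measurableTypeR R -> \bar R) :
  (measurable (D : set (measurableTypeR R))) ->
  (measurable_fun (T := measurableTypeR R) D f) -> (forall x, (0 <= f x)%E) ->
  (\int[cmu]_(x in D) f x = \int[mu]_(x in D) f x)%E.
Proof.
move=> mD mf f0.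
have := @ge0_integral_pushforward _ _ cT (measurableTypeR R) R idfun
  measurable_fun_id_completed cmu D f mD mf (fun x _ => f0 x).
rewrite preimage_id => <-.
apply: (eq_measure_integral mu); first exact: measurable_fun_id_completed.
move=> mid A mA _; reflexivity.
Qed.

Lemma completed_integral (D : set R) (f : measurableTypeR R -> \bar R) :
  (measurable (D : set (measurableTypeR R))) ->
  (measurable_fun (T := measurableTypeR R) D f) ->
  (\int[cmu]_(x in D) f x = \int[mu]_(x in D) f x)%E.
Proof.
move=> mD mf; rewrite integralE [RHS]integralE.
rewrite ge0_completed_integral//; last exact: measurable_funepos.
by rewrite ge0_completed_integral//; exact: measurable_funeneg.
Qed.

Lemma lebesgue_integral_onE (a b : R) (f : R -> R) :
  measurable_fun (T := measurableTypeR R) (U := measurableTypeR R) setT f ->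
  lebesgue_integral_on a b f = \int[mu]_(x in `[a, b]) f x.
Proof.
move=> mf; rewrite /lebesgue_integral_on /Rintegral completed_integral//.
by apply/measurable_EFinP; exact: measurable_funTS.
Qed.

(* Each superlevel set at a rational height is Borel up to a null set; [u] is
   set to 0 on the union of these null sets. *)
Lemma lebesgue_measurable_borel_version (u : R -> R) :
  lebesgue_measurable_fun u ->
  exists (v : R -> R) (N : set R), [/\
    measurable_fun (T := measurableTypeR R) (U := measurableTypeR R) setT v,
    measurable (N : set (measurableTypeR R)), mu N = 0%E,
    forall x, ~ N x -> v x = u x & forall x, `|v x| <= `|u x| ].
Proof.
move=> mu_.
(* The heights are enumerated through [unpickle]; an index that codes no rational falls back on the
   height 0, which only repeats a condition. *)
have H (k : nat) : exists BN : set R * set R, [/\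
    measurable (BN.1 : set (measurableTypeR R)),
    measurable (BN.2 : set (measurableTypeR R)), mu BN.2 = 0%E &
    forall x, ~ BN.2 x -> (ratr (odflt 0 (unpickle k : option rat)) < u x) <-> BN.1 x].
  set q := odflt _ _.
  have : (completed_algebra_gen mu).-sigma.-measurable [set x | ratr q < u x].
    rewrite completed_caratheodory_measurable.
    have -> : [set x | ratr q < u x] = setT `&` u @^-1` `]ratr q, +oo[.
      by rewrite setTI; apply/seteqP; split=> x /=; rewrite in_itv/= andbT.
    exact: mu_.
  rewrite g_sigma_completed_algebra_genE.
  move=> [A mA [N0 [N [mN N0' NN]] E]].
  exists (A, N); split => // x /= nN.
  have -> : (is_true (ratr q < u x)) = [set x | ratr q < u x] x by [].
  rewrite -E; split; last by left.
  by case=> // /NN.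
have [BN BNP] := choice H.
pose N := \bigcup_(i in [set: nat]) (BN i).2.
have mN : measurable (N : set (measurableTypeR R)).
  apply: (@bigcup_measurable _ (measurableTypeR R) (fun i => (BN i).2) setT) => k _.
  have [_ mk _ _] := BNP k. exact mk.
have N0 : mu N = 0%E.
  apply: (measure_negligible mN); apply: negligible_bigcup => k.
  have [_ mk k0 _] := BNP k.
  by exists (BN k).2; split; [exact mk|exact k0|].
pose v x := if pselect (N x) then 0 else u x.
exists v, N; split => //.
- have mS c : measurable ([set x | c < u x] `\` N : set (measurableTypeR R)).
    have -> : [set x | c < u x] `\` N = 
        (\bigcup_(k in [set k | c <= ratr (odflt 0 (unpickle k : option rat))]) (BN k).1) `\` N.
      apply/seteqP; split=> x /= [cu nN]; split => //.
        have [q /andP[cq qu]] := rat_in_itvoo cu.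
        exists (pickle q) => /=; first by rewrite pickleK/= ltW.
        have [_ _ _ /(_ x)] := BNP (pickle q).
        rewrite pickleK/= => -[|Bx _]; last exact: Bx.
        by move=> Nx; apply: nN; exists (pickle q).
      case: cu => k /= ck Bx.
      have [_ _ _ /(_ x)] := BNP k => -[|_ /(_ Bx)]; last exact: le_lt_trans.
      by move=> Nx; apply: nN; exists k.
    apply: measurableD => //.
    apply: (@bigcup_measurable _ (measurableTypeR R) (fun i => (BN i).1)) => k _.
    have [mk _ _ _] := BNP k. exact mk.
  apply: (measurability _ (RGenOInfty.measurableE R)) => _ [_ [c ->] <-].
  rewrite setTI.
  (* Since [v] vanishes on [N], the set [N] lies outside the superlevel set for [0 <= c] and inside
     it for [c < 0]. *)
  have [c0|c0] := leP 0 c.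
    have E : [set x | c < u x] `\` N = v @^-1` `]c, +oo[.
      apply/seteqP; split=> x /=; rewrite /v in_itv/= andbT; case: pselect => /= Nx.
      - by case.
      - by case.
      - by move=> /(le_lt_trans c0); rewrite ltxx.
      - by [].
    by have := mS c; rewrite E => H'; exact H'.
  have E : ([set x | c < u x] `\` N) `|` N = v @^-1` `]c, +oo[.
    apply/seteqP; split=> x /=; rewrite /v in_itv/= andbT; case: pselect => /= Nx.
    - by [].
    - by case=> // -[].
    - by right.
    - by left.
  by have := measurableU _ _ (mS c) mN; rewrite E => H'; exact H'.
- by move=> x nN; rewrite /v; case: pselect => /=.
- by move=> x; rewrite /v; case: pselect => //= _; rewrite normr0.
Qed.
End completed_integral.

Section primitives.
Context {R : realType}.
Notation mu := (@lebesgue_measure R).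

Lemma itv_Rintegral_add (f : R -> R) (a b c : R) : a <= b -> b <= c ->
  mu.-integrable `[a, c] (EFin \o f) ->
  \int[mu]_(x in `[a, c]) f x = 
  \int[mu]_(x in `[a, b]) f x + \int[mu]_(x in `[b, c]) f x.
Proof.
move=> ab bc fi.
have /(_ b) := Rintegral_itvB fi; rewrite !bnd_simp => /(_ ab bc) H.
rewrite -(@Rintegral_itv_obnd_cbnd _ b (BRight c)) -?H; first by lra.
by apply: integrableS fi => //=; apply: subset_itvr; rewrite bnd_simp.
Qed.

Lemma Rintegral_primitive (f : R -> R) : 
  (forall a b, mu.-integrable `[a, b] (EFin \o f)) ->
  exists F : R -> R, forall s t, s <= t -> \int[mu]_(x in `[s, t]) f x = F t - F s.
Proof.
move=> fi.
pose I a b := \int[mu]_(x in `[a, b]) f x.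
exists (fun t => if 0 <= t then I 0 t else - I t 0) => s t st; rewrite -/(I s t).
have [s0|s0] := leP 0 s.
  rewrite (le_trans s0 st) /I (@itv_Rintegral_add _ 0 s t)//; lra.
have [t0|t0] := leP 0 t.
  rewrite /I (@itv_Rintegral_add _ s 0 t)//; [lra|exact: ltW].
rewrite /I (@itv_Rintegral_add _ s t 0)//; [lra|exact: ltW].
Qed.

Lemma bounded_itv_integrable (f : R -> R) (C : R) :
  measurable_fun (T := measurableTypeR R) (U := measurableTypeR R) setT f ->
  (forall x, `|f x| <= C) ->
  forall a b, mu.-integrable `[a, b] (EFin \o f).
Proof.
move=> mf fC a b; apply: measurable_bounded_integrable => //.
- by rewrite /= lebesgue_measure_itv; case: ifP => // _; rewrite -EFinB ltry.
- exact: measurable_funTS.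
- exists C; split; first exact: num_real.
  by move=> M CM x _; apply: le_trans (fC x) (ltW CM).
Qed.

(** Near [t] the primitive based at [t - 1] differs from the global one by a constant, so the
    fundamental theorem on a window around [t] suffices. *)
Lemma continuous_primitive (f : R -> R) : continuous f ->
  exists F : R -> R, (forall t : R, is_derive t 1 F (f t)) /\
    forall s t, s <= t -> lebesgue_integral_on s t f = F t - F s.
Proof.
move=> cf.
have mf : measurable_fun (T := measurableTypeR R) (U := measurableTypeR R) setT f.
  exact: continuous_measurable_fun.
have fi a b : mu.-integrable `[a, b] (EFin \o f).
  apply: continuous_compact_integrable; first exact: segment_compact.
  exact: continuous_subspaceT.
have [F FE] := Rintegral_primitive fi.
exists F; split=> [t|s t st]; last by rewrite lebesgue_integral_onE// FE.
have t1 : t - 1 < t by rewrite ltrBlDr ltrDl.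
have t2 : t < t + 1 by rewrite ltrDl.
have [dF F'] := @continuous_FTC1_closed R f (t - 1) t (t + 1) t2 (fi _ _) t1 (cf t).
set G := (fun x => _) in dF F'.
apply: (@near_eq_is_derive _ _ _ (fun x => G x + F (t - 1))).
  near=> x; rewrite /G FE ?subrK//.
  by apply: ltW; near: x; exact: lt_nbhsr.
rewrite -[f t]addr0; apply: (isd_add (f := G)).
by rewrite -F' derive1E; exact: derivableP.
Unshelve. all: by end_near. Qed.

Lemma ae_lebesgue_nat (P : nat -> R -> Prop) :
  (forall k, {ae mu, forall x, P k x}) -> {ae mu, forall x, forall k, P k x}.
Proof.
move=> H; have : mu.-negligible (\bigcup_k ~` [set x | P k x]).
  by apply: negligible_bigcup => k; exact: H.
apply: negligibleS => x /= /existsNP [k nk]; by exists k.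
Qed.

(* [u] may be modified on a null set to a Borel function without changing its integrals. *)
Lemma lebesgue_integral_on_borel_version (u v : R -> R) (N : set R) :
  lebesgue_measurable_fun u ->
  measurable_fun (T := measurableTypeR R) (U := measurableTypeR R) setT v ->
  measurable (N : set (measurableTypeR R)) -> mu N = 0%E ->
  (forall x, ~ N x -> v x = u x) ->
  forall s t, lebesgue_integral_on s t u = \int[mu]_(x in `[s, t]) v x.
Proof.
move=> mu_ mv mN N0 vu s t; rewrite -lebesgue_integral_onE//.
rewrite /lebesgue_integral_on /Rintegral; congr fine.
apply: ae_eq_integral.
- exact: borel_completed_measurable.
- by apply/measurable_EFinP; apply: measurable_funTS.
- apply/measurable_EFinP; apply: measurable_funTS => _ A mA.
  by rewrite setTI; apply: borel_completed_measurable; rewrite -[_ @^-1` _]setTI; exact: mv.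
- exists N; split; [exact: borel_completed_measurable|exact: N0|].
  move=> x /= H; apply: contrapT => nN; apply: H => _.
  by rewrite vu.
Qed.

Lemma lebesgue_integral_on_bound (u : R -> R) (C : R) : lebesgue_measurable_fun u ->
  (forall x, `|u x| <= C) ->
  forall s t, s <= t -> `|lebesgue_integral_on s t u| <= C * (t - s).
Proof.
move=> mu_ uC s t st.
have [v [N [mv mN N0 vu vle]]] := lebesgue_measurable_borel_version mu_.
rewrite (lebesgue_integral_on_borel_version mu_ mv mN N0 vu).
have vC x : `|v x| <= C by exact: le_trans (vle x) (uC x).
have vi := bounded_itv_integrable mv vC.
apply: le_trans (le_normr_Rintegral _ (vi _ _)) _ => //.
have -> : C * (t - s) = \int[mu]_(x in `[s, t]) C.
  rewrite Rintegral_cst//= lebesgue_measure_itv/= lte_fin.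
  case: ltP => [//|ts]; by rewrite (@le_anti _ _ t s) ?subrr ?mulr0 ?st ?ts.
apply: le_Rintegral => //.
  have /integrable_abse := vi s t; exact: eq_integrable.
apply: (@bounded_itv_integrable (fun=> C) `|C|) => //.
Qed.

(** Lebesgue differentiation is applied to a Borel version of [u]. The exceptional times are the
    non-Lebesgue points together with the null set where the two versions differ. *)
Lemma ae_is_derive_antiderivative (u U : R -> R) (C : R) : lebesgue_measurable_fun u ->
  (forall x, `|u x| <= C) ->
  (forall s t, s <= t -> U t - U s = lebesgue_integral_on s t u) ->
  {ae mu, forall t, is_derive (t : R) 1 U (u t)}.
Proof.
move=> mu_ uC UE.
have [v [N [mv mN N0 vu vle]]] := lebesgue_measurable_borel_version mu_.
have vC x : `|v x| <= C by exact: le_trans (vle x) (uC x).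
have vi := bounded_itv_integrable mv vC.
have UE' s t : s <= t -> U t - U s = \int[mu]_(x in `[s, t]) v x.
  by move=> st; rewrite UE// (lebesgue_integral_on_borel_version mu_ mv mN N0 vu).
have vloc : locally_integrable [set: R] v.
  split => //; first exact: openT.
  move=> K _ cK.
  have [M [_ MK]] := compact_bounded cK.
  have KM : K `<=` `[- (`|M| + 1), `|M| + 1].
    move=> x Kx /=; rewrite in_itv/= -ler_norml.
    by apply: MK => //; rewrite (le_lt_trans (ler_norm M))// ltrDl.
  have /integrableP[_ +] := vi (- (`|M| + 1)) (`|M| + 1).
  apply: le_lt_trans; apply: ge0_subset_integral => //=.
    exact: compact_measurable.
  by do 2 apply: measurableT_comp => //; apply: measurable_funTS.
(* The fundamental theorem needs a fixed left end, here [- k]; the countably many statements are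
   intersected afterwards. *)
have H k : {ae mu, forall x, - k%:R < x -> is_derive (x : R) 1 U (v x)}.
  have := lebesgue_differentiation vloc.
  apply: filterS; first exact: (ae_filter_ringOfSetsType mu).
  move=> x lx kx.
  have x1 : x < x + 1 by rewrite ltrDl.
  have [|dF F'] := @FTC1_lebesgue_pt R v (BLeft (- k%:R)) x (x + 1) x1 (vi _ _) _ lx.
    by first [exact: (ltW kx)|exact: kx].
  set G := (fun x => _) in dF F'.
  apply: (@near_eq_is_derive _ _ _ (fun x => G x + U (- k%:R))).
    near=> y; rewrite /G -UE' ?subrK//.
    by apply: ltW; near: y; exact: lt_nbhsr.
  rewrite -[v x]addr0; apply: (isd_add (f := G)).
  by rewrite -F' derive1E; exact: derivableP.
have /ae_lebesgue_nat H2 := H.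
have H3 : {ae mu, forall x, ~ N x} by exists N; split => //= x /=; apply: contrapT.
apply: (@filterS2 _ _ (ae_filter_ringOfSetsType mu) _ _ _ _ H2 H3) => x Hk nN.
rewrite -vu//; apply: (Hk (Num.bound `|x|)).
rewrite ltrNl (le_lt_trans (ler_norm _))// normrN.
by rewrite archi_boundP.
Unshelve. all: by end_near. Qed.

(** Both sides are measures in [A] that agree on half-open intervals, so uniqueness of Lebesgue
    measure applies. *)
Lemma lebesgue_measure_scale (om : R) (A : set R) : 0 < om ->
  measurable (A : set (measurableTypeR R)) ->
  mu A = (om%:E * mu [set t | (om * t)%R \in A])%E.
Proof.
move=> om0 mA.
have mf : measurable_fun (T := measurableTypeR R) (U := measurableTypeR R) setT (fun t : R => om * t).
  by apply: continuous_measurable_fun; exact: mulrl_continuous.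
pose m1 := measure_function_pushforward__canonical__measure_function_Measure mu mf.
pose m2 : {measure set (measurableTypeR R) -> \bar R} := mscale (NngNum (ltW om0)) m1.
have -> : mu A = m2 A.
  apply: lebesgue_measure_unique => // X [[a b] /= _ <-].
  rewrite /m2/= /mscale/= /m1/= /pushforward.
  have -> : (fun t => om * t) @^-1` `]a, b] = `](a / om), (b / om)]%classic.
    by apply/seteqP; split=> x /=; rewrite !in_itv/= ltr_pdivrMr// ler_pdivlMr// ![x * om]mulrC.
  rewrite !lebesgue_measure_itv/= !lte_fin ltr_pM2r ?invr_gt0//.
  case: ifP => // _; last by rewrite mule0.
  rewrite -!EFinB -EFinM; congr EFin; field; exact: lt0r_neq0.
rewrite /m2/= /mscale/= /m1/= /pushforward; congr (_ * mu _)%E.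
by apply/seteqP; split=> x /=; rewrite inE.
Qed.

(** The input is evaluated at [om * t], so the null set of times where U fails to be derivable has
    to be pulled back by the scaling. *)
Lemma negligible_scale (om : R) (N : set R) : 0 < om -> mu.-negligible N ->
  mu.-negligible [set t | N (om * t)].
Proof.
move=> om0 [B [mB B0 NB]].
exists [set t | (om * t)%R \in B]; split.
- have -> : [set t | (om * t)%R \in B] = setT `&` (fun t : R => om * t) @^-1` B.
    by apply/seteqP; split=> x /=; rewrite inE// => -[].
  by apply: (@continuous_measurable_fun R (fun t : R => om * t)) => //; exact: mulrl_continuous.
- have := lebesgue_measure_scale om0 mB; rewrite B0 => /esym/eqP.
  by rewrite mule_eq0 eqe gt_eqF//= => /eqP.
- by move=> t /= /NB; rewrite inE.
Qed.

End primitives.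

(** * Absolutely continuous curves *)

Section ac.
Context {R : realType} {V : normedModType R}.
Notation mu := (@lebesgue_measure R).

(** Induction along a real interval: at the supremum of the points satisfying [P], the hypothesis
    carries [P] from just before it to just after it. As the hypothesis jumps from [s <= t] directly
    to [s' >= t], closedness of [P] needs no separate argument. *)
Lemma itv_induction (P : R -> Prop) (a b : R) : a <= b -> P a ->
  (forall t, a <= t <= b -> exists2 d, 0 < d & forall s s', a <= s -> s <= t -> t <= s' ->
     s' <= b -> t - d < s -> s' < t + d -> P s -> P s') ->
  P b.
Proof.
move=> ab Pa H.
pose E := [set t | a <= t <= b /\ P t].
have Ea : E a by split => //; rewrite lexx.
have hE : has_sup E by split; [exists a|exists b => t [/andP[]]].
have aS : a <= sup E by apply: sup_upper_bound.
have Sb : sup E <= b by apply: ge_sup; [exists a|move=> t [/andP[]]].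
have [|d d0 {}H] := H (sup E); first by rewrite aS.
have [s [/andP[sa sb] Ps] sd] := sup_adherent d0 hE.
have sS : s <= sup E by apply: sup_upper_bound => //; split => //; rewrite sa.
have [Sb'|bS] := ltP (sup E) b; last first.
  by apply: (H s b) => //; rewrite (@le_lt_trans _ _ (sup E))// ltrDl.
pose s' := Num.min b (sup E + d / 2).
have Ps' : P s'.
  apply: (H s s') => //.
  - by rewrite /s' le_min Sb/= lerDl divr_ge0// ltW.
  - by rewrite /s' ge_min lexx.
  - by rewrite /s' gt_min ltrD2l; apply/orP; right; lra.
have : s' <= sup E.
  apply: sup_upper_bound => //; split => //; rewrite /s' ge_min lexx/= andbT le_min ab/=.
  by rewrite (le_trans aS)// lerDl divr_ge0// ltW.
by rewrite /s' ge_min leNgt Sb'/= -subr_ge0 => ?; lra.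
Qed.

Lemma isd_local_lipschitz (x : R -> V) (t : R) dx (C e : R) : is_derive t 1 x dx ->
  `|dx| <= C -> 0 < e ->
  exists2 d, 0 < d & forall s, `|s - t| < d -> `|x s - x t| <= (C + e) * `|s - t|.
Proof.
move=> [dx1 dx2] dxC e0.
have /cvgrPdist_lt/(_ _ e0) : h^-1 *: (x (h *: 1 + t) - x t) @[h --> 0^'] --> dx.
  by rewrite -dx2; exact: dx1.
move=> [d /= d0 H]; exists d => // s; have -> : x s = x (t + (s - t)) by rewrite addrC subrK.
move: (s - t) => h hd.
have [->|h0] := eqVneq h 0; first by rewrite addr0 subrr !normr0 mulr0.
have := H h; rewrite /ball_ /= sub0r normrN => /(_ hd h0).
rewrite [h *: 1]mulr1 addrC => {}H; rewrite [t + h]addrC.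
have -> : x (h + t) - x t = h *: (h^-1 *: (x (h + t) - x t)).
  by rewrite scalerA divff// scale1r.
rewrite normrZ mulrC ler_wpM2r//.
rewrite -[X in `|X|](subrK dx) (le_trans (ler_normD _ _))// addrC lerD//.
by rewrite distrC addrC; apply: ltW.
Qed.

Lemma isd_lipschitz_bound (x : R -> V) (t : R) dx (L : R) : is_derive t 1 x dx ->
  (\forall s \near t, `|x s - x t| <= L * `|s - t|) -> `|dx| <= L.
Proof.
move=> [dx1 dx2] H.
have cv : h^-1 *: (x (h *: 1 + t) - x t) @[h --> 0^'] --> dx.
  by rewrite -dx2; exact: dx1.
have ct : (h *: 1 + t : R) @[h --> (0:R)^'] --> t.
  apply: cvg_within_filter.
  have : (h *: 1 + t : R) @[h --> (0:R)] --> (0 : R) *: (1:R) + t.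
    by apply: cvgD; [apply: cvgZr_tmp; exact: cvg_id|exact: cvg_cst].
  by rewrite scale0r add0r.
apply/ler_addgt0Pr => e e0.
near (0 : R)^' => h.
have h0 : h != 0 by near: h; exact: nbhs_dnbhs_neq.
rewrite -[X in `|X|](subrK (h^-1 *: (x (h *: 1 + t) - x t))).
rewrite (le_trans (ler_normD _ _))// addrC lerD//.
  rewrite normrZ normfV ler_pdivrMl ?normr_gt0// mulrC.
  have -> : `|h| = `|h *: 1 + t - t| by rewrite addrK [h *: 1]mulr1.
  by near: h; apply: (ct _ H).
apply: ltW; near: h; move/cvgrPdist_lt : cv; exact.
Unshelve. all: by end_near. Qed.

End ac.
Section ac.
Context {R : realType} {V : normedModType R}.
Notation mu := (@lebesgue_measure R).

(** The values lie in an arbitrary normed space, so the derivative is not integrated. The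
    exceptional null set is covered by an open set [O] of measure below [del]. Outside [O] the
    derivative bound advances the estimate; inside [O] the increments are recorded in a list of
    disjoint intervals, whose total contribution absolute continuity makes small. *)
Lemma ac_lipschitz (x : R -> V) (a b C : R) : 0 <= C -> a <= b ->
  abs_continuous a b x ->
  {ae mu, forall t, a <= t <= b -> exists2 dx, is_derive (t : R) 1 x dx & `|dx| <= C} ->
  `|x b - x a| <= C * (b - a).
Proof.
move=> C0 ab ac [B [mB B0 NB]].
apply/ler_addgt0Pr => e e0.
(* The slack accumulated over the whole interval is at most [e / 2]; the added 1 covers the case
   [a = b]. *)
pose e1 := e / 2 / (b - a + 1).
have ba1 : 0 < b - a + 1 by rewrite ltr_wpDl// subr_ge0.
have e10 : 0 < e1 by rewrite !divr_gt0.
have e20 : 0 < e / 2 by rewrite divr_gt0.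
have [del del0 acd] := ac _ e20.
have [|O [oO BO mO]] := lebesgue_regularity_outer mB _ del0; first by rewrite [X in (X < _)%E]B0 ltry.
have {}mO : (mu O < del%:E)%E.
  apply: le_lt_trans mO.
  have -> : O = (O `\` B) `|` B.
    by rewrite setUC setDUK.
  apply: le_trans (measureU2 _ _ _) _ => //=.
    by apply: measurableD => //; exact: open_measurable.
  rewrite setUC setDUK//.
  by rewrite [X in (_ + X)%E]B0 adde0.
(* The list [l] holds the increments taken inside [O] so far, the latest first. Comparing its total
   length with the measure of [O] up to [s] is what finally keeps that length below [del]. *)
pose P s := exists l : seq (R * R), [/\ 
  all (fun p => [&& a <= p.1, p.1 <= p.2 & p.2 <= s]) l,
  pairwise (fun p q => q.2 <= p.1) l,
  ((\sum_(p <- l) (p.2 - p.1))%:E <= mu (O `&` `]-oo, s]))%E &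
  `|x s - x a| <= (C + e1) * (s - a) + \sum_(p <- l) `|x p.2 - x p.1| ].
have mOs s : measurable (O `&` `]-oo, s] : set (measurableTypeR R)).
  by apply: measurableI => //; exact: open_measurable.
have : P b.
  apply: (itv_induction ab).
    exists [::]; split => //; first by rewrite big_nil measure_ge0.
    by rewrite !subrr normr0 mulr0 big_nil addr0.
  move=> t tab.
  have [Ot|nOt] := pselect (O t).
    have [d /= d0 dO] : nbhs_ball t O by apply/nbhs_ballP; exact: open_nbhs_nbhs.
    exists d => // s s' sa st ts' s'b sd s'd [l [la lp lO lx]].
    have ss' : s <= s' by exact: le_trans ts'.
    exists ((s, s') :: l); split.
    - rewrite /= sa ss' lexx/=; apply: sub_all la => p /and3P[-> -> /= ps].
      exact: le_trans ss'.
    - rewrite /= lp andbT; apply: sub_all la => p /and3P[_ _]; exact.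
    - rewrite big_cons EFinD/=.
      apply: (@le_trans _ _ (mu (`]s, s'] `|` (O `&` `]-oo, s]))%classic)).
        rewrite measureU//=.
          apply: leeD => //.
          by rewrite lebesgue_measure_itv/= lte_fin; case: ltP => //= s's; rewrite lee_fin; lra.
        apply/seteqP; split => y //=; rewrite !in_itv/= => -[/andP[sy _] [_]].
        by rewrite leNgt sy.
      apply: le_measure; rewrite ?inE//; first by apply: measurableU.
      move=> y /= [|[Oy]]; rewrite !in_itv/=.
        move=> /andP[sy ys']; split => //; apply: dO; rewrite /ball/= ltr_norml; apply/andP; split; lra.
      by move=> ys; split => //; exact: le_trans ss'.
    - rewrite big_cons/=.
      have -> : x s' - x a = (x s' - x s) + (x s - x a) by rewrite addrA subrK.
      apply: le_trans (ler_normD _ _) _; rewrite addrCA; apply: lerD => //.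
      apply: le_trans lx _; rewrite lerD2r ler_wpM2l// ?lerD2r//.
      by rewrite addr_ge0// ltW.
  have [dx xd dxC] : exists2 dx, is_derive t 1 x dx & `|dx| <= C.
    apply: contrapT => nt; apply: nOt; apply: BO; apply: NB => /= /(_ tab).
    exact: nt.
  have [d d0 H] := isd_local_lipschitz xd dxC e10.
  exists d => // s s' sa st ts' s'b sd s'd [l [la lp lO lx]].
  have ss' : s <= s' by exact: le_trans ts'.
  exists l; split => //.
  - by apply: sub_all la => p /and3P[-> -> /= ps]; exact: le_trans ss'.
  - apply: le_trans lO _; apply: le_measure; rewrite ?inE//.
    by move=> y /= [Oy]; rewrite !in_itv/= => ys; split => //; exact: le_trans ss'.
  - have Hs : `|x s - x t| <= (C + e1) * (t - s).
      have := H s; rewrite distrC [`|t - s|]ger0_norm ?subr_ge0//.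
      by apply; lra.
    have Hs' : `|x s' - x t| <= (C + e1) * (s' - t).
      have := H s'; rewrite [`|s' - t|]ger0_norm ?subr_ge0//.
      by apply; lra.
    have -> : x s' - x a = (x s' - x t) + ((x t - x s) + (x s - x a)).
      by rewrite addrA subrKA addrA subrK.
    apply: le_trans (ler_normD _ _) _; apply: le_trans (lerD (lexx _) (ler_normD _ _)) _.
    rewrite [`|x t - x s|]distrC.
    apply: le_trans (lerD Hs' (lerD Hs lx)) _.
    by rewrite le_eqVlt; apply/orP; left; apply/eqP; ring.
move=> [l [la lp lO lx]].
have lsum : \sum_(p <- l) (p.2 - p.1) < del.
  rewrite -lte_fin; apply: le_lt_trans lO _; apply: le_lt_trans mO.
  by apply: le_measure; rewrite ?inE//; exact: open_measurable.
have lx2 : \sum_(p <- l) `|x p.2 - x p.1| < e / 2.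
  have := acd (size l) (fun k => (nth (0, 0) l k).1) (fun k => (nth (0, 0) l k).2).
  have E (f : R * R -> R) : \sum_(k < size l) f (nth (0, 0) l k) = \sum_(p <- l) f p.
    by rewrite (big_nth (0, 0)) big_mkord.
  rewrite (E (fun p => p.2 - p.1)) (E (fun p => `|x p.2 - x p.1|)); apply => //.
    by move=> k; move/all_nthP : la => /(_ (0, 0) k (ltn_ord k)) /and3P[].
  have disj (i j : nat) : (i < j < size l)%N ->
      `](nth (0, 0) l i).1, (nth (0, 0) l i).2[%classic `&`
      `](nth (0, 0) l j).1, (nth (0, 0) l j).2[%classic = set0.
    move=> /andP[ij jl]; move/(pairwiseP (0, 0)) : lp => /(_ i j).
    rewrite !inE => /(_ (ltn_trans ij jl) jl ij) ji.
    apply/seteqP; split => y //=; rewrite !in_itv/= => -[/andP[iy _] /andP[_ yj]].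
    by have := lt_trans iy (lt_le_trans yj ji); rewrite ltxx.
  apply/trivIsetP => i j _ _; rewrite -val_eqE/= neq_ltn => /orP[ij|ji].
    by apply: disj; rewrite ij ltn_ord.
  by rewrite setIC; apply: disj; rewrite ji ltn_ord.
have Ce : (C + e1) * (b - a) <= C * (b - a) + e / 2.
  have E1 : e1 * (b - a + 1) = e / 2 by rewrite /e1 mulfVK// lt0r_neq0.
  by rewrite -E1 mulrDl lerD2l ler_pM2l// lerDl.
have e12 : e / 2 + e / 2 = e by lra.
apply: le_trans lx _; rewrite -e12 addrA; apply: lerD => //; exact: ltW.
Qed.

(** The mean value theorem fails for vector values. Real induction with a slack of [2 * e1] per unit
    of time replaces it: one [e1] absorbs the first-order error of [f], the other that of [phi]. *)
Lemma mean_value_ineq (f df : R -> V) (phi dphi : R -> R) (a b : R) : a <= b ->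
  (forall t, a <= t <= b -> is_derive t 1 f (df t)) ->
  (forall t, a <= t <= b -> is_derive t 1 phi (dphi t)) ->
  (forall t, a <= t <= b -> `|df t| <= dphi t) ->
  `|f b - f a| <= phi b - phi a.
Proof.
move=> ab fd phid H; apply/ler_addgt0Pr => e e0.
pose e1 := e / (2 * (b - a + 1)).
have ba1 : 0 < b - a + 1 by rewrite ltr_wpDl// subr_ge0.
have e10 : 0 < e1 by rewrite !divr_gt0// mulr_gt0.
have : `|f b - f a| <= phi b - phi a + 2 * e1 * (b - a).
  apply: (itv_induction (P := fun s => `|f s - f a| <= phi s - phi a + 2 * e1 * (s - a)) ab).
    by rewrite !subrr normr0 mulr0 addr0.
  move=> t tab.
  have [d d0 Hd] := isd_local_lipschitz (fd _ tab) (lexx _) e10.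
  (* With its linear part removed, [phi] has derivative 0 at [t] and is therefore [e1]-Lipschitz
     around [t]. *)
  have phid2 : is_derive t 1 (fun s => phi s - dphi t * s) 0.
    apply: (isd_eq (df := dphi t - dphi t * 1)); last by rewrite mulr1 subrr.
    apply: isd_sub; first exact: phid.
  have [d' d'0 Hd'] := isd_local_lipschitz phid2 (lexx _) e10.
  exists (Num.min d d'); first by rewrite lt_min d0.
  have HH s : `|s - t| < Num.min d d' -> `|f s - f t| <= (dphi t + e1) * `|s - t| /\
     `|phi s - phi t - dphi t * (s - t)| <= e1 * `|s - t|.
    rewrite lt_min => /andP[sd sd']; split.
      by apply: le_trans (Hd _ sd) _; rewrite ler_wpM2r// lerD2r; exact: H.
    have := Hd' _ sd'; rewrite normr0 add0r => /(le_trans _); apply.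
    by rewrite le_eqVlt; apply/orP; left; apply/eqP; congr (`| _ |); ring.
  move=> s s' sa st ts' s'b sd s'd Ps.
  have [|] := HH s'; first by rewrite ltr_norml; apply/andP; split; lra.
  have [|] := HH s; first by rewrite ltr_norml; apply/andP; split; lra.
  rewrite [`|s' - t|]ger0_norm ?subr_ge0// [`|s - t|]ler0_norm ?subr_le0//.
  rewrite [`|f s - f t|]distrC !(ler_norml (_ - _ * _)) => h1 /andP[h2 h3] h4 /andP[h5 h6].
  have : `|f s' - f a| <= `|f s' - f t| + (`|f t - f s| + `|f s - f a|).
    have -> : f s' - f a = (f s' - f t) + ((f t - f s) + (f s - f a)).
      by rewrite addrA subrKA addrA subrK.
    apply: le_trans (ler_normD _ _) _; apply: lerD => //; exact: ler_normD.
  nra.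
move=> /le_trans; apply; rewrite lerD2l.
have E1 : 2 * e1 * (b - a + 1) = e.
  by rewrite /e1 invfM; field; rewrite lt0r_neq0.
by rewrite -E1 ler_pM2l ?lerDl// mulr_gt0.
Qed.
End ac.

(** * Global solutions of Lipschitz equations *)

Section completeness.
Context {R : realType} {K : nat}.

(** The factor 2 is the sum of the geometric tail. *)
Lemma geometric_limit (z : nat -> 'rV[R]_K) (A : R) :
  (forall k, `|z k.+1 - z k| <= A * 2^-1 ^+ k) ->
  exists l, forall k, `|l - z k| <= 2 * A * 2^-1 ^+ k.
Proof.
move=> H.
have A0 : 0 <= A by have := H 0; rewrite expr0 mulr1; apply: le_trans.
have half0 k : 0 < (2^-1 : R) ^+ k by rewrite exprn_gt0// invr_gt0.
have H2 k m : `|z (k + m)%N - z k| <= 2 * A * (2^-1 ^+ k - 2^-1 ^+ (k + m)%N).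
  elim: m => [|m IH]; first by rewrite addn0 !subrr normr0 mulr0.
  rewrite addnS -[z _](subrK (z (k + m)%N)) -addrA (le_trans (ler_normD _ _))//.
  apply: le_trans (lerD (H _) IH) _.
  rewrite exprS le_eqVlt; apply/orP; left; apply/eqP; rewrite ?addnS ?exprS; by field.
have H3 k m : `|z (k + m)%N - z k| <= 2 * A * 2^-1 ^+ k.
  by apply: le_trans (H2 k m) _; rewrite ler_wpM2l ?mulr_ge0// gerBl ltW.
have small (e : R) : 0 < e -> exists k, 2 * A * 2^-1 ^+ k < e.
  move=> e0.
  have /cvgrPdist_lt/(_ (e / (2 * A + 1))) : (2^-1 : R) ^+ k @[k --> \oo] --> (0:R).
    by apply: cvg_expr; rewrite ger0_norm ?invr_ge0// invf_lt1// ltr1n.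
  have A1 : 0 < 2 * A + 1 by rewrite ltr_wpDl// mulr_ge0.
  rewrite divr_gt0// => /(_ isT) [k _ /(_ k (leqnn k))] /=.
  rewrite sub0r normrN ger0_norm ?ltW// ltr_pdivlMr// => Hk; exists k.
  apply: le_lt_trans Hk; rewrite mulrC ler_pM2l//; lra.
have cv : cvg (z @ \oo).
  apply: cauchy_cvg; apply: cauchy_exP => e e0.
  have [k ke] := small _ e0; exists (z k); exists k => // m /= km.
  rewrite -ball_normE /ball_ /= distrC -(subnKC km); exact: le_lt_trans (H3 _ _) ke.
exists (lim (z @ \oo)) => k.
have cv2 : z m - z k @[m --> \oo] --> lim (z @ \oo) - z k.
  by apply: cvgB => //; exact: cvg_cst.
apply/ler_addgt0Pr => e e0.
have [m0 _ Hm] := (cvgrPdist_lt _ _).1 cv2 _ e0.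
have := Hm (k + m0)%N (leq_addl _ _).
move=> He; rewrite -[X in `|X|](subrK (z (k + m0)%N - z k)) (le_trans (ler_normD _ _))//.
by rewrite addrC lerD// ltW.
Qed.

Lemma vector_primitive (g : R -> 'rV[R]_K) (t0 : R) (z0 : 'rV[R]_K) : continuous g ->
  exists P : R -> 'rV[R]_K, P t0 = z0 /\ forall t : R, is_derive t 1 P (g t).
Proof.
move=> cg.
have /choice[F FP] (j : 'I_K) : exists F : R -> R, forall t, is_derive (t : R) 1 F (g t 0 j).
  have cgj : continuous (fun t => g t 0 j).
    move=> t; apply: (@continuous_comp _ _ _ g (fun M : 'rV[R]_K => M 0 j)); [exact: cg|exact: coord_continuous].
  by have [F [FP _]] := continuous_primitive cgj; exists F.
exists (fun t => \row_j (F j t - F j t0 + z0 0 j)); split.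
  by apply/rowP => j; rewrite mxE subrr add0r.
move=> t; apply: isd_mx => i j; rewrite ord1.
under [X in is_derive _ _ X]eq_fun do rewrite mxE.
apply: (isd_eq (df := g t 0 j - 0 + 0)); last by rewrite subr0 addr0.
Qed.
End completeness.

Section picard.
Context {R : realType} {K : nat}.
Variables (F : R -> 'rV[R]_K -> 'rV[R]_K) (L M : R).
Hypothesis L0 : 0 < L.
Hypothesis FL : forall t z z', `|F t z - F t z'| <= L * `|z - z'|.
Hypothesis FM : forall t z, `|F t z| <= M.
Hypothesis Fc : forall z, continuous (fun t => F t z).

(** Bielecki's weight. Integrating it from [t0] costs a factor [1 / (2 L)], so a Picard step with
    Lipschitz constant [L] contracts by one half on the whole line at once, with no gluing of short
    time intervals. *)
Let E (t0 t : R) := expR (2 * L * `|t - t0|).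

Lemma picard_growth (f df : R -> 'rV[R]_K) (t0 c : R) : 0 <= c ->
  (forall t : R, is_derive t 1 f (df t)) -> f t0 = 0 ->
  (forall t, `|df t| <= c * E t0 t) ->
  forall t, `|f t| <= c / (2 * L) * E t0 t.
Proof.
move=> c0 fd f0 H t.
have L20 : 0 < 2 * L by rewrite mulr_gt0.
have cL : 0 <= c / (2 * L) by rewrite divr_ge0// ltW.
have Ed (s k : R) : is_derive s 1 (fun s : R => expR (k * (s - t0))) (k * expR (k * (s - t0))).
  have Hk : is_derive s 1 (fun s : R => k * (s - t0)) k.
    by apply: (isd_eq (isd_mull k (isd_sub (isd_id s 1) (isd_cst t0 s 1)))); rewrite subr0 mulr1.
  rewrite mulrC.
  exact (@is_derive1_comp R expR (fun s => k * (s - t0)) s _ _ (is_derive_expR _) Hk).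
have [t0t|tt0] := leP t0 t.
  have := @mean_value_ineq R _ f df (fun s => c / (2 * L) * expR (2 * L * (s - t0))) 
    (fun s => c * expR (2 * L * (s - t0))) t0 t t0t (fun s _ => fd s).
  rewrite f0 subr0 subrr mulr0 expR0 mulr1 => HH.
  apply: le_trans (HH _ _) _ => [s _|s /andP[ts _]|].
  - apply: (isd_eq (isd_mull (c / (2 * L)) (Ed s (2 * L)))).
    by field; rewrite lt0r_neq0.
  - by have := H s; rewrite /E ger0_norm ?subr_ge0.
  - by rewrite /E ger0_norm ?subr_ge0// gerBl.
(* Before [t0] the weight decreases in time, so its primitive carries the opposite sign. *)
have := @mean_value_ineq R _ f df (fun s => - (c / (2 * L)) * expR (- (2 * L) * (s - t0))) 
  (fun s => c * expR (- (2 * L) * (s - t0))) t t0 (ltW tt0) (fun s _ => fd s).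
rewrite f0 sub0r normrN subrr mulr0 expR0 mulr1 => HH.
apply: le_trans (HH _ _) _ => [s _|s /andP[_ st]|].
- apply: (isd_eq (isd_mull (- (c / (2 * L))) (Ed s (- (2 * L))))).
  by field; rewrite lt0r_neq0.
- by have := H s; rewrite /E ler0_norm ?subr_le0// mulrN mulNr.
- rewrite /E ler0_norm ?subr_le0; last exact: ltW.
  by rewrite mulNr opprK mulrN mulNr addrC gerDl oppr_le0.
Qed.

Lemma picard_rhs_continuous (z : R -> 'rV[R]_K) : continuous z -> continuous (fun t => F t (z t)).
Proof.
move=> cz t; apply/cvgrPdist_le => e e0.
have e2 : 0 < e / 2 by rewrite divr_gt0.
have eL : 0 < e / 2 / L by rewrite divr_gt0.
near=> s.
have -> : F t (z t) - F s (z s) = (F t (z t) - F s (z t)) + (F s (z t) - F s (z s)).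
  by rewrite addrA subrK.
rewrite (le_trans (ler_normD _ _))// [leRHS](splitr e) lerD//.
  near: s; move/cvgrPdist_le : (@Fc (z t) t); exact.
rewrite (le_trans (FL _ _ _))// mulrC -ler_pdivlMr//.
near: s; move/cvgrPdist_le : (@cz t); exact.
Unshelve. all: by end_near. Qed.

Theorem picard_global (t0 : R) (z0 : 'rV[R]_K) :
  exists z : R -> 'rV[R]_K, z t0 = z0 /\ forall t : R, is_derive t 1 z (F t (z t)).
Proof.
have M0 : 0 <= M by apply: le_trans (FM 0 0).
(* The integral operator is obtained by choice; on discontinuous arguments its value is
   arbitrary. *)
have /choice[op opP] (z : R -> 'rV[R]_K) : exists P : R -> 'rV[R]_K,
    continuous z -> P t0 = z0 /\ forall t : R, is_derive t 1 P (F t (z t)).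
  have [cz|ncz] := pselect (continuous z); last by exists z.
  by have [P PP] := vector_primitive t0 z0 (picard_rhs_continuous cz); exists P.
pose zs k := iter k op (fun=> z0).
have zsc k : continuous (zs k).
  elim: k => [|k IH]; first by move=> t; exact: cvg_cst.
  move=> t; have [_ /(_ t)] := opP _ IH; exact: isd_continuous.
have zs0 k : zs k t0 = z0 by case: k => [|k] //; have [] := opP _ (zsc k).
have zsd k (t : R) : is_derive t 1 (zs k.+1) (F t (zs k t)) by have [_] := opP _ (zsc k).
(* A Lipschitz constant common to all iterates passes to their pointwise limit and makes it
   continuous. *)
have zsL k s t : `|zs k t - zs k s| <= M * `|t - s|.
  wlog st : s t / s <= t.
    move=> W; have [st|ts] := leP s t; first exact: W.
    by rewrite distrC [`|t - s|]distrC; apply: W; exact: ltW.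
  case: k => [|k]; first by rewrite /zs/= subrr normr0 mulr_ge0.
  have := @mean_value_ineq R _ (zs k.+1) _ (fun s => M * s) (fun=> M) s t st (fun t _ => zsd k t).
  rewrite -mulrBr [`|t - s|]ger0_norm ?subr_ge0//; apply => // r _.
  by apply: (isd_eq (isd_mull M (isd_id r 1))); rewrite mulr1.
have E1 t : 1 <= E t0 t by rewrite -expR0 ler_expR !mulr_ge0// ltW.
pose A := M / (2 * L).
have A0 : 0 <= A by rewrite divr_ge0// mulr_ge0// ltW.
have AE : A = M / (2 * L) by [].
clearbody A.
have h0 k : 0 <= (2^-1 : R) ^+ k by rewrite exprn_ge0// invr_ge0.
have L0' := ltW L0.
have zsdiff k t : `|zs k.+1 t - zs k t| <= (A * E t0 t) * 2^-1 ^+ k.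
  elim: k t => [|k IH] t.
    rewrite expr0 mulr1 AE; apply: (@picard_growth (fun t => zs 1%N t - zs 0%N t) (fun t => F t (zs 0%N t) - 0)) => //.
    - by rewrite !zs0 subrr.
    - by move=> s; rewrite subr0 (le_trans (FM _ _))// ler_peMr.
  have -> : A * E t0 t * 2^-1 ^+ k.+1 = (L * (A * 2^-1 ^+ k)) / (2 * L) * E t0 t.
    rewrite exprS; field; exact: lt0r_neq0.
  apply: (@picard_growth (fun t => zs k.+2 t - zs k.+1 t) (fun t => F t (zs k.+1 t) - F t (zs k t))).
  - do ! apply: mulr_ge0 => //.
  - by rewrite !zs0 subrr.
  - move=> s; apply: le_trans (FL _ _ _) _; rewrite -!mulrA ler_pM2l//.
    by apply: le_trans (IH s) _; rewrite le_eqVlt; apply/orP; left; apply/eqP; ring.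
have /choice[z zP] t := geometric_limit (fun k => zsdiff k t).
have half (c e : R) : 0 < e -> exists k, c * 2^-1 ^+ k <= e.
  move=> e0.
  have /cvgrPdist_lt/(_ (e / (`|c| + 1))) : (2^-1 : R) ^+ k @[k --> \oo] --> (0:R).
    by apply: cvg_expr; rewrite ger0_norm ?invr_ge0// invf_lt1// ltr1n.
  have A1 : 0 < `|c| + 1 by rewrite ltr_wpDl.
  rewrite divr_gt0// => /(_ isT) [k _ /(_ k (leqnn k))] /=.
  rewrite sub0r normrN ger0_norm ?exprn_ge0 ?invr_ge0// ltr_pdivlMr// => Hk; exists k.
  apply: le_trans (ltW Hk); rewrite mulrC ler_wpM2l ?exprn_ge0 ?invr_ge0//.
  by rewrite (le_trans (ler_norm _))// lerDl.
have zL s t : `|z t - z s| <= M * `|t - s|.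
  apply/ler_addgt0Pr => e e0.
  have [k Hk] := half (2 * (A * E t0 t) + 2 * (A * E t0 s)) _ e0.
  have -> : z t - z s = (z t - zs k t) + ((zs k t - zs k s) + (zs k s - z s)).
    by rewrite addrA subrKA addrA subrK.
  apply: le_trans (ler_normD _ _) _; apply: le_trans (lerD (zP _ k) (ler_normD _ _)) _.
  rewrite [`|zs k s - _|]distrC.
  apply: le_trans (lerD (lexx _) (lerD (zsL _ _ _) (zP s k))) _.
  by rewrite addrCA lerD2l -mulrDl.
have zc : continuous z.
  move=> t; apply/cvgrPdist_le => e e0.
  have M1 : 0 < M + 1 by rewrite ltr_wpDl.
  near=> s; rewrite (le_trans (zL _ _))//.
  rewrite (@le_trans _ _ ((M + 1) * `|t - s|))//; first by rewrite ler_wpM2r// lerDl.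
  rewrite mulrC -ler_pdivlMr//; near: s.
  by have /cvgrPdist_le := @cvg_id _ (nbhs t); apply; rewrite divr_gt0.
(* Derivatives do not pass to the limit. The limit [z] is therefore compared with the primitive [y]
   of [F t (z t)]: both are close to [zs k.+1], which is a primitive of [F t (zs k t)]. *)
have [y [y0 yd]] := vector_primitive t0 z0 (picard_rhs_continuous zc).
suff zy : z = y by exists y; split=> // t; have := yd t; rewrite zy.
apply/funext => t; apply/eqP; rewrite -subr_eq0 -normr_le0.
apply/ler_addgt0Pr => e e0; rewrite add0r.
have [k Hk] := half (A * E t0 t + A * E t0 t) _ e0.
have H1 : `|y t - zs k.+1 t| <= L * (2 * A * 2^-1 ^+ k) / (2 * L) * E t0 t.
  apply: (@picard_growth (fun t => y t - zs k.+1 t) (fun t => F t (z t) - F t (zs k t))).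
  - do ! apply: mulr_ge0 => //.
  - by rewrite y0 zs0 subrr.
  - move=> s; apply: le_trans (FL _ _ _) _; rewrite -!mulrA ler_pM2l//.
    by apply: le_trans (zP s k) _; rewrite le_eqVlt; apply/orP; left; apply/eqP; ring.
have -> : z t - y t = (z t - zs k.+1 t) + (zs k.+1 t - y t) by rewrite addrA subrK.
apply: le_trans (ler_normD _ _) _; rewrite [`|zs _ _ - y t|]distrC.
apply: le_trans (lerD (zP t k.+1) H1) _; apply: le_trans _ Hk.
rewrite exprS le_eqVlt; apply/orP; left; apply/eqP; field; exact: lt0r_neq0.
Unshelve. all: by end_near. Qed.
End picard.

(** * Smooth and locally Lipschitz maps *)

Section cont_diff_closure.
Context {R : realType}.
Implicit Types V W : normedModType R.

Lemma differentiable_eps V W (f : V -> W) (x : V) (l : {linear V -> W}) :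
  continuous l ->
  (forall e, 0 < e -> \forall h \near (0 : V), `|f (h + x) - f x - l h| <= e * `|h|) ->
  differentiable f x /\ 'd f x = l :> (V -> W).
Proof.
move=> lc H.
have E : f \o shift x = cst (f x) + l +o_ 0 id.
  apply/eqaddoP => _/posnumP[e].
  by apply: filterS (H e%:num _) => // h /=; rewrite opprD addrA.
have dE := diff_unique lc E.
by split=> //; apply/diff_locallyP; rewrite dE.
Qed.

Lemma diff_eps V W (f : V -> W) (x : V) : differentiable f x ->
  forall e, 0 < e -> \forall h \near (0 : V), `|f (h + x) - f x - 'd f x h| <= e * `|h|.
Proof.
move=> /diff_locally /eqaddoP H e e0.
by apply: filterS (H e e0) => // h /=; rewrite opprD addrA.
Qed.

Lemma near_eq_diff V W (f g : V -> W) (x : V) :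
  (\forall y \near x, f y = g y) -> differentiable f x ->
  differentiable g x /\ 'd g x = 'd f x :> (V -> W).
Proof.
move=> fg df; apply: differentiable_eps; first exact: diff_continuous.
move=> e e0.
have fgx : f x = g x by exact: (nbhs_singleton fg).
have fg0 : \forall h \near (0 : V), f (h + x) = g (h + x).
  by move: fg; rewrite (near_shift (0 : V)) /= subr0.
apply: filterS2 (diff_eps df e0) fg0 => h H E.
by rewrite -E -fgx.
Qed.

Lemma near_eq_differentiable V W (f g : V -> W) (x : V) :
  (\forall y \near x, f y = g y) -> differentiable f x -> differentiable g x.
Proof. by move=> fg /(near_eq_diff fg)[]. Qed.

Lemma cont_diff_sub V W k (O O' : set V) (f : V -> W) : O' `<=` O ->
  cont_diff k O f -> cont_diff k O' f.
Proof.
move=> OO'; elim: k f => [|k IH] f /= H; first by move=> x /OO'; exact: H.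
by case: H => H1 H2; split=> [x /OO'|v]; [exact: H1|exact: IH].
Qed.

Lemma cont_diff_congr V W k (O : set V) (f g : V -> W) : open O ->
  (forall x, O x -> f x = g x) -> cont_diff k O f -> cont_diff k O g.
Proof.
move=> oO; elim: k f g => [|k IH] f g fg /= H.
  move=> x Ox; have nf : \forall y \near x, f y = g y.
    by near=> y; apply: fg; near: y; exact: open_nbhs_nbhs.
  rewrite /prop_for /continuous_at -(fg _ Ox).
  exact: cvg_trans (near_eq_cvg nf) (H x Ox).
case: H => H1 H2; split=> [x Ox|v].
  apply: near_eq_differentiable (H1 x Ox).
  by near=> y; apply: fg; near: y; exact: open_nbhs_nbhs.
apply: IH (H2 v) => x Ox; apply: near_eq_derive.
by near=> y; apply: fg; near: y; exact: open_nbhs_nbhs.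
Unshelve. all: by end_near. Qed.

Lemma cont_diff_cst V W k (O : set V) (c : W) : cont_diff k O (fun=> c).
Proof.
elim: k c => [|k IH] c /=; first by move=> x _; exact: cvg_cst.
split=> [x _|v]; first exact: differentiable_cst.
have -> : 'D_v (fun _ : V => c) = fun=> 0 by apply/funext => x; rewrite derive_cst.
exact: IH.
Qed.

Lemma smooth_cst V W (O : set V) (c : W) : smooth O (fun=> c).
Proof. by move=> k; exact: cont_diff_cst. Qed.

Lemma smooth_derive V W (O : set V) (f : V -> W) v : smooth O f -> smooth O ('D_v f).
Proof. by move=> H k; have [_ H2] := H k.+1; exact: H2. Qed.

Lemma smooth_differentiable V W (O : set V) (f : V -> W) x : smooth O f -> O x ->
  differentiable f x.
Proof. by move=> /(_ 1%N) [H _]; exact: H. Qed.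

Lemma smooth_sub V W (O O' : set V) (f : V -> W) : O' `<=` O -> smooth O f -> smooth O' f.
Proof. by move=> OO H k; exact: cont_diff_sub (H k). Qed.

(** For an affine inner map the derivative of [f \o A] along [v] is ['D_(l v) f \o A], again of the
    form treated, so the induction on the order closes without a formula for higher derivatives of
    compositions. *)
Lemma cont_diff_affine V V' W k (O : set V) (f : V -> W) (A : V' -> V) (l : V' -> V) :
  open O -> (forall y, differentiable A y) -> (forall y, 'd A y = l :> (V' -> V)) ->
  cont_diff k O f -> cont_diff k (A @^-1` O) (f \o A).
Proof.
move=> oO dA dlA.
have cA : continuous A by move=> y; exact: differentiable_continuous.
elim: k f => [|k IH] f /= H.
  by move=> x Ox; apply: continuous_comp; [exact: cA|exact: H].
have oA : open (A @^-1` O) by apply: open_comp => // x _; exact: cA.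
case: H => H1 H2; split=> [x Ox|v].
  by apply: differentiable_comp; [exact: dA|exact: H1].
apply: (cont_diff_congr oA) (IH _ (H2 (l v))) => y Oy /=.
rewrite [RHS]deriveE; last by apply: differentiable_comp; [exact: dA|exact: H1].
rewrite diff_comp//; last exact: H1.
by rewrite /= dlA deriveE//; exact: H1.
Qed.

Lemma smooth_affine V V' W (O : set V) (f : V -> W) (A : V' -> V) (l : V' -> V) :
  open O -> (forall y, differentiable A y) -> (forall y, 'd A y = l :> (V' -> V)) ->
  smooth O f -> smooth (A @^-1` O) (f \o A).
Proof. by move=> oO dA lA H k; exact: (cont_diff_affine oO dA lA). Qed.

End cont_diff_closure.

Section near_generic.
Context {R : realType} {V W : normedModType R}.

Lemma near_normP (x0 : V) (P : V -> Prop) :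
  (\forall x \near x0, P x) <-> exists2 e : R, 0 < e & forall x, `|x - x0| < e -> P x.
Proof.
split=> [/nbhs_normP[e /= e0 H]|[e e0 H]].
  by exists e => // x xe; apply: H; rewrite /ball_/= distrC.
by apply/nbhs_normP; exists e => //= x; rewrite /ball_/= distrC => /H.
Qed.

Lemma near_all (x0 : V) (P : V -> Prop) : (forall x, P x) -> \forall x \near x0, P x.
Proof. by move=> H; apply: nearW. Qed.

Lemma lipschitz_continuous (f : V -> W) (L : R) :
  (forall x y, `|f x - f y| <= L * `|x - y|) -> continuous f.
Proof.
move=> H x; apply/cvgrPdist_le => e e0.
have L1 : 0 < `|L| + 1 by rewrite ltr_wpDl.
near=> y; apply: le_trans (H _ _) _.
apply: (@le_trans _ _ ((`|L| + 1) * `|x - y|)).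
  by rewrite ler_wpM2r// (le_trans (ler_norm _))// lerDl.
rewrite mulrC -ler_pdivlMr//; near: y.
by have /cvgrPdist_le := @cvg_id _ (nbhs x); apply; rewrite divr_gt0.
Unshelve. all: by end_near. Qed.

Lemma open_near (O : set V) x0 : open O -> O x0 -> \forall x \near x0, O x.
Proof. by move=> oO Ox0; exact: open_nbhs_nbhs. Qed.

Lemma open_norm (O : set V) x0 : open O -> O x0 ->
  exists2 e : R, 0 < e & forall x, `|x - x0| < e -> O x.
Proof. by move=> oO Ox0; apply/near_normP; exact: open_near. Qed.

Lemma continuous_norm (f : V -> W) x0 : {for x0, continuous f} ->
  forall e : R, 0 < e -> exists2 d : R, 0 < d & forall x, `|x - x0| < d -> `|f x - f x0| < e.
Proof.
move=> cf e e0; apply/near_normP; have /cvgrPdist_lt/(_ _ e0) := cf.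
by apply: filterS => x; rewrite distrC.
Qed.

End near_generic.

(* Bounded and Lipschitz on S near x0, uniformly in the parameter. *)
Definition ulip (R : realType) (T : Type) (V W : normedModType R) (S : set V) (x0 : V)
    (f : T -> V -> W) : Prop :=
  exists e L : R, [/\ 0 < e, 0 <= L,
    forall t x, S x -> `|x - x0| < e -> `|f t x| <= L &
    forall t x y, S x -> S y -> `|x - x0| < e -> `|y - x0| < e ->
      `|f t x - f t y| <= L * `|x - y|].

Section ulip_theory.
Context {R : realType} {T : Type}.
Implicit Types V W : normedModType R.

Lemma ulip_bounded V W (S : set V) x0 (c : T -> W) (C : R) :
  (forall t, `|c t| <= C) -> ulip S x0 (fun t _ => c t).
Proof.
move=> H; exists 1, `|C|; split => // [t x _ _|t x y _ _ _ _].
  exact: le_trans (H t) (ler_norm _).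
by rewrite subrr normr0 mulr_ge0.
Qed.

Lemma ulip_cst V W (S : set V) x0 (c : W) : ulip S x0 (fun (_ : T) _ => c).
Proof. by apply: (@ulip_bounded _ _ _ _ _ `|c|). Qed.

Lemma ulip_lipschitz V W (S : set V) x0 (f : V -> W) (L : R) :
  (forall x y, `|f x - f y| <= L * `|x - y|) -> ulip S x0 (fun (_ : T) => f).
Proof.
move=> H; exists 1, (`|L| + `|f x0|); split => //.
- move=> _ x _ xx0; rewrite -[f x](subrK (f x0)) (le_trans (ler_normD _ _))// lerD2r.
  apply: le_trans (H _ _) _; apply: le_trans (ler_wpM2r _ (ler_norm L)) _ => //.
  by rewrite ler_piMr// ltW.
- move=> _ x y _ _ _ _; apply: le_trans (H _ _) _; rewrite ler_wpM2r//.
  by rewrite (le_trans (ler_norm _))// lerDl.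
Qed.

Lemma ulip_congr V W (S : set V) x0 (f g : T -> V -> W) :
  (forall t x, S x -> f t x = g t x) -> ulip S x0 f -> ulip S x0 g.
Proof.
move=> fg [e [L [e0 L0 H1 H2]]]; exists e, L; split => // [t x Sx|t x y Sx Sy].
  by rewrite -fg//; exact: H1.
by rewrite -!fg//; exact: H2.
Qed.

Lemma ulip_near V W (S : set V) x0 (f g : T -> V -> W) :
  (\forall x \near x0, forall t, S x -> f t x = g t x) -> ulip S x0 f -> ulip S x0 g.
Proof.
move=> /nbhs_normP[e1 /= e10 fg] [e [L [e0 L0 H1 H2]]]; exists (Num.min e e1), L; split => //.
- by rewrite lt_min e0.
- move=> t x Sx; rewrite lt_min => /andP[xe xe1]; rewrite -fg//; last by rewrite /ball_/= distrC.
  exact: H1.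
- move=> t x y Sx Sy; rewrite !lt_min => /andP[xe xe1] /andP[ye ye1].
  rewrite -!fg// ?/ball_/= ?[`|x0 - _|]distrC//.
  exact: H2.
Qed.

Lemma ulip_add V W (S : set V) x0 (f g : T -> V -> W) : ulip S x0 f -> ulip S x0 g ->
  ulip S x0 (fun t x => f t x + g t x).
Proof.
move=> [e [L [e0 L0 H1 H2]]] [e' [L' [e0' L0' H1' H2']]].
exists (Num.min e e'), (L + L'); split => //; rewrite ?lt_min ?e0 ?addr_ge0//.
- move=> t x Sx; rewrite lt_min => /andP[xe xe'].
  by rewrite (le_trans (ler_normD _ _))// lerD//; [exact: H1|exact: H1'].
- move=> t x y Sx Sy; rewrite !lt_min => /andP[xe xe'] /andP[ye ye'].
  rewrite opprD addrACA mulrDl (le_trans (ler_normD _ _))// lerD//; [exact: H2|exact: H2'].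
Qed.

Lemma ulip_opp V W (S : set V) x0 (f : T -> V -> W) : ulip S x0 f ->
  ulip S x0 (fun t x => - f t x).
Proof.
move=> [e [L [e0 L0 H1 H2]]]; exists e, L; split => // [t x Sx xe|t x y Sx Sy xe ye].
  by rewrite normrN; exact: H1.
by rewrite -opprD normrN; exact: H2.
Qed.

Lemma ulip_subr V W (S : set V) x0 (f g : T -> V -> W) : ulip S x0 f -> ulip S x0 g ->
  ulip S x0 (fun t x => f t x - g t x).
Proof. by move=> uf ug; apply: ulip_add => //; exact: ulip_opp. Qed.

Lemma ulip_sum V W (S : set V) x0 (I : Type) (r : seq I) (P : pred I) (f : I -> T -> V -> W) :
  (forall i, ulip S x0 (f i)) -> ulip S x0 (fun t x => \sum_(i <- r | P i) f i t x).
Proof.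
move=> H; elim: r => [|i r IH].
  by apply: ulip_congr (ulip_cst _ _ 0) => t x _; rewrite big_nil.
case: (boolP (P i)) => Pi.
  by apply: ulip_congr (ulip_add (H i) IH) => t x _; rewrite big_cons Pi.
by apply: ulip_congr IH => t x _; rewrite big_cons (negbTE Pi).
Qed.

Lemma ulip_scale V W (S : set V) x0 (k : T -> V -> R) (f : T -> V -> W) :
  ulip S x0 k -> ulip S x0 f -> ulip S x0 (fun t x => k t x *: f t x).
Proof.
move=> [e [L [e0 L0 H1 H2]]] [e' [L' [e0' L0' H1' H2']]].
exists (Num.min e e'), (L * L' + L * L'); split => //; rewrite ?lt_min ?e0 ?addr_ge0 ?mulr_ge0//.
- move=> t x Sx; rewrite lt_min => /andP[xe xe'].
  by rewrite normrZ ler_wpDl ?mulr_ge0// ler_pM//; [exact: H1|exact: H1'].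
- move=> t x y Sx Sy; rewrite !lt_min => /andP[xe xe'] /andP[ye ye'].
  have -> : k t x *: f t x - k t y *: f t y = k t x *: (f t x - f t y) + (k t x - k t y) *: f t y.
    by rewrite scalerBr scalerBl addrA subrK.
  rewrite (le_trans (ler_normD _ _))// !normrZ mulrDl lerD//.
    by rewrite -mulrA ler_pM//; [exact: H1|exact: H2'].
  by rewrite mulrAC ler_pM//; [exact: H2|exact: H1'].
Qed.

Lemma ulip_mul V (S : set V) x0 (k f : T -> V -> R) :
  ulip S x0 k -> ulip S x0 f -> ulip S x0 (fun t x => k t x * f t x).
Proof. exact: (@ulip_scale V R). Qed.

Lemma ulip_comp V V' W (S : set V) (S' : set V') x0 (g : V -> V') (f : T -> V' -> W) :
  S x0 -> (forall x, S x -> S' (g x)) ->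
  ulip S x0 (fun _ : T => g) -> ulip S' (g x0) f -> ulip S x0 (fun t x => f t (g x)).
Proof.
move=> Sx0 SS' [e [L [e0 L0 H1 H2]]] [e' [L' [e0' L0' H1' H2']]].
have L1 : 0 < L + 1 by rewrite ltr_wpDl.
(* The radius [e' / (L + 1)] keeps the image within [e'] of [g x0]. The parameter [t] stays in the
   claim because [T] may be empty while the Lipschitz bound on [g] is available only at some [t]. *)
have near x : S x -> `|x - x0| < Num.min e (e' / (L + 1)) -> forall t : T, `|g x - g x0| < e'.
  move=> Sx; rewrite lt_min => /andP[xe xe'] t.
  apply: le_lt_trans (H2 t _ _ Sx Sx0 xe _) _; first by rewrite subrr normr0.
  move: xe'; rewrite ltr_pdivlMr// mulrC; apply: le_lt_trans.
  by rewrite ler_wpM2r// lerDl.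
exists (Num.min e (e' / (L + 1))), (L' * L + L'); split; rewrite ?addr_ge0 ?mulr_ge0//.
- by rewrite lt_min e0 divr_gt0.
- move=> t x Sx xe; apply: le_trans (H1' t _ (SS' _ Sx) (near _ Sx xe t)) _.
  by rewrite lerDr mulr_ge0.
- move=> t x y Sx Sy xe ye.
  apply: le_trans (H2' t _ _ (SS' _ Sx) (SS' _ Sy) (near _ Sx xe t) (near _ Sy ye t)) _.
  rewrite mulrDl ler_wpDr ?mulr_ge0// -mulrA ler_wpM2l//.
  by move: xe ye; rewrite !lt_min => /andP[xe _] /andP[ye _]; exact: H2.
Qed.

End ulip_theory.

Section row_vectors.
Context {R : realType}.

Lemma coord_le_norm n (x : 'rV[R]_n) j : `|x 0 j| <= `|x|.
Proof. by rewrite [leRHS]/Num.Def.normr/= mx_normrE; exact: (le_bigmax _ _ (0, j)). Qed.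

Lemma norm_le_coord n (x : 'rV[R]_n) (C : R) : 0 <= C -> (forall j, `|x 0 j| <= C) -> `|x| <= C.
Proof.
move=> C0 H; rewrite [leLHS]/Num.Def.normr/= mx_normrE (bigmax_le _ C0)// => -[i j] _ /=.
by rewrite ord1.
Qed.

Lemma row_basisE n (x : 'rV[R]_n) : x = \sum_j x 0 j *: delta_mx 0 j.
Proof. exact: row_sum_delta. Qed.

Lemma linear_row_bound n (W : normedModType R) (f : {linear 'rV[R]_n -> W}) :
  exists2 L : R, 0 <= L & forall x, `|f x| <= L * `|x|.
Proof.
exists (\sum_j `|f (delta_mx 0 j)|); first exact: sumr_ge0.
move=> x; rewrite [x in f x]row_basisE linear_sum mulr_suml.
apply: le_trans (ler_norm_sum _ _ _) _; apply: ler_sum => j _.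
by rewrite linearZ normrZ mulrC ler_wpM2l// coord_le_norm.
Qed.

Lemma linear_row_continuous n (W : normedModType R) (f : {linear 'rV[R]_n -> W}) :
  continuous f.
Proof.
have [L L0 H] := linear_row_bound f.
by apply: (@lipschitz_continuous _ _ _ _ L) => x y; rewrite -linearB.
Qed.

Lemma linear_row_ulip n (W : normedModType R) (f : {linear 'rV[R]_n -> W}) (T : Type) S x0 :
  ulip S x0 (fun _ : T => f).
Proof.
have [L L0 H] := linear_row_bound f.
by apply: (@ulip_lipschitz _ _ _ _ _ _ _ L) => x y; rewrite -linearB.
Qed.

End row_vectors.

(** A working replacement for continuous differentiability at [x0], closed under sums, products and
    compositions by short arguments. Averaging needs the derivatives near the origin only through
    the Lipschitz constants. *)
Definition nice (R : realType) (V W : normedModType R) (f : V -> W) (x0 : V) : Prop :=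
  (\forall x \near x0, differentiable f x) /\ ulip setT x0 (fun _ : unit => f).

Section nice_theory.
Context {R : realType} {V : normedModType R}.
Implicit Types W : normedModType R.

Lemma nice_differentiable W (f : V -> W) x0 : nice f x0 -> differentiable f x0.
Proof. by move=> [/nbhs_singleton]. Qed.

Lemma nice_continuous W (f : V -> W) x0 : nice f x0 -> {for x0, continuous f}.
Proof. by move=> /nice_differentiable; exact: differentiable_continuous. Qed.

Lemma nice_ulip W (f : V -> W) x0 (T : Type) (S : set V) : nice f x0 -> ulip S x0 (fun _ : T => f).
Proof.
by move=> [_ [e [L [e0 L0 H1 H2]]]]; exists e, L; split => // _; [move=> x _; exact: (H1 tt)|
  move=> x y _ _; exact: (H2 tt)].
Qed.

Lemma nice_near W (f g : V -> W) x0 : (\forall x \near x0, f x = g x) -> nice f x0 -> nice g x0.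
Proof.
move=> fg [d u]; split.
  have := near_join fg; move: d; apply: filterS2 => x dx fgx.
  exact: near_eq_differentiable dx.
by apply: ulip_near u; apply: filterS fg.
Qed.

Lemma nice_cst W (c : W) x0 : nice (fun _ : V => c) x0.
Proof.
split; last exact: ulip_cst.
by apply: nearW => x; exact: differentiable_cst.
Qed.

Lemma nice_add W (f g : V -> W) x0 : nice f x0 -> nice g x0 -> nice (fun x => f x + g x) x0.
Proof.
move=> [df uf] [dg ug]; split; last exact: ulip_add.
by apply: filterS2 df dg => x; exact: differentiableD.
Qed.

Lemma nice_opp W (f : V -> W) x0 : nice f x0 -> nice (fun x => - f x) x0.
Proof.
move=> [df uf]; split; last exact: ulip_opp.
by apply: filterS df => x; exact: differentiableN.
Qed.

Lemma nice_sub W (f g : V -> W) x0 : nice f x0 -> nice g x0 -> nice (fun x => f x - g x) x0.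
Proof. by move=> nf ng; apply: nice_add => //; exact: nice_opp. Qed.

Lemma nice_sum W (I : Type) (r : seq I) (P : pred I) (f : I -> V -> W) x0 :
  (forall i, nice (f i) x0) -> nice (fun x => \sum_(i <- r | P i) f i x) x0.
Proof.
move=> H; elim: r => [|i r IH].
  by apply: nice_near (nice_cst 0 _); apply: nearW => x; rewrite big_nil.
case: (boolP (P i)) => Pi.
  by apply: nice_near (nice_add (H i) IH); apply: nearW => x; rewrite big_cons Pi.
by apply: nice_near IH; apply: nearW => x; rewrite big_cons (negbTE Pi).
Qed.

Lemma nice_mul (f g : V -> R) x0 : nice f x0 -> nice g x0 -> nice (fun x => f x * g x) x0.
Proof.
move=> [df uf] [dg ug]; split; last exact: ulip_mul.
by apply: filterS2 df dg => x; exact: differentiableM.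
Qed.

Lemma nice_scalel W (k : V -> R) (w : W) x0 : nice k x0 -> nice (fun x => k x *: w) x0.
Proof.
move=> [dk uk]; split; last by apply: ulip_scale => //; exact: ulip_cst.
by apply: filterS dk => x; exact: differentiableZl.
Qed.

Lemma nice_comp {V' : normedModType R} W (g : V -> V') (f : V' -> W) x0 :
  nice g x0 -> nice f (g x0) -> nice (fun x => f (g x)) x0.
Proof.
move=> ng [df uf]; split; last first.
  by apply: (@ulip_comp _ _ _ _ _ setT setT x0 g (fun=> f)) => //; exact: nice_ulip.
have cg := nice_continuous ng.
have := cg _ df; case: ng => dg _; move: dg; apply: filterS2 => x dgx dfx.
exact: (@differentiable_comp _ _ _ _ g f).
Qed.

Lemma nice_row n (f : V -> 'rV[R]_n) x0 : (forall j, nice (fun x => f x 0 j) x0) -> nice f x0.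
Proof.
move=> H; have := nice_sum (index_enum 'I_n) predT (fun j => nice_scalel (delta_mx 0 j : 'rV[R]_n) (H j)).
by apply: nice_near; apply: nearW => x; rewrite -row_basisE.
Qed.

End nice_theory.

Section nice_rows.
Context {R : realType}.

Lemma nice_linear_row n (W : normedModType R) (f : {linear 'rV[R]_n -> W}) x0 : nice f x0.
Proof.
split; last exact: linear_row_ulip.
by apply: near_all => x; apply: linear_differentiable; exact: linear_row_continuous.
Qed.

Lemma nice_id (V : normedModType R) (x0 : V) : nice (fun x => x) x0.
Proof.
split; first by apply: near_all => x; exact: (@ex_diff _ _ _ _ _ _ _ (is_diff_id x)).
by apply: (@ulip_lipschitz _ _ _ _ _ _ _ 1) => x y; rewrite mul1r.
Qed.

Lemma coord_is_linear n (j : 'I_n) : linear (fun x : 'rV[R]_n => x 0 j).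
Proof. by move=> a x y; rewrite !mxE. Qed.

Definition coordl n (j : 'I_n) : {linear 'rV[R]_n -> R} :=
  HB.pack (fun x : 'rV[R]_n => x 0 j) (GRing.isLinear.Build _ _ _ _ _ (coord_is_linear j)).

Lemma nice_coord (V : normedModType R) n (f : V -> 'rV[R]_n) x0 j :
  nice f x0 -> nice (fun x => f x 0 j) x0.
Proof. by move=> nf; apply: (nice_comp (f := coordl j) nf); exact: nice_linear_row. Qed.

Lemma nice_scale (V : normedModType R) n (k : V -> R) (f : V -> 'rV[R]_n) x0 :
  nice k x0 -> nice f x0 -> nice (fun x => k x *: f x) x0.
Proof.
move=> nk nf; apply: nice_row => j.
apply: nice_near (nice_mul nk (nice_coord j nf)).
by apply: nearW => x; rewrite mxE.
Qed.

(** The generators [b] and coordinates [c] let one proof serve both row vectors and the real line.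
    Continuity of the derivatives along [b] bounds the differential near [x0], and the mean value
    inequality along segments of the ball turns this into a Lipschitz bound. *)
Lemma cont_diff1_nice (V W : normedModType R) m (b : 'I_m -> V) (c : 'I_m -> V -> R)
    (O : set V) (f : V -> W) x0 :
  (forall v, v = \sum_i c i v *: b i) -> (forall i v, `|c i v| <= `|v|) ->
  open O -> O x0 -> cont_diff 1 O f -> nice f x0.
Proof.
move=> cb cle oO Ox0 [df Df].
have bnd i : exists2 e, 0 < e & forall x, `|x - x0| < e -> `|'D_(b i) f x| <= `|'D_(b i) f x0| + 1.
  have /cvgrPdist_lt/(_ _ (@ltr01 R)) := Df (b i) _ Ox0.
  move=> /nbhs_normP[e /= e0 He]; exists e => // x xe.
  have := He x; rewrite /ball_/= distrC => /(_ xe) /ltW; rewrite distrC => H.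
  by rewrite -[X in `|X|](subrK ('D_(b i) f x0)) addrC (le_trans (ler_normD _ _))// lerD.
have [e /all_and2[e0 He]] := choice (fun i => let: ex_intro2 e p q := bnd i in ex_intro _ e (conj p q)).
have [r r0 rO] := open_norm oO Ox0.
pose d := \big[Num.min/r]_i e i.
have d0 : 0 < d by rewrite /d; elim/big_ind : _ => // x y x0' y0'; rewrite lt_min x0'.
have dr : d <= r by rewrite /d; elim/big_rec : _ => // i y _ yr; rewrite ge_min yr orbT.
have de i : d <= e i by rewrite /d (bigD1 i)//= ge_min lexx.
pose L := \sum_i (`|'D_(b i) f x0| + 1).
have L0 : 0 <= L by apply: sumr_ge0 => i _; rewrite addr_ge0.
have dO x : `|x - x0| < d -> O x by move=> xd; apply: rO; exact: lt_le_trans dr.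
have dL x v : `|x - x0| < d -> `|'d f x v| <= L * `|v|.
  move=> xd; have dfx := df _ (dO _ xd).
  rewrite {1}[v]cb linear_sum mulr_suml; apply: le_trans (ler_norm_sum _ _ _) _.
  apply: ler_sum => i _; rewrite linearZ normrZ mulrC -deriveE//.
  by apply: ler_pM => //; apply: He; exact: lt_le_trans (de i).
have lip x y : `|x - x0| < d -> `|y - x0| < d -> `|f x - f y| <= L * `|x - y|.
  move=> xd yd.
  pose g (t : R) := f (y + t *: (x - y)).
  have seg t : 0 <= t <= 1 -> `|y + t *: (x - y) - x0| < d.
    move=> /andP[t0 t1].
    have -> : y + t *: (x - y) - x0 = (1 - t) *: (y - x0) + t *: (x - x0).
      have -> : x - y = (x - x0) - (y - x0) by rewrite opprB addrA subrK.
      by rewrite addrAC scalerBl scale1r scalerBr addrA addrAC.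
    apply: le_lt_trans (ler_normD _ _) _; rewrite !normrZ (ger0_norm t0) ger0_norm ?subr_ge0//.
    have -> : d = (1 - t) * d + t * d by rewrite -mulrDl subrK mul1r.
    (* For [t < 1] strictness comes from the first term; at [t = 1] only the second remains. *)
    have [t10|] := eqVneq t 1; first by rewrite t10 subrr !mul0r !add0r !mul1r.
    move=> tn1; apply: ltr_leD; first by rewrite ltr_pM2l// subr_gt0 lt_neqAle tn1.
    by rewrite ler_wpM2l// ltW.
  have gd (t : R) : 0 <= t <= 1 -> is_derive t 1 g ('d f (y + t *: (x - y)) (x - y)).
    move=> t01; apply: isd_comp; first exact: df (dO _ (seg _ t01)).
    have H := isd_add (isd_cst y t 1) (isd_scalel (isd_id t 1) (isd_cst (x - y) t 1)).
    by apply: (isd_eq H); rewrite add0r scaler0 add0r scale1r.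
  have H := @mean_value_ineq R W g _ (fun t => L * `|x - y| * t) (fun=> L * `|x - y|) 0 1 ler01 gd.
  have g1 : g 1 = f x by rewrite /g scale1r addrC subrK.
  have g0 : g 0 = f y by rewrite /g scale0r addr0.
  rewrite g1 g0 mulr1 mulr0 subr0 in H; apply: H => t t01.
    by apply: (isd_eq (isd_mull (L * `|x - y|) (isd_id t 1))); rewrite mulr1.
  exact: dL (seg _ t01).
split.
  apply: (filterS (P := O)); first by move=> x; exact: df.
  exact: open_nbhs_nbhs.
exists d, (L * d + `|f x0| + L); split => //.
- by rewrite !addr_ge0// mulr_ge0// ltW.
- move=> _ x _ xd; rewrite -[f x](subrK (f x0)) (le_trans (ler_normD _ _))//.
  apply: ler_wpDr => //; rewrite lerD2r.
  have x0d : `|x0 - x0| < d by rewrite subrr normr0.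
  apply: le_trans (lip _ _ xd x0d) _; rewrite ler_wpM2l//; exact: ltW.
- move=> _ x y _ _ xd yd; apply: le_trans (lip _ _ xd yd) _.
  by rewrite ler_wpM2r// lerDr addr_ge0// mulr_ge0// ltW.
Qed.

Lemma smooth_row_nice n (W : normedModType R) (O : set 'rV[R]_n) (f : 'rV[R]_n -> W) x0 :
  open O -> O x0 -> smooth O f -> nice f x0.
Proof.
move=> oO Ox0 /(_ 1%N); apply: (cont_diff1_nice (b := fun i => delta_mx 0 i) (c := fun i x => x 0 i)) => //.
  exact: row_basisE.
by move=> i v; exact: coord_le_norm.
Qed.

Lemma smooth_real_nice (W : normedModType R) (O : set R) (f : R -> W) x0 :
  open O -> O x0 -> smooth O f -> nice f x0.
Proof.
move=> oO Ox0 /(_ 1%N); apply: (@cont_diff1_nice R W 1 (fun=> 1 : R) (fun _ x => x)) => //.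
by move=> v; rewrite big_ord1 [v *: 1]mulr1.
Qed.

End nice_rows.

(** * Averaging *)

Section misc.
Context {R : realType}.

Lemma nonincreasing_isd (f df : R -> R) (a b : R) : a <= b ->
  (forall t, a <= t <= b -> is_derive (t : R) 1 f (df t)) ->
  (forall t, a <= t <= b -> df t <= 0) -> f b <= f a.
Proof.
move=> ab fd H.
have [||c cab E] := @MVT_segment R f df a b ab.
- by move=> x xab; apply: fd; move: xab; rewrite in_itv/= => /andP[/ltW -> /ltW].
- apply: continuous_in_subspaceT => t; rewrite inE/= in_itv/= => tab.
  exact: isd_continuous (fd _ tab).
have cab' : a <= c <= b by move: cab; rewrite in_itv.
rewrite -subr_le0 E mulr_le0_ge0 ?subr_ge0//; exact: H.
Qed.

(** This is how [nice] yields bounds on differentials: the Lipschitz estimate is read off along the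
    line through [x] in direction [v]. *)
Lemma lip_diff_bound (V W : normedModType R) (f : V -> W) (x v : V) (L : R) :
  differentiable f x -> (\forall y \near x, `|f y - f x| <= L * `|y - x|) ->
  `|'d f x v| <= L * `|v|.
Proof.
move=> df /near_normP[e e0 He].
have H0 : is_derive (0 : R) 1 (fun s : R => x + s *: v) v.
  have H := isd_add (isd_cst x (0 : R) 1) (isd_scalel (isd_id (0 : R) 1) (isd_cst v (0 : R) 1)).
  by apply: (isd_eq H); rewrite add0r scaler0 add0r scale1r.
have dfx : differentiable f (x + 0 *: v) by rewrite scale0r addr0.
have H1 : is_derive (0 : R) 1 (fun s : R => f (x + s *: v)) ('d f x v).
  by have := @isd_comp _ _ _ _ f (fun s : R => x + s *: v) 0 1 v dfx H0; rewrite scale0r addr0.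
apply: (isd_lipschitz_bound H1); apply/near_normP.
have v1 : 0 < `|v| + 1 by rewrite ltr_wpDl.
exists (e / (`|v| + 1)); first by rewrite divr_gt0.
move=> s; rewrite subr0 => se; rewrite scale0r addr0.
have E : `|x + s *: v - x| = `|v| * `|s| by rewrite addrC addKr normrZ mulrC.
apply: le_trans (He _ _) _; last by rewrite E mulrA.
move: se; rewrite E ltr_pdivlMr// mulrC; apply: le_lt_trans.
by rewrite ler_wpM2r// lerDl.
Qed.

Lemma continuous_bigsum (V W : normedModType R) (J : Type) (r : seq J) (P : pred J)
    (f : J -> V -> W) (x : V) : (forall k, {for x, continuous (f k)}) ->
  {for x, continuous (fun y => \sum_(k <- r | P k) f k y)}.
Proof.
move=> H; rewrite /prop_for /continuous_at; elim: r => [|k r IH].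
  by under eq_cvg do rewrite big_nil; rewrite big_nil; exact: cvg_cst.
under eq_cvg do rewrite big_cons; rewrite big_cons.
by case: (P k) => //; apply: cvgD => //; exact: H.
Qed.

Lemma continuous_scalel (W : normedModType R) (k : R -> R) (w : W) (t : R) :
  {for t, continuous k} -> {for t, continuous (fun s => k s *: w)}.
Proof. by move=> ck; apply: cvgZr_tmp. Qed.

(** Applied to each coordinate this is a 1-Lipschitz retraction onto the closed ball of the maximum
    norm. It turns a field controlled near the origin into a bounded, globally Lipschitz one. *)
Definition clamp (r x : R) : R := Num.max (- r) (Num.min r x).

Lemma clamp_id r x : `|x| <= r -> clamp r x = x.
Proof.
rewrite ler_norml => /andP[h1 h2]; rewrite /clamp.
by rewrite (min_idPr h2) (max_idPr h1).
Qed.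

Lemma clamp_le r x : 0 <= r -> `|clamp r x| <= r.
Proof.
by move=> r0; rewrite /clamp ler_norml le_max lexx/= ge_max ge_min lexx/= andbT; lra.
Qed.

Lemma min_lip (r x y : R) : `|Num.min r x - Num.min r y| <= `|x - y|.
Proof.
wlog xy : x y / x <= y.
  by move=> W; have [/W//|/ltW/W] := leP x y; rewrite distrC [X in _ <= X]distrC.
rewrite distrC [X in _ <= X]distrC [X in _ <= X]ger0_norm ?subr_ge0//.
rewrite ger0_norm; last by rewrite subr_ge0 le_min !ge_min lexx/= xy orbT.
rewrite /Num.min; case: ltP => ?; case: ltP => ?; lra.
Qed.

Lemma max_lip (r x y : R) : `|Num.max r x - Num.max r y| <= `|x - y|.
Proof.
have E z : Num.max r z = - Num.min (- r) (- z) by rewrite oppr_min !opprK.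
by rewrite !E -opprD normrN (le_trans (min_lip _ _ _))// -opprD normrN.
Qed.

Lemma clamp_lip r x y : `|clamp r x - clamp r y| <= `|x - y|.
Proof. exact: le_trans (max_lip _ _ _) (min_lip _ _ _). Qed.

Definition clamp_row n r (x : 'rV[R]_n) : 'rV[R]_n := \row_j clamp r (x 0 j).

Lemma clamp_row_id n r (x : 'rV[R]_n) : `|x| <= r -> clamp_row r x = x.
Proof.
by move=> xr; apply/rowP => j; rewrite mxE clamp_id// (le_trans (coord_le_norm _ _)).
Qed.

Lemma clamp_row_le n r (x : 'rV[R]_n) : 0 <= r -> `|clamp_row r x| <= r.
Proof. by move=> r0; apply: norm_le_coord => // j; rewrite mxE clamp_le. Qed.

Lemma clamp_row_lip n r (x y : 'rV[R]_n) : `|clamp_row r x - clamp_row r y| <= `|x - y|.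
Proof.
apply: norm_le_coord => // j; rewrite !mxE (le_trans (clamp_lip _ _ _))//.
by have := coord_le_norm (x - y) j; rewrite !mxE.
Qed.

(** Expanding [B] in coordinates reduces the claim to the product rule for real functions. *)
Lemma isd_bilinear n (B : 'rV[R]_n -> 'rV[R]_n -> R) (z : R -> 'rV[R]_n) (t : R) dz :
  (forall x, linear (B x)) -> (forall x y, B x y = B y x) ->
  is_derive t 1 z dz -> is_derive t 1 (fun s => B (z s) (z s)) (2 * B (z t) dz).
Proof.
move=> lB sB zd.
have Blin x y k w : B x (k *: y + w) = k * B x y + B x w by exact: lB.
have B0 x : B x 0 = 0 by have := Blin x 0 1 0; rewrite scaler0 addr0 => /eqP; rewrite mul1r -subr_eq0 opprD addNKr oppr_eq0 => /eqP.
have BE x y : B x y = \sum_j y 0 j * B x (delta_mx 0 j).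
  rewrite {1}[y]row_basisE; elim/big_rec2 : _ => // j w k _ <-.
  by rewrite Blin.
have BE2 x y : B x y = \sum_j (\sum_i x 0 i * B (delta_mx 0 j) (delta_mx 0 i)) * y 0 j.
  by rewrite BE; apply: eq_bigr => j _; rewrite mulrC sB BE.
have H : is_derive t 1 (fun s => \sum_j (\sum_i z s 0 i * B (delta_mx 0 j) (delta_mx 0 i)) * z s 0 j)
   (\sum_j ((\sum_i z t 0 i * B (delta_mx 0 j) (delta_mx 0 i)) * dz 0 j 
         + (\sum_i dz 0 i * B (delta_mx 0 j) (delta_mx 0 i)) * z t 0 j)).
  apply: isd_sum => j _; apply: isd_mul; last exact: isd_coord.
  apply: isd_sum => i _.
  apply: (isd_eq (isd_mul (isd_coord 0 i zd) (isd_cst (B (delta_mx 0 j) (delta_mx 0 i)) t 1))).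
  by rewrite mulr0 add0r.
apply: (isd_near (f := fun s => \sum_j (\sum_i z s 0 i * B (delta_mx 0 j) (delta_mx 0 i)) * z s 0 j)).
  by apply: near_all => s; rewrite -BE2.
apply: (isd_eq H); rewrite big_split/= -!BE2 [B dz _]sB; ring.
Qed.

Lemma expR_decay (c x y : R) : 0 < c -> 0 <= x -> 0 < y ->
  exists2 D : R, 0 < D & forall t, D <= t -> expR (- c * t) * x <= y.
Proof.
(* The time comes from [1 + c * t <= expR (c * t)]; the extra 1 keeps it positive when [x = 0]. *)
move=> c0 x0 y0; exists ((x / y + 1) / c); first by rewrite divr_gt0// ltr_wpDl// divr_ge0// ltW.
move=> t Dt; rewrite mulNr expRN mulrC ler_pdivrMr ?expR_gt0//.
have xy : x = y * (x / y) by rewrite mulrC divfK// lt0r_neq0.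
rewrite {1}xy ler_pM2l//.
apply: le_trans (expR_ge1Dx _); move: Dt; rewrite ler_pdivrMr// [t * c]mulrC; lra.
Qed.

End misc.

Section averaging.
Context {R : realType} {K : nat} {I : finType}.
Variables (f0 : 'rV[R]_K -> 'rV[R]_K) (Y : I -> 'rV[R]_K -> 'rV[R]_K).
Variables (c C : I -> R -> R) (Cb : R).
Hypothesis nf0 : nice f0 0.
Hypothesis nY : forall k, nice (Y k) 0.
Hypothesis f00 : f0 0 = 0.
Hypothesis ccont : forall k, continuous (c k).
Hypothesis cb : forall k t, `|c k t| <= Cb.
Hypothesis Cd : forall k (t : R), is_derive t 1 (C k) (c k t).
Hypothesis CB : forall k t, `|C k t| <= Cb.
Variables (B : 'rV[R]_K -> 'rV[R]_K -> R) (m M gam : R).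
Hypothesis lB : forall x, linear (B x).
Hypothesis sB : forall x y, B x y = B y x.
Hypothesis m0 : 0 < m.
Hypothesis Bm : forall x, m * `|x| ^+ 2 <= B x x.
Hypothesis BM : forall x y, `|B x y| <= M * (`|x| * `|y|).
Hypothesis gam0 : 0 < gam.
Hypothesis Blyap : forall x, B x ('d f0 0 x) <= - gam * `|x| ^+ 2.

Let F t x := f0 x + \sum_k c k t *: Y k x.
Let q k x := 2 * B x (Y k x).

Let Blin x y k w : B x (k *: y + w) = k * B x y + B x w.
Proof. exact: lB. Qed.
Let B0 x : B x 0 = 0.
Proof.
have := Blin x 0 1 0; rewrite scaler0 addr0 => /eqP.
by rewrite mul1r -subr_eq0 opprD addNKr oppr_eq0 => /eqP.
Qed.
Let BD x y w : B x (y + w) = B x y + B x w.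
Proof. by have := Blin x y 1 w; rewrite scale1r mul1r. Qed.
Let BE x y : B x y = \sum_j (\sum_i x 0 i * B (delta_mx 0 j) (delta_mx 0 i)) * y 0 j.
Proof.
have H u v : B u v = \sum_j v 0 j * B u (delta_mx 0 j).
  by rewrite {1}[v]row_basisE; elim/big_rec2 : _ => // j w k _ <-; rewrite Blin.
by rewrite H; apply: eq_bigr => j _; rewrite mulrC sB H.
Qed.
Let BS (J : finType) x (a : J -> R) (y : J -> 'rV[R]_K) :
  B x (\sum_k a k *: y k) = \sum_k a k * B x (y k).
Proof. by elim/big_rec2 : _ => // k u v _ <-; rewrite Blin. Qed.

Let nq k : nice (q k) 0.
Proof.
apply: nice_near (nice_mul (nice_cst (2 : R) _) (_ : nice (fun x : 'rV[R]_K => B x (Y k x)) 0)).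
  exact: near_all.
have : nice (fun x : 'rV[R]_K => \sum_j (\sum_i x 0 i * B (delta_mx 0 j) (delta_mx 0 i)) * Y k x 0 j) 0.
  apply: nice_sum => j; apply: nice_mul; last exact: nice_coord.
  apply: nice_sum => i; apply: nice_mul; last exact: nice_cst.
  by apply: nice_coord; exact: nice_id.
by apply: nice_near; apply: near_all => x; rewrite -BE.
Qed.

Let uF : ulip setT 0 F.
Proof.
apply: ulip_add; first exact: nice_ulip.
apply: ulip_sum => k; apply: ulip_scale; last exact: nice_ulip.
exact: (ulip_bounded _ _ (cb k)).
Qed.

(* W = V - (1/om) sum_k C_k(om t) q_k removes the oscillating part of V' up to
   an error of order 1/om. *)
Lemma averaging_decay (rmax : R) : 0 < rmax -> exists r1 cc D : R, [/\ 0 < r1, r1 <= rmax, 0 < cc, 0 < D &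
  forall om t0 t1 (z : R -> 'rV[R]_K), 1 <= om -> t0 <= t1 ->
    (forall t, t0 <= t <= t1 -> `|z t| <= r1) ->
    (forall t, t0 <= t <= t1 -> is_derive t 1 z (F (om * t) (z t))) ->
    B (z t1) (z t1) <= expR (- cc * (t1 - t0)) * B (z t0) (z t0) + D / om].
Proof.
move=> rmax0.
have [eF [LF [eF0 LF0 FB FL]]] := uF.
have /choice[rq /choice[Lq qP]] : forall k, exists e L : R, [/\ 0 < e, 0 <= L,
   forall x, `|x| < e -> differentiable (q k) x,
   forall x, `|x| < e -> `|q k x| <= L & forall x y, `|x| < e -> `|y| < e -> `|q k x - q k y| <= L * `|x - y|].
  move=> k; have [/near_normP[e1 e10 dq] [e [L [e0 L0 H1 H2]]]] := nq k.
  exists (Num.min e e1), L; split => //.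
  - by rewrite lt_min e0.
  - by move=> x; rewrite lt_min => /andP[xe xe1]; apply: dq; rewrite subr0.
  - by move=> x; rewrite lt_min => /andP[xe xe1]; apply: (H1 tt); rewrite ?subr0.
  - by move=> x y; rewrite !lt_min => /andP[xe _] /andP[ye _]; apply: (H2 tt); rewrite ?subr0.
pose M1 := `|M| + 1.
have M10 : 0 < M1 by rewrite ltr_wpDl.
have BM1 x y : `|B x y| <= M1 * (`|x| * `|y|).
  by apply: le_trans (BM x y) _; rewrite ler_wpM2r ?mulr_ge0// (le_trans (ler_norm M))// lerDl.
(* Close to the origin the nonlinear remainder of [f0] is at most [gam / (2 * M1)] times the norm of
   [x], which costs half of the linear decay. *)
have [e1 e10 f0L] : exists2 e, 0 < e & forall x, `|x| < e -> B x (f0 x) <= - (gam / 2) * `|x| ^+ 2.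
  have df0 := nice_differentiable nf0.
  have e20 : 0 < gam / (2 * M1) by rewrite divr_gt0// mulr_gt0.
  have /near_normP[e e0 He] := diff_eps df0 e20.
  exists e => // x xe; have := He x; rewrite subr0 f00 subr0 addr0 => /(_ xe) {}He.
  have -> : f0 x = (f0 x - 'd f0 0 x) + 'd f0 0 x by rewrite subrK.
  rewrite BD; apply: le_trans (lerD (ler_norm _) (Blyap x)) _.
  apply: (@le_trans _ _ (M1 * (`|x| * (gam / (2 * M1) * `|x|)) + - gam * `|x| ^+ 2)).
    rewrite lerD2r (le_trans (BM1 _ _))// ler_pM2l// ler_wpM2l//.
  rewrite le_eqVlt; apply/orP; left; apply/eqP; field; exact: lt0r_neq0.
pose r1 := Num.min (rmax) (Num.min (eF / 2) (Num.min (e1 / 2) (\big[Num.min/1]_k (rq k / 2)))).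
have r10 : 0 < r1.
  rewrite !lt_min rmax0 !divr_gt0//=; elim/big_ind : _ => // [x y|k _]; first by rewrite lt_min => -> ->.
  by rewrite divr_gt0//; have [] := qP k.
have r1q k : r1 < rq k.
  have [ek _ _ _ _] := qP k.
  apply: (@le_lt_trans _ _ (rq k / 2)); last lra.
  rewrite !ge_min; apply/orP; right; apply/orP; right; apply/orP; right.
  by rewrite (bigD1 k)//= ge_min lexx.
have r1F : r1 < eF.
  apply: (@le_lt_trans _ _ (eF / 2)); last lra.
  by rewrite !ge_min lexx orbT.
have r1e : r1 < e1.
  apply: (@le_lt_trans _ _ (e1 / 2)); last lra.
  by rewrite !ge_min lexx !orbT.
(* The rate in terms of V itself, obtained from V being at most [M1] times the squared norm. *)
pose cc := gam / M1.
have cc0 : 0 < cc by rewrite divr_gt0.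
have Cb0 (k : I) : 0 <= Cb by exact: le_trans (normr_ge0 _) (@CB k 0).
pose D2 := \sum_k Cb * Lq k.
have D20 : 0 <= D2 by apply: sumr_ge0 => k _; rewrite mulr_ge0 ?Cb0//; have [] := qP k.
pose D1 := \sum_k Cb * (Lq k * LF).
have D10 : 0 <= D1 by apply: sumr_ge0 => k _; rewrite !mulr_ge0 ?Cb0//; have [] := qP k.
clear Cb0; pose D3 := D1 + cc * D2.
have D30 : 0 <= D3 by apply: addr_ge0 => //; apply: mulr_ge0 => //; exact: ltW.
have D3c : 0 <= D3 / cc by rewrite divr_ge0// ltW.
(* [D2] bounds the gap between V and W at each of the two end times, up to the factor [1 / om]. [D1]
   bounds the error in the derivative of W, [D3] is that error once V has been replaced by W in the
   decay term, and [D3 / cc] is the level at which decay and error balance. *)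
pose D := 2 * D2 + D3 / cc + 1.
exists r1, cc, D; split => //.
- by rewrite ge_min lexx.
- rewrite /D; lra.
move=> om t0 t1 z om1 t01 zr zd.
have om0 : 0 < om by exact: lt_le_trans om1.
have om10 : 0 <= om^-1 by rewrite invr_ge0 ltW.
have nom x : `|om^-1 * x| = `|x| / om by rewrite normrM ger0_norm// mulrC.
pose Wc t := om^-1 * \sum_k C k (om * t) * q k (z t).
pose W t := B (z t) (z t) - Wc t.
have WcB t : t0 <= t <= t1 -> `|Wc t| <= D2 / om.
  move=> tt; rewrite nom ler_wpM2r//.
  apply: le_trans (ler_norm_sum _ _ _) _; apply: ler_sum => k _.
  have [_ Lk _ qB _] := qP k.
  by rewrite normrM ler_pM// qB// (le_lt_trans (zr _ tt)).
pose dq k t := 'd (q k) (z t) (F (om * t) (z t)).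
have dqB k t : t0 <= t <= t1 -> `|dq k t| <= Lq k * LF.
  move=> tt; have zt := zr _ tt; have [_ Lk qd _ qL] := qP k.
  have zk := le_lt_trans zt (r1q k).
  apply: le_trans (lip_diff_bound (L := Lq k) _ (qd _ zk) _) _.
    apply/near_normP; exists (rq k - `|z t|); first by rewrite subr_gt0.
    move=> y yz; apply: qL => //; rewrite -[y](subrK (z t)) (le_lt_trans (ler_normD _ _))//; lra.
  rewrite ler_wpM2l// FB// subr0; exact: le_lt_trans r1F.
pose dW t := 2 * B (z t) (f0 (z t)) - om^-1 * \sum_k C k (om * t) * dq k t.
have Wd t : t0 <= t <= t1 -> is_derive t 1 W (dW t).
  move=> tt; have zt := zr _ tt.
  have Vd := isd_bilinear lB sB (zd _ tt).
  have omd : is_derive t 1 (fun s : R => om * s) om.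
    by apply: (isd_eq (isd_mull om (isd_id t 1))); rewrite mulr1.
  have Ckd k : is_derive t 1 (fun s => C k (om * s)) (c k (om * t) * om).
    exact: (@is_derive1_comp R (C k) (fun s => om * s) t _ _ (Cd k (om * t)) omd).
  have qd k : is_derive t 1 (fun s => q k (z s)) (dq k t).
    have [_ _ qd _ _] := qP k.
    by apply: (@isd_comp _ _ _ _ (q k) z) (zd _ tt); apply: qd; exact: le_lt_trans (r1q k).
  have Sd : is_derive t 1 (fun s => \sum_k C k (om * s) * q k (z s)) 
     (\sum_k (C k (om * t) * dq k t + c k (om * t) * om * q k (z t))).
    by apply: isd_sum => k _; exact: isd_mul.
  apply: (isd_eq (isd_sub Vd (isd_mull om^-1 Sd))).
  rewrite /dW big_split/= mulrDr BD mulrDr BS.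
  (* Differentiating [C k (om * t)] yields a factor [om] that cancels [om^-1]: this is exactly the
     oscillating part of the derivative of V. *)
  have -> : om^-1 * \sum_k c k (om * t) * om * q k (z t) = 2 * \sum_k c k (om * t) * B (z t) (Y k (z t)).
    rewrite !mulr_sumr; apply: eq_bigr => k _; rewrite /q; field; exact: lt0r_neq0.
  ring.
have dWB t : t0 <= t <= t1 -> dW t <= - cc * W t + D3 / om.
  move=> tt; have zt := zr _ tt.
  have h1 : 2 * B (z t) (f0 (z t)) <= - cc * B (z t) (z t).
    have := f0L (z t) (le_lt_trans zt r1e).
    have := le_trans (ler_norm _) (BM1 (z t) (z t)).
    rewrite -expr2 => h2 h3.
    have : cc * B (z t) (z t) <= gam * `|z t| ^+ 2.
      rewrite /cc -mulrA ler_pM2l// mulrC ler_pdivrMr// mulrC; exact: h2.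
    lra.
  have h2 : `|om^-1 * \sum_k C k (om * t) * dq k t| <= D1 / om.
    rewrite nom ler_wpM2r//.
    apply: le_trans (ler_norm_sum _ _ _) _; apply: ler_sum => k _.
    by rewrite normrM ler_pM// dqB.
  have := WcB t tt; rewrite /dW /W; move: h2; rewrite !ler_norml => /andP[h3 h4] /andP[h5 h6].
  have : cc * Wc t >= - (cc * D2 / om).
    by rewrite -mulrA -mulrN ler_pM2l// .
  rewrite /D3 mulrDl; lra.
(* An integrating factor makes the differential inequality for W a monotonicity statement. *)
pose G t := (W t - D3 / cc / om) * expR (cc * (t - t0)).
have Gd t : t0 <= t <= t1 -> is_derive t 1 G ((W t - D3 / cc / om) * (expR (cc * (t - t0)) * cc) + dW t * expR (cc * (t - t0))).
  move=> tt.
  have Ed : is_derive t 1 (fun s : R => expR (cc * (s - t0))) (expR (cc * (t - t0)) * cc).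
    have Hk : is_derive t 1 (fun s : R => cc * (s - t0)) cc.
      by apply: (isd_eq (isd_mull cc (isd_sub (isd_id t 1) (isd_cst t0 t 1)))); rewrite subr0 mulr1.
    exact (@is_derive1_comp R expR (fun s => cc * (s - t0)) t _ _ (is_derive_expR _) Hk).
  have Wd' : is_derive t 1 (fun s => W s - D3 / cc / om) (dW t).
    by apply: (isd_eq (isd_sub (Wd _ tt) (isd_cst (D3 / cc / om) t 1))); rewrite subr0.
  exact: isd_mul.
have GN : G t1 <= G t0.
  apply: (nonincreasing_isd t01 Gd) => t tt.
  have E0 := expR_gt0 (cc * (t - t0)).
  have -> : (W t - D3 / cc / om) * (expR (cc * (t - t0)) * cc) + dW t * expR (cc * (t - t0)) =
     expR (cc * (t - t0)) * (dW t - (- cc * W t + D3 / om)).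
    by field; rewrite !lt0r_neq0.
  by rewrite mulr_ge0_le0// ?subr_le0 ?dWB// ltW.
move: GN; rewrite /G subrr mulr0 expR0 mulr1.
set E := expR (cc * (t1 - t0)).
have E0 : 0 < E by exact: expR_gt0.
have E1 : 1 <= E by rewrite /E -expR0 ler_expR mulr_ge0 ?subr_ge0// ltW.
rewrite -ler_pdivlMr// => GN.
rewrite mulNr expRN -/E.
have t0in : t0 <= t0 <= t1 by rewrite lexx.
have t1in : t0 <= t1 <= t1 by rewrite lexx t01.
have := WcB _ t0in; have := WcB _ t1in; rewrite !ler_norml => /andP[h1 h2] /andP[h3 h4].
have D2om : 0 <= D2 / om by rewrite divr_ge0// ltW.
have D3om : 0 <= D3 / cc / om by rewrite divr_ge0// ltW.
have h5 : (W t0 - D3 / cc / om) / E <= E^-1 * B (z t0) (z t0) + D2 / om.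
  rewrite mulrC; apply: (@le_trans _ _ (E^-1 * (B (z t0) (z t0) + D2 / om))).
    by rewrite ler_pM2l ?invr_gt0// /W; lra.
  by rewrite mulrDr lerD2l ler_piMl// invf_le1.
have -> : D / om = 2 * (D2 / om) + D3 / cc / om + om^-1 by rewrite /D; field; rewrite !lt0r_neq0.
by move: GN h5; rewrite /W; lra.
Qed.

(** A decaying V cannot carry the solution out of the ball of radius [r1], so the estimate of
    [averaging_decay] holds for all later times. The basin radius [s0] is fixed before [eps], as
    attractivity on one common set requires. The margin [d] is there because a solution must live on
    an open interval around [t0]. *)
Lemma averaging_stability (rmax : R) : 0 < rmax -> exists r1 s0 : R, [/\ 0 < r1, r1 <= rmax, 0 < s0,
  (forall eps, 0 < eps -> exists om0 del : R, [/\ 0 < om0, 0 < del &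
     forall om t0 z0, om0 <= om -> `|z0| <= del -> exists (z : R -> 'rV[R]_K) (d : R),
       [/\ 0 < d, z t0 = z0,
        forall t, t0 - d < t -> `|z t| < r1 /\ is_derive t 1 z (F (om * t) (z t)) &
        forall t, t0 <= t -> `|z t| <= eps]]) &
  (forall eps, 0 < eps -> exists om0 Del : R, [/\ 0 < om0, 0 < Del &
     forall om t0 z0, om0 <= om -> `|z0| <= s0 -> exists (z : R -> 'rV[R]_K) (d : R),
       [/\ 0 < d, z t0 = z0,
        forall t, t0 - d < t -> `|z t| < r1 /\ is_derive t 1 z (F (om * t) (z t)) &
        forall t, t0 + Del <= t -> `|z t| <= eps]])].
Proof.
move=> rmax0.
have [eF [LF [eF0 LF0 FB FL]]] := uF.
have rF0 : 0 < Num.min rmax (eF / 2) by rewrite lt_min rmax0 divr_gt0.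
have [r1 [cc [D [r10 r1max cc0 D0 dec]]]] := averaging_decay rF0.
have r1F : r1 < eF.
  have : r1 <= eF / 2 by rewrite (le_trans r1max)// ge_min lexx orbT.
  lra.
have {}r1max : r1 <= rmax by rewrite (le_trans r1max)// ge_min lexx.
pose M1 := `|M| + 1.
have M10 : 0 < M1 by rewrite ltr_wpDl.
have BM1 x : B x x <= M1 * `|x| ^+ 2.
  apply: le_trans (ler_norm _) _; apply: le_trans (BM x x) _.
  by rewrite expr2 ler_wpM2r ?mulr_ge0// (le_trans (ler_norm M))// lerDl.
have B_ge0 x : 0 <= B x x by apply: le_trans (Bm x); rewrite mulr_ge0 ?sqr_ge0 ?ltW.
(* Solutions of the field clamped to the ball of radius [r1] exist globally and stay in it. *)
have main om t0 z0 : 1 <= om -> `|z0| < r1 -> B z0 z0 + D / om < m * r1 ^+ 2 ->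
    exists (z : R -> 'rV[R]_K) (d : R), [/\ 0 < d, z t0 = z0,
        forall t, t0 - d < t -> `|z t| < r1 /\ is_derive t 1 z (F (om * t) (z t)) &
        forall t, t0 <= t -> m * `|z t| ^+ 2 <= expR (- cc * (t - t0)) * B z0 z0 + D / om].
  move=> om1 z0r Vr.
  have om0 : 0 < om by exact: lt_le_trans om1.
  have cl0 (x : 'rV[R]_K) : `|clamp_row r1 x - 0| < eF.
    rewrite subr0; apply: le_lt_trans r1F; apply: clamp_row_le; exact: ltW.
  have [z [zt0 zd]] : exists z : R -> 'rV[R]_K, z t0 = z0 /\
      forall t : R, is_derive t 1 z (F (om * t) (clamp_row r1 (z t))).
    apply: (@picard_global R K (fun t x => F (om * t) (clamp_row r1 x)) (LF + 1) LF).
    - by rewrite ltr_wpDl.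
    - move=> t x y; apply: le_trans (FL (om * t) _ _ Logic.I Logic.I (cl0 x) (cl0 y)) _.
      apply: (@le_trans _ _ (LF * `|x - y|)); first by rewrite ler_wpM2l// clamp_row_lip.
      by rewrite ler_wpM2r// lerDl.
    - by move=> t x; exact: (FB _ _ Logic.I (cl0 x)).
    - move=> x; rewrite /F => t.
      apply: cvgD; first exact: cvg_cst.
      apply: (@continuous_bigsum _ _ _ _ _ _ (fun k s => c k (om * s) *: Y k (clamp_row r1 x))) => k.
      apply: continuous_scalel.
      apply: (@continuous_comp _ _ _ (fun s : R => om * s) (c k)); last exact: ccont.
      exact: mulrl_continuous.
  have zc t : {for t, continuous z} by exact: isd_continuous (zd t).
  have zF t : `|z t| <= r1 -> is_derive t 1 z (F (om * t) (z t)).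
    by move=> zr; have := zd t; rewrite clamp_row_id.
  have bound t : t0 <= t -> (forall s, t0 <= s <= t -> `|z s| < r1) ->
      m * `|z t| ^+ 2 <= expR (- cc * (t - t0)) * B z0 z0 + D / om.
    move=> tt H; apply: le_trans (Bm _) _; rewrite -zt0.
    by apply: dec => // s /H => [|/ltW/zF] //; exact: ltW.
  have E1 t : t0 <= t -> expR (- cc * (t - t0)) <= 1.
    by move=> tt; rewrite -expR0 ler_expR mulNr oppr_le0 mulr_ge0 ?subr_ge0// ltW.
  have trap t : t0 <= t -> `|z t| < r1.
    move=> tt; suff : forall s, t0 <= s <= t -> `|z s| < r1 by apply; rewrite tt lexx.
    apply: (itv_induction (P := fun t => forall s, t0 <= s <= t -> `|z s| < r1) tt).
      by move=> s /andP[h1 h2]; rewrite (@le_anti _ _ s t0) ?h1 ?h2// zt0.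
    move=> s /andP[t0s st].
    have [zs|zs] := ltP `|z s| r1.
      have zs0 : 0 < r1 - `|z s| by rewrite subr_gt0.
      have [d d0 Hd] := continuous_norm (zc s) zs0.
      exists d => // s1 s2 t01 s1s ss2 s2t s1d s2d Ps1 p /andP[t0p ps2].
      have [ps1|s1p] := leP p s1; first by apply: Ps1; rewrite t0p.
      have : `|z p - z s| < r1 - `|z s| by apply: Hd; rewrite ltr_norml; apply/andP; split; lra.
      by have := ler_normD (z p - z s) (z s); rewrite subrK; lra.
    (* If the solution had reached norm [r1] at [s], then shortly before it would already exceed
       [rho], while the estimate valid up to that moment keeps it within [rho < r1]. *)
    have [rho [rho0 rhor Hrho]] : exists rho, [/\ 0 <= rho, rho < r1 &
        forall x : 'rV[R]_K, m * `|x| ^+ 2 <= B z0 z0 + D / om -> `|x| <= rho].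
      exists (Num.sqrt ((B z0 z0 + D / om) / m)).
      have q0 : 0 <= (B z0 z0 + D / om) / m.
        by rewrite divr_ge0 ?addr_ge0// ?ltW// divr_gt0.
      split; first exact: sqrtr_ge0.
        rewrite -[ltRHS](@ger0_norm _ r1) ?(ltW r10)// -sqrtr_sqr ltr_sqrt ?exprn_gt0//.
        by rewrite ltr_pdivrMr// [_ * m]mulrC.
      move=> x mx; rewrite -[leLHS](@ger0_norm _ `|x|)// -sqrtr_sqr ler_wsqrtr//.
      by rewrite ler_pdivlMr// [_ * m]mulrC.
    have r0 : 0 < r1 - rho by rewrite subr_gt0.
    have [d d0 Hd] := continuous_norm (zc s) r0.
    exists d => // s1 s2 t01 s1s ss2 s2t s1d s2d Ps1; exfalso.
    have zs1 : `|z s1| <= rho.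
      apply: Hrho; apply: le_trans (bound _ t01 Ps1) _; rewrite lerD2r ler_piMl//; exact: E1.
    have : `|z s1 - z s| < r1 - rho by apply: Hd; rewrite ltr_norml; apply/andP; split; lra.
    rewrite distrC => h; have := ler_normD (z s - z s1) (z s1); rewrite subrK; lra.
  have z0r0 : 0 < r1 - `|z t0| by rewrite zt0 subr_gt0.
  have [d d0 Hd] := continuous_norm (zc t0) z0r0.
  have all t : t0 - d < t -> `|z t| < r1.
    move=> td; have [/trap//|tt0] := leP t0 t.
    have : `|z t - z t0| < r1 - `|z t0| by apply: Hd; rewrite ltr_norml; apply/andP; split; lra.
    by have := ler_normD (z t - z t0) (z t0); rewrite subrK; lra.
  exists z, d; split => //.
    by move=> t /all zr; split => //; apply: zF; exact: ltW.
  by move=> t tt; apply: bound => // s /andP[h1 _]; exact: trap.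
have sqle (x y : R) : 0 <= x -> 0 < y -> m * x ^+ 2 <= m * y ^+ 2 -> x <= y.
  by move=> x0 y0; rewrite ler_pM2l// ler_pXn2r// nnegrE// ltW.
(* [cal y] is the radius of initial data giving V <= m y^2 / 4 *)
pose cal y := Num.min (y / 2) (Num.sqrt (m * y ^+ 2 / (4 * M1))).
have cal0 y : 0 < y -> 0 < cal y.
  by move=> y0; rewrite lt_min divr_gt0//= sqrtr_gt0 divr_gt0 ?mulr_gt0 ?exprn_gt0.
have calr y : 0 < y -> cal y < y.
  by move=> y0; rewrite gt_min; apply/orP; left; lra.
have calV y x : 0 < y -> `|x| <= cal y -> B x x <= m * y ^+ 2 / 4.
  move=> y0; rewrite le_min => /andP[_ xs]; apply: le_trans (BM1 x) _.
  have : `|x| ^+ 2 <= m * y ^+ 2 / (4 * M1).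
    have h0 : 0 <= m * y ^+ 2 / (4 * M1) by rewrite divr_ge0 ?mulr_ge0 ?exprn_ge0 ?ltW.
    by rewrite -(sqr_sqrtr h0) ler_pXn2r// nnegrE// sqrtr_ge0.
  move=> h; apply: (@le_trans _ _ (M1 * (m * y ^+ 2 / (4 * M1)))); first by rewrite ler_pM2l.
  rewrite le_eqVlt; apply/orP; left; apply/eqP; field; exact: lt0r_neq0.
(* A quarter of the level [m * y ^+ 2] goes to the initial value of V and another quarter to the
   averaging error. *)
have omy y om : 0 < y -> Num.max 1 (4 * D / (m * y ^+ 2)) <= om -> 1 <= om /\ D / om <= m * y ^+ 2 / 4.
  move=> y0; rewrite ge_max => /andP[om1 h]; split => //.
  have om0 : 0 < om by exact: lt_le_trans om1.
  move: h; rewrite ler_pdivrMr ?mulr_gt0 ?exprn_gt0// ler_pdivrMr//; lra.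
exists r1, (cal r1); split => //; first exact: cal0.
- move=> eps eps0; pose y := Num.min eps r1.
  have y0 : 0 < y by rewrite lt_min eps0.
  have yr : y <= r1 by rewrite ge_min lexx orbT.
  have ye : y <= eps by rewrite ge_min lexx.
  have yr2 : m * y ^+ 2 <= m * r1 ^+ 2 by rewrite ler_pM2l// ler_pXn2r// nnegrE ltW.
  have my0 : 0 < m * y ^+ 2 by rewrite mulr_gt0 ?exprn_gt0.
  exists (Num.max 1 (4 * D / (m * y ^+ 2))), (cal y); split; [by rewrite lt_max ltr01|exact: cal0|].
  move=> om t0 z0 /(omy _ _ y0)[om1 omD] z0c.
  have V0 := calV _ _ y0 z0c.
  have [||z [d [d0 zt0 zd zb]]] := main om t0 z0 om1.
  - by rewrite (le_lt_trans z0c)// (lt_le_trans (calr _ y0)).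
  - lra.
  exists z, d; split => // t tt; apply: le_trans ye; apply: sqle => //.
  have E1 : expR (- cc * (t - t0)) <= 1.
    by rewrite -expR0 ler_expR mulNr oppr_le0 mulr_ge0 ?subr_ge0// ltW.
  have := zb t tt; have := ler_piMl (B_ge0 z0) E1; lra.
- move=> eps eps0; pose y := Num.min eps r1.
  have y0 : 0 < y by rewrite lt_min eps0.
  have yr : y <= r1 by rewrite ge_min lexx orbT.
  have ye : y <= eps by rewrite ge_min lexx.
  have yr2 : m * y ^+ 2 <= m * r1 ^+ 2 by rewrite ler_pM2l// ler_pXn2r// nnegrE ltW.
  have my0 : 0 < m * y ^+ 2 by rewrite mulr_gt0 ?exprn_gt0.
  have mr0 : 0 < m * r1 ^+ 2 by rewrite mulr_gt0 ?exprn_gt0.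
  have x0 : 0 <= m * r1 ^+ 2 / 4 by lra.
  have y20 : 0 < m * y ^+ 2 / 4 by lra.
  have [Del Del0 HDel] := expR_decay cc0 x0 y20.
  exists (Num.max 1 (4 * D / (m * y ^+ 2))), Del; split => //; first by rewrite lt_max ltr01.
  move=> om t0 z0 /(omy _ _ y0)[om1 omD] z0c.
  have V0 := calV _ _ r10 z0c.
  have [||z [d [d0 zt0 zd zb]]] := main om t0 z0 om1.
  - by rewrite (le_lt_trans z0c)// calr.
  - lra.
  exists z, d; split => // t tt; apply: le_trans ye; apply: sqle => //.
  have t0t : t0 <= t by rewrite (le_trans _ tt)// lerDl ltW.
  have := zb t t0t; have := HDel (t - t0); rewrite lerBrDl => /(_ tt).
  have : expR (- cc * (t - t0)) * B z0 z0 <= expR (- cc * (t - t0)) * (m * r1 ^+ 2 / 4).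
    by rewrite ler_pM2l ?expR_gt0.
  lra.
Qed.

End averaging.

(** * A quadratic Lyapunov form *)

Definition dot (R : realType) n (u v : 'rV[R]_n) : R := \sum_i u 0 i * v 0 i.

Section dot_theory.
Context {R : realType}.
Implicit Types n : nat.

Lemma dotC n (u v : 'rV[R]_n) : dot u v = dot v u.
Proof. by apply: eq_bigr => i _; rewrite mulrC. Qed.
Lemma dotDl n (u v w : 'rV[R]_n) : dot (u + v) w = dot u w + dot v w.
Proof. by rewrite -big_split; apply: eq_bigr => i _; rewrite mxE mulrDl. Qed.
Lemma dotZl n (k : R) (u v : 'rV[R]_n) : dot (k *: u) v = k * dot u v.
Proof. by rewrite mulr_sumr; apply: eq_bigr => i _; rewrite mxE mulrA. Qed.
Lemma dotDr n (u v w : 'rV[R]_n) : dot w (u + v) = dot w u + dot w v.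
Proof. by rewrite dotC dotDl !(dotC w). Qed.
Lemma dotZr n (k : R) (u v : 'rV[R]_n) : dot v (k *: u) = k * dot v u.
Proof. by rewrite dotC dotZl (dotC v). Qed.
Lemma dotNl n (u v : 'rV[R]_n) : dot (- u) v = - dot u v.
Proof. by rewrite -scaleN1r dotZl mulN1r. Qed.
Lemma dotNr n (u v : 'rV[R]_n) : dot v (- u) = - dot v u.
Proof. by rewrite dotC dotNl (dotC v). Qed.
Lemma dot0l n (v : 'rV[R]_n) : dot 0 v = 0.
Proof. by rewrite -(scale0r v) dotZl mul0r. Qed.
Lemma dot_mx n (u v : 'rV[R]_n) (A : 'M[R]_n) : dot (u *m A) v = dot u (v *m A^T).
Proof.
have E (x y : 'rV[R]_n) : dot x y = (x *m y^T) 0 0 by rewrite mxE; apply: eq_bigr => i _; rewrite mxE.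
by rewrite !E trmx_mul trmxK mulmxA.
Qed.
Lemma dot_ge0 n (u : 'rV[R]_n) : 0 <= dot u u.
Proof. by apply: sumr_ge0 => i _; rewrite -expr2 sqr_ge0. Qed.
Lemma dot_eq0 n (u : 'rV[R]_n) : dot u u = 0 -> u = 0.
Proof.
move=> /eqP; rewrite psumr_eq0; last by move=> i _; rewrite -expr2 sqr_ge0.
by move=> /allP H; apply/rowP => i; have := H i (mem_index_enum _); rewrite mxE mulf_eq0 orbb => /eqP.
Qed.
Lemma dot_gt0 n (u : 'rV[R]_n) : u != 0 -> 0 < dot u u.
Proof. by move=> u0; rewrite lt0r dot_ge0 andbT; apply: contra u0 => /eqP/dot_eq0 ->. Qed.
Lemma dot_delta n (u : 'rV[R]_n) i : dot (delta_mx 0 i) u = u 0 i.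
Proof.
rewrite /dot (bigD1 i)//= big1 ?addr0; first by rewrite mxE !eqxx mul1r.
by move=> j ji; rewrite mxE eqxx (negbTE ji) mul0r.
Qed.
Lemma dot_amgm n (s : R) (u v : 'rV[R]_n) : 0 < s -> 
  dot u v <= s * dot u u + dot v v / (4 * s).
Proof.
move=> s0; have := dot_ge0 ((2 * s) *: u - v).
rewrite !(dotDl, dotDr, dotNl, dotNr, dotZl, dotZr) (dotC v u) => H.
have -> : s * dot u u + dot v v / (4 * s) = dot u v + (2 * s * (2 * s * dot u u) - 2 * s * dot u v - (2 * s * dot u v - dot v v)) / (4 * s).
  by field; rewrite lt0r_neq0.
rewrite lerDl; apply: divr_ge0; [move: H; lra|lra].
Qed.
Lemma dot_double_le n (u v : 'rV[R]_n) : 2 * dot u v <= dot u u + dot v v.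
Proof. have := dot_ge0 (u - v); rewrite !(dotDl, dotDr, dotNl, dotNr) (dotC v u); lra. Qed.
Lemma dot_double_ge n (u v : 'rV[R]_n) : - (dot u u + dot v v) <= 2 * dot u v.
Proof. have := dot_ge0 (u + v); rewrite !(dotDl, dotDr, dotNl, dotNr) (dotC v u); lra. Qed.
Lemma dot_sub_le n (u v : 'rV[R]_n) : dot (u - v) (u - v) <= 2 * dot u u + 2 * dot v v.
Proof. have := dot_ge0 (u + v); rewrite !(dotDl, dotDr, dotNl, dotNr) (dotC v u); lra. Qed.
Lemma dot_le_norm n (u : 'rV[R]_n) : dot u u <= n%:R * `|u| ^+ 2.
Proof.
rewrite /dot; apply: (@le_trans _ _ (\sum_(i < n) `|u| ^+ 2)).
  apply: ler_sum => i _; rewrite -expr2 -real_normK ?num_real// ler_pXn2r ?nnegrE//; exact: coord_le_norm.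
by rewrite sumr_const card_ord mulr_natl.
Qed.

Lemma dot_linear n (u : 'rV[R]_n) : linear (dot u).
Proof. by move=> k x y; rewrite dotDr dotZr. Qed.

Lemma mulmx_bound m n (A : 'M[R]_(m, n)) : exists2 C : R, 0 <= C & forall x : 'rV[R]_m, `|x *m A| <= C * `|x|.
Proof.
have [L L0 H] := linear_row_bound (mulmxr A : {linear 'rV[R]_m -> 'rV[R]_n}).
by exists L.
Qed.

(** The constant is the minimum on the unit sphere, which is compact; homogeneity of degree two
    extends the bound to all vectors. *)
Lemma posdef_lower n (q : 'rV[R]_n -> R) : continuous q ->
  (forall k x, q (k *: x) = k ^+ 2 * q x) -> (forall x, x != 0 -> 0 < q x) ->
  exists2 k : R, 0 < k & forall x, k * `|x| ^+ 2 <= q x.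
Proof.
move=> cq qZ q0.
have q00 : q 0 = 0 by have := qZ 0 0; rewrite scaler0 expr0n mul0r.
pose A := [set x : 'rV[R]_n | `|x| = 1].
(* The sphere is empty exactly when the space is zero, and then any constant serves. *)
have [[x0 Ax0]|nA] := pselect (exists x, A x); last first.
  exists 1 => // x; have [->|xn] := eqVneq x 0.
    by rewrite normr0 expr0n mulr0 q00.
  exfalso; apply: nA; exists (`|x|^-1 *: x); rewrite /A/= normrZ normfV normr_id mulVf// normr_eq0.
  exact: xn.
have cA : compact A.
  apply: bounded_closed_compact.
    exists 1; split; first exact: num_real.
    by move=> M M1 x /= ->; exact: ltW.
  have -> : A = (fun x : 'rV[R]_n => `|x|) @^-1` [set 1] by [].
  apply: preimage_closed; last exact: closed_eq.
  by move=> x _; exact: norm_continuous.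
have [|||c cA' Hc] := @EVT_min_rV R n q A.
- by exists x0.
- exact: cA.
- exact: continuous_subspaceT.
have c0 : c != 0.
  by apply/eqP => c0; move: cA'; rewrite inE /A/= c0 normr0 => /esym/eqP; rewrite oner_eq0.
exists (q c); first exact: q0.
move=> x; have [->|xn] := eqVneq x 0; first by rewrite normr0 expr0n mulr0 q00.
have nx : 0 < `|x| by rewrite normr_gt0.
have := Hc (`|x|^-1 *: x); rewrite qZ.
rewrite inE /A/= normrZ normfV normr_id mulVf ?lt0r_neq0// => /(_ erefl).
by rewrite exprVn mulrC ler_pdivlMr// exprn_gt0.
Qed.

Lemma bilinear_rowE n (B : 'rV[R]_n -> 'rV[R]_n -> R) x y :
  (forall x, linear (B x)) -> (forall x y, B x y = B y x) ->
  B x y = \sum_j (\sum_i x 0 i * B (delta_mx 0 j) (delta_mx 0 i)) * y 0 j.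
Proof.
move=> lB sB.
have Blin u v k w : B u (k *: v + w) = k * B u v + B u w by exact: lB.
have B0 u : B u 0 = 0 by have := Blin u 0 1 0; rewrite scaler0 addr0 => /eqP; rewrite mul1r -subr_eq0 opprD addNKr oppr_eq0 => /eqP.
have E u v : B u v = \sum_j v 0 j * B u (delta_mx 0 j).
  by rewrite {1}[v]row_basisE; elim/big_rec2 : _ => // j w k _ <-; rewrite Blin.
by rewrite E; apply: eq_bigr => j _; rewrite mulrC sB E.
Qed.

Lemma bilinear_diag_continuous n (B : 'rV[R]_n -> 'rV[R]_n -> R) :
  (forall x, linear (B x)) -> (forall x y, B x y = B y x) -> continuous (fun x => B x x).
Proof.
move=> lB sB x; apply: nice_continuous.
have : nice (fun y : 'rV[R]_n => \sum_j (\sum_i y 0 i * B (delta_mx 0 j) (delta_mx 0 i)) * y 0 j) x.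
  apply: nice_sum => j; apply: nice_mul; last by apply: nice_coord; exact: nice_id.
  apply: nice_sum => i; apply: nice_mul; last exact: nice_cst.
  by apply: nice_coord; exact: nice_id.
by apply: nice_near; apply: near_all => y; rewrite -bilinear_rowE.
Qed.

Lemma bilinear_bound n (B : 'rV[R]_n -> 'rV[R]_n -> R) :
  (forall x, linear (B x)) -> (forall x y, B x y = B y x) ->
  exists M, forall x y, `|B x y| <= M * (`|x| * `|y|).
Proof.
move=> lB sB; exists (\sum_j \sum_i `|B (delta_mx 0 j) (delta_mx 0 i)|) => x y.
rewrite bilinear_rowE// mulr_suml; apply: le_trans (ler_norm_sum _ _ _) _.
apply: ler_sum => j _; rewrite normrM mulrA ler_pM ?coord_le_norm//.
rewrite mulr_suml; apply: le_trans (ler_norm_sum _ _ _) _.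
by apply: ler_sum => i _; rewrite normrM mulrC ler_wpM2l// coord_le_norm.
Qed.

Lemma symmetric_form_lower n (S : 'M[R]_n) : S^T = S ->
  (forall x : 'rV[R]_n, x != 0 -> 0 < dot (x *m S) x) ->
  exists2 k : R, 0 < k & forall x : 'rV[R]_n, k * dot x x <= dot (x *m S) x.
Proof.
move=> Ss Sp.
have lB (x : 'rV[R]_n) : linear (dot (x *m S)) by exact: dot_linear.
have sB (x y : 'rV[R]_n) : dot (x *m S) y = dot (y *m S) x by rewrite dot_mx Ss dotC.
have [|k k0 Hk] := posdef_lower (bilinear_diag_continuous lB sB) _ Sp.
  by move=> k x; rewrite -scalemxAl dotZl dotZr mulrA.
have n0 : 0 < n%:R + 1 :> R by rewrite ltr_wpDl.
exists (k / (n%:R + 1)); first by rewrite divr_gt0.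
move=> x; apply: le_trans (Hk x); rewrite -mulrA ler_pM2l// mulrC ler_pdivrMr// mulrC.
apply: le_trans (dot_le_norm x) _; rewrite ler_wpM2r ?exprn_ge0//; lra.
Qed.

Lemma norm_le_dot n (x : 'rV[R]_n) : `|x| ^+ 2 <= dot x x.
Proof.
rewrite -[leRHS]sqr_sqrtr ?dot_ge0// ler_pXn2r ?nnegrE ?sqrtr_ge0//.
apply: norm_le_coord => [|j]; first exact: sqrtr_ge0.
rewrite -sqrtr_sqr ler_wsqrtr// /dot (bigD1 j)//= -expr2 lerDl.
by apply: sumr_ge0 => i _; rewrite -expr2 sqr_ge0.
Qed.

Lemma dot_mulmx_bound n (A : 'M[R]_n) : exists2 C : R, 0 < C & 
  forall x : 'rV[R]_n, dot (x *m A) (x *m A) <= C * dot x x.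
Proof.
have [L L0 HL] := mulmx_bound A.
exists (n%:R * L ^+ 2 + 1); first by rewrite ltr_wpDl// mulr_ge0// exprn_ge0.
move=> x; apply: le_trans (dot_le_norm _) _.
apply: (@le_trans _ _ (n%:R * (L ^+ 2 * dot x x))); last by rewrite mulrDl mulrA lerDl mul1r dot_ge0.
rewrite ler_wpM2l//; apply: (@le_trans _ _ ((L * `|x|) ^+ 2)).
  by rewrite ler_pXn2r ?nnegrE ?mulr_ge0.
by rewrite exprMn ler_wpM2l ?exprn_ge0// norm_le_dot.
Qed.
End dot_theory.

Section resolvent.
Context {R : realType} {n : nat}.
Variables (Rm : 'M[R]_n) (D lam c : R).
Hypothesis Rs : Rm^T = Rm.
Hypothesis Rp : forall x : 'rV[R]_n, 0 <= dot (x *m Rm) x.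
Hypotheses (D0 : 0 < D) (hlam : 0 < lam) (c0 : 0 < c).

(* With y = v - (lam / kap) w, the weight S = c (D + lam Rm)^-1 on y makes the cross terms in v and w
   of the derivative of |v|^2 + <y S, y> cancel while the term in |w|^2 becomes negative. *)
Lemma resolvent_exists : exists S : 'M[R]_n, [/\ S^T = S,
  forall x : 'rV[R]_n, D *: (x *m S) + lam *: (x *m Rm *m S) = c *: x,
  forall x : 'rV[R]_n, x != 0 -> 0 < dot (x *m S) x &
  forall x : 'rV[R]_n, 0 <= dot (x *m S) (x *m Rm)].
Proof.
pose Q := D%:M + lam *: Rm.
have QE (x : 'rV[R]_n) : x *m Q = D *: x + lam *: (x *m Rm).
  by rewrite mulmxDr mul_mx_scalar -scalemxAr.
have Qpos x : D * dot x x <= dot (x *m Q) x.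
  by rewrite QE dotDl !dotZl lerDl mulr_ge0 ?Rp// ltW.
have Qu : Q \in unitmx.
  rewrite -row_free_unit -kermx_eq0; apply/rowV0P => v /sub_kermxP vQ.
  apply: dot_eq0; apply/le_anti; rewrite dot_ge0 andbT.
  by have := Qpos v; rewrite vQ dot0l pmulr_rle0.
have Qs : Q^T = Q by rewrite /Q linearD/= tr_scalar_mx linearZ/= Rs.
have QSs : (invmx Q)^T = invmx Q by rewrite trmx_inv Qs.
have comm : Rm *m invmx Q = invmx Q *m Rm.
  have QR : Q *m Rm = Rm *m Q by rewrite mulmxDl mulmxDr mul_scalar_mx mul_mx_scalar -scalemxAl -scalemxAr.
  by apply/esym; apply: (canRL (mulmxK Qu)); rewrite -mulmxA -QR mulKmx.
exists (c *: invmx Q); split.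
- by rewrite linearZ/= QSs.
- move=> x; have -> : c *: x = c *: (x *m Q *m invmx Q) by rewrite mulmxK.
  rewrite QE mulmxDl -!scalemxAl scalerDr -!scalemxAr !scalerA.
  by rewrite ![_ * c]mulrC.
- move=> x x0; rewrite -scalemxAr dotZl mulr_gt0//.
  pose z := x *m invmx Q; have xE : x = z *m Q by rewrite /z mulmxKV.
  rewrite -/z {1}xE dotC; apply: lt_le_trans (Qpos z).
  rewrite mulr_gt0// dot_gt0//; apply: contra x0 => /eqP z0; by rewrite xE z0 mul0mx.
(* Writing x = z Q, the quantity is, up to the factor [c], D times the form of [Rm] at z plus [lam]
   times the squared length of z [Rm]. *)
- move=> x; rewrite -scalemxAr dotZl mulr_ge0 ?(ltW c0)//.
  pose z := x *m invmx Q; have xE : x = z *m Q by rewrite /z mulmxKV.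
  rewrite -/z xE QE mulmxDl -!scalemxAl dotDr !dotZr addr_ge0// mulr_ge0 ?(ltW D0) ?(ltW hlam)//.
    by rewrite dotC.
  by rewrite dotC dot_mx Rs dot_ge0.
Qed.

End resolvent.

(** The forces on v and w are proportional with ratio [lam / kap], so y = v - (lam / kap) w feels no
    force: y' = - v Rm + (D / kap) w, with D = a lam - b kap. In the kinetic plus potential energy
    the force terms cancel as well. Adding the weighted square of y cancels the coupling of v and w
    and leaves a loss of at least [d] times the squared length of w. *)
Lemma lyapunov_exists (R : realType) (n : nat) (K := (n + n + (n + 1))%N) (H Rm : 'M[R]_n) (a lam b kap h be : R) :
  H^T = H -> (forall x : 'rV[R]_n, x != 0 -> 0 < dot (x *m H) x) ->
  Rm^T = Rm -> (forall x : 'rV[R]_n, 0 <= dot (x *m Rm) x) ->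
  0 < a -> 0 < lam -> 0 < b -> 0 < kap -> 0 < h -> 0 < be -> 0 < a * lam - b * kap ->
  exists (B : 'rV[R]_K -> 'rV[R]_K -> R) (m M gam : R),
  [/\ forall x, linear (B x), forall x y, B x y = B y x, 0 < m /\ 0 < gam,
   (forall x, m * `|x| ^+ 2 <= B x x) /\ (forall x y, `|B x y| <= M * (`|x| * `|y|)) &
   forall z, B z (st (st_v z) (- (st_v z *m Rm) - b *: st_w z - (lam ^+ 2 * be) *: (st_g z *m H))
      (- (a *: st_w z) - (kap * lam * be) *: (st_g z *m H)) (- (h * st_eta z))) <= - gam * `|z| ^+ 2].
Proof.
move=> Hs Hp Rs Rp ha hlam hb hkap hh hbe hgains; pose D := a * lam - b * kap.
have [S [Ss SE Sp SRp]] := resolvent_exists Rs Rp (hgains : 0 < D) hlam (mulr_gt0 hb hkap).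
have [kH kH0 HkH] := symmetric_form_lower Hs Hp.
have [kS kS0 HkS] := symmetric_form_lower Ss Sp.
have [CR CR0 HCR] := dot_mulmx_bound Rm.
have [CH CH0 HCH] := dot_mulmx_bound H.
have D0 : 0 < D by [].
pose Q0 := lam ^+ 2 * be; have Q00 : 0 < Q0 by rewrite mulr_gt0// exprn_gt0.
pose G0 := kap * lam * be; have G00 : 0 < G0 by rewrite !mulr_gt0.
pose k := G0 * kH; have k0 : 0 < k by rewrite mulr_gt0.
pose d := D * lam / kap ^+ 2 * kS; have d0 : 0 < d by rewrite mulr_gt0// divr_gt0 ?exprn_gt0// mulr_gt0.
(* Since w = (kap / lam) (v - y), the squares of v and y control that of w; [c1] is the resulting
   constant, needed for positivity of the form. *)
pose c1 := Num.min (2^-1) kS * (lam / kap) ^+ 2 / 2.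
have c10 : 0 < c1.
  by rewrite divr_gt0// mulr_gt0 ?exprn_gt0 ?divr_gt0// lt_min invr_gt0 kS0 ltr0n.
pose k' := Q0 * kH; have k'0 : 0 < k' by rewrite mulr_gt0.
(* [A1] collects the multiples of the squared length of w, and [A2] those of x, that the cross terms
   produce after Young's inequality. The conditions on [th] involving [A1] and [A2] make them
   absorbable by the decay; the bounds by [k' / 4], [c1 / 2] and [4^-1] keep the form positive
   definite. *)
pose A1 := 1 + a ^+ 2 / k + b ^+ 2; have A10 : 0 < A1.
  by rewrite /A1 -addrA ltr_pwDl// addr_ge0 ?sqr_ge0// divr_ge0 ?sqr_ge0// ltW.
pose A2 := CR + 4^-1 + Q0 * (1 + CH / 4); have A20 : 0 < A2.
  have h1 : 0 < 1 + CH / 4 by lra.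
  by have := mulr_gt0 Q00 h1; rewrite /A2; lra.
have [th [th0 th1 thd thk [thk' thc th4]]] : exists th, [/\ 0 < th, th <= 1, th * A1 <= d / 2, th * A2 <= k / 4 &
    [/\ th <= k' / 4, th <= c1 / 2 & th <= 4^-1]].
  exists (Num.min (Num.min (4^-1) (d / 2 / A1)) (Num.min (k / 4 / A2) (Num.min (k' / 4) (c1 / 2)))); split.
  - have ? := divr_gt0 (divr_gt0 d0 (ltr0n R 2)) A10.
    have ? := divr_gt0 (divr_gt0 k0 (ltr0n R 4)) A20.
    have ? := divr_gt0 k'0 (ltr0n R 4).
    have ? := divr_gt0 c10 (ltr0n R 2).
    by rewrite !lt_min invr_gt0 ltr0n; do !(apply/andP; split).
  - by rewrite !ge_min invf_le1// ?ler1n.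
  - by rewrite -ler_pdivlMr// !ge_min lexx !orbT.
  - by rewrite -ler_pdivlMr// !ge_min lexx !orbT.
  - by split; rewrite !ge_min lexx ?orbT.
(* The terms in th^2 and th^3 make the decay strict in the directions g and v, where the derivative of
   the energy vanishes when Rm = 0. *)
pose ry (z : 'rV[R]_K) := st_v z - (lam / kap) *: st_w z.
pose B z z' := dot (st_v z) (st_v z') + Q0 * dot (st_g z *m H) (st_g z') + dot (ry z *m S) (ry z')
  + st_eta z * st_eta z' + th ^+ 2 * (dot (st_g z) (st_w z') + dot (st_g z') (st_w z))
  - th ^+ 3 * (dot (st_v z) (st_g z') + dot (st_v z') (st_g z)).
have gP c x y : @st_g R n n (c *: x + y) = c *: st_g x + st_g y by rewrite /st_g !linearP.
have vP c x y : @st_v R n n (c *: x + y) = c *: st_v x + st_v y by rewrite /st_v !linearP.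
have wP c x y : @st_w R n n (c *: x + y) = c *: st_w x + st_w y by rewrite /st_w !linearP.
have eP c x y : @st_eta R n n (c *: x + y) = c * st_eta x + st_eta y by rewrite /st_eta !linearP !mxE.
have ryP c x y : ry (c *: x + y) = c *: ry x + ry y.
  by rewrite /ry vP wP scalerDr opprD scalerBr addrACA !scalerA [c * _]mulrC.
have lB x : linear (B x).
  move=> c y z; rewrite /B gP vP wP eP ryP !(dotDr, dotDl, dotZr, dotZl) /GRing.scale/=; ring.
have sB x y : B x y = B y x.
  rewrite /B (dotC (st_v x)) (dot_mx (st_g x)) (dot_mx (ry x)) Hs Ss (dotC (st_g x) (_ *m H)) (dotC (ry x)).
  ring.
have [M BM] := bilinear_bound lB sB.
have dotst (z : 'rV[R]_K) : dot z z = dot (st_g z) (st_g z) + dot (st_v z) (st_v z) 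
    + (dot (st_w z) (st_w z) + st_eta z ^+ 2).
  rewrite /dot big_split_ord/= big_split_ord/= big_split_ord/= big_ord1 expr2.
  by congr (_ + _ + (_ + _)); rewrite ?[in RHS]/st_eta ?mxE//; apply: eq_bigr => i _; rewrite !mxE.
have stz (g v w : 'rV[R]_n) (eta : R) : [/\ st_g (st g v w eta) = g, st_v (st g v w eta) = v,
    st_w (st g v w eta) = w & st_eta (st g v w eta) = eta].
  by rewrite /st_g /st_v /st_w /st_eta /st !row_mxKl !row_mxKr !row_mxKl !mxE eqxx mulr1n.
pose gam := Num.min (Num.min (d / 2) (th ^+ 2 * k / 2)) (Num.min (th ^+ 3 / 2) h).
have hlf (x : R) : 0 < x -> 0 < x / 2 by move=> x0; rewrite divr_gt0.
have gam0 : 0 < gam.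
  have ? : 0 < th ^+ 2 * k := mulr_gt0 (exprn_gt0 2 th0) k0.
  have ? : 0 < th ^+ 3 := exprn_gt0 3 th0.
  by rewrite !lt_min hh !andbT; do !(apply/andP; split); apply: hlf.
pose m := Num.min (Num.min (4^-1) (k' / 2)) (c1 / 2).
have m0 : 0 < m.
  by rewrite !lt_min invr_gt0 ltr0n (hlf _ k'0) (hlf _ c10).
have th2 : th ^+ 2 <= th by rewrite -[leRHS]mulr1 expr2 ler_pM2l.
have th3 : th ^+ 3 <= th by rewrite exprS -[leRHS]mulr1 ler_pM2l// (le_trans th2).
exists B, m, M, gam; split => //.
- split => // z.
  apply: (@le_trans _ _ (m * dot z z)); first by rewrite ler_pM2l// norm_le_dot.
  rewrite dotst /B.
  set x := st_g z; set v := st_v z; set w := st_w z; set q := st_eta z; set y := ry z.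
  have X0 := dot_ge0 x; have V0 := dot_ge0 v; have W0 := dot_ge0 w; have Y0 := dot_ge0 y.
  have hH := HkH x; have hS := HkS y.
  have wE : w = (kap / lam) *: (v - y).
    rewrite /y /ry opprB addrC subrK scalerA.
    have -> : kap / lam * (lam / kap) = 1 by field; rewrite !lt0r_neq0.
    by rewrite scale1r.
  have hW : c1 * dot w w <= dot v v / 2 + kS * dot y y.
    have h1 : dot w w = (kap / lam) ^+ 2 * dot (v - y) (v - y) by rewrite wE dotZl dotZr mulrA -expr2.
    have h2 : dot (v - y) (v - y) <= 2 * dot v v + 2 * dot y y by exact: dot_sub_le.
    have h3 : c1 * dot w w = Num.min 2^-1 kS * (dot (v - y) (v - y) / 2).
      by rewrite h1 /c1; field; rewrite !lt0r_neq0.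
    rewrite h3; apply: (@le_trans _ _ (Num.min 2^-1 kS * (dot v v + dot y y))).
      by rewrite ler_pM2l ?lt_min ?invr_gt0 ?kS0 ?ltr0n//; move: h2; clear; lra.
    rewrite mulrDr lerD//; first by rewrite mulrC ler_wpM2l// ge_min lexx.
    by rewrite ler_wpM2r// ge_min lexx orbT.
  have hxw : - (dot x x + dot w w) <= 2 * dot x w by exact: dot_double_ge.
  have hvx : 2 * dot v x <= dot v v + dot x x by exact: dot_double_le.
  have p2 : 0 <= th ^+ 2 by rewrite sqr_ge0.
  have p3 : 0 <= th ^+ 3 by rewrite exprn_ge0 ?ltW.
  have q1 : - (th * (dot x x + dot w w)) <= th ^+ 2 * (dot x w + dot x w).
    have : th ^+ 2 * (dot x x + dot w w) <= th * (dot x x + dot w w) by rewrite ler_wpM2r// addr_ge0.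
    have : th ^+ 2 * (- (dot x x + dot w w)) <= th ^+ 2 * (2 * dot x w) by rewrite ler_wpM2l.
    clear; lra.
  have q2 : th ^+ 3 * (dot v x + dot v x) <= th * (dot v v + dot x x).
    have : th ^+ 3 * (dot v v + dot x x) <= th * (dot v v + dot x x) by rewrite ler_wpM2r// addr_ge0.
    have : th ^+ 3 * (2 * dot v x) <= th ^+ 3 * (dot v v + dot x x) by rewrite ler_wpM2l.
    clear; lra.
  have q3 : k' * dot x x <= Q0 * dot (x *m H) x by rewrite -mulrA ler_pM2l.
  have q4 : th * dot x x <= k' / 4 * dot x x by rewrite ler_wpM2r.
  have q5 : th * dot w w <= c1 / 2 * dot w w by rewrite ler_wpM2r.
  have q6 : th * dot v v <= 4^-1 * dot v v by rewrite ler_wpM2r.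
  have q7 : m * dot x x <= k' / 2 * dot x x by rewrite ler_wpM2r// !ge_min lexx ?orbT.
  have q8 : m * dot w w <= c1 / 2 * dot w w by rewrite ler_wpM2r// !ge_min lexx ?orbT.
  have q9 : m * dot v v <= 4^-1 * dot v v by rewrite ler_wpM2r// !ge_min lexx ?orbT.
  have q10 : m * q ^+ 2 <= q ^+ 2.
    by rewrite ler_piMl ?sqr_ge0// !ge_min invf_le1// ler1n.
  move: X0 V0 W0 hS hW q1 q2 q3 q4 q5 q6 q7 q8 q9 q10; clear; lra.
- move=> z; rewrite /B.
  set L := st _ _ _ _.
  have [Lg Lv Lw Le] : [/\ st_g L = st_v z, st_v L = - (st_v z *m Rm) - b *: st_w z - (lam ^+ 2 * be) *: (st_g z *m H),
     st_w L = - (a *: st_w z) - (kap * lam * be) *: (st_g z *m H) & st_eta L = - (h * st_eta z)] by apply: stz.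
  have Lr : ry L = - (st_v z *m Rm) + (D / kap) *: st_w z.
    rewrite /ry Lv Lw scalerBr scalerN !scalerA opprD !opprK.
    have -> : lam / kap * (kap * lam * be) = lam ^+ 2 * be by field; exact: lt0r_neq0.
    rewrite addrA [X in X + _](addrAC _ _ (_ *: (st_w z))) subrK -!addrA -scaleNr -scalerDl.
    by congr (_ + _ *: _); rewrite /D; field; exact: lt0r_neq0.
  rewrite Lg Lv Lw Le Lr -/Q0 -/G0 {1}/ry.
  apply: (@le_trans _ _ (- gam * dot z z)); last by rewrite !mulNr lerN2 ler_pM2l// norm_le_dot.
  rewrite dotst.
  set x := st_g z; set v := st_v z; set w := st_w z; set q := st_eta z.
  have X0 := dot_ge0 x; have V0 := dot_ge0 v; have W0 := dot_ge0 w; have qq := sqr_ge0 q.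
  have hR := Rp v; have hSR := SRp v.
  have hk : k * dot x x <= G0 * dot (x *m H) x by rewrite -mulrA ler_pM2l.
  have hd : d * dot w w <= D * lam / kap ^+ 2 * dot (w *m S) w.
    rewrite /d -[leLHS]mulrA ler_pM2l; first exact: HkS.
    by rewrite divr_gt0 ?exprn_gt0// mulr_gt0.
  have cross : D / kap * dot (v *m S) w + lam / kap * dot (w *m S) (v *m Rm) = b * dot v w.
    have := congr1 (fun y => dot y w) (SE v); rewrite dotDl !dotZl.
    have -> : dot (v *m Rm *m S) w = dot (w *m S) (v *m Rm) by rewrite dot_mx Ss dotC.
    move=> e0; have -> : b * dot v w = b * kap * dot v w / kap by field; exact: lt0r_neq0.
    by rewrite -e0; field; exact: lt0r_neq0.
  (* The Young weight [th / 4] leaves only [th ^+ 3 / 4] on v, a quarter of the decay that the cubic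
     term provides, at the price of a full [th] on w. *)
  have e1 : th ^+ 2 * dot v w <= th ^+ 3 / 4 * dot v v + th * dot w w.
    have s0 : 0 < th / 4 by rewrite divr_gt0.
    apply: (@le_trans _ _ (th ^+ 2 * (th / 4 * dot v v + dot w w / (4 * (th / 4))))).
      by rewrite ler_pM2l ?exprn_gt0// dot_amgm.
    by rewrite le_eqVlt; apply/orP; left; apply/eqP; field; exact: lt0r_neq0.
  have e2 : - (a * dot x w) <= k / 4 * dot x x + a ^+ 2 / k * dot w w.
    have s0 : 0 < k / (4 * a) by rewrite divr_gt0// mulr_gt0.
    have := dot_amgm (- x) w s0; rewrite !(dotNl, dotNr) opprK -mulrN => e0.
    apply: (@le_trans _ _ (a * (k / (4 * a) * dot x x + dot w w / (4 * (k / (4 * a)))))).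
      by rewrite ler_pM2l.
    by rewrite le_eqVlt; apply/orP; left; apply/eqP; field; rewrite !lt0r_neq0.
  have e3 : dot (v *m Rm) x <= dot v v / 4 + CR * dot x x.
    have s0 : 0 < (4^-1 : R) by rewrite invr_gt0.
    rewrite dot_mx Rs; have := dot_amgm v (x *m Rm) s0; rewrite divff ?invr1 ?divr1 ?pnatr_eq0//.
    by have := HCR x; clear; lra.
  have e4 : b * dot w x <= b ^+ 2 * dot w w + dot x x / 4.
    apply: (@le_trans _ _ (b * (b * dot w w + dot x x / (4 * b)))).
      by rewrite ler_pM2l// dot_amgm.
    by rewrite le_eqVlt; apply/orP; left; apply/eqP; field; exact: lt0r_neq0.
  have e5 : Q0 * dot (x *m H) x <= Q0 * (1 + CH / 4) * dot x x.
    have := dot_amgm x (x *m H) ltr01; rewrite (dotC x (x *m H)) mul1r mulr1 => h1.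
    rewrite -mulrA ler_pM2l//; move: h1; have := HCH x; clear; lra.
  have p2 : 0 < th ^+ 2 by rewrite exprn_gt0.
  have p3 : 0 < th ^+ 3 by rewrite exprn_gt0.
  have f2 : th ^+ 2 * (- (a * dot x w) - G0 * dot (x *m H) x) <= 
      - (th ^+ 2 * (3 / 4 * k * dot x x)) + th * (a ^+ 2 / k * dot w w).
    have g1 : th ^+ 2 * (- (a * dot x w) - G0 * dot (x *m H) x) <= 
      th ^+ 2 * (k / 4 * dot x x + a ^+ 2 / k * dot w w - k * dot x x) by rewrite ler_pM2l//; move: e2 hk; clear; lra.
    have g2 : th ^+ 2 * (a ^+ 2 / k * dot w w) <= th * (a ^+ 2 / k * dot w w).
      by rewrite ler_wpM2r// mulr_ge0// divr_ge0 ?sqr_ge0// ltW.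
    move: g1 g2; clear; lra.
  have f3 : th ^+ 3 * (dot (v *m Rm) x + b * dot w x + Q0 * dot (x *m H) x) <=
      th ^+ 3 / 4 * dot v v + th * (b ^+ 2 * dot w w) + th ^+ 2 * (th * A2 * dot x x).
    have g1 : th ^+ 3 * (dot (v *m Rm) x + b * dot w x + Q0 * dot (x *m H) x) <=
       th ^+ 3 * (dot v v / 4 + b ^+ 2 * dot w w + A2 * dot x x).
      by rewrite ler_pM2l// /A2; move: e3 e4 e5; clear; lra.
    have g2 : th ^+ 3 * (b ^+ 2 * dot w w) <= th * (b ^+ 2 * dot w w).
      by rewrite ler_wpM2r// mulr_ge0// sqr_ge0.
    have g3 : th ^+ 3 * (A2 * dot x x) = th ^+ 2 * (th * A2 * dot x x) by ring.
    move: g1 g2 g3; clear; lra.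
  have f4 : th ^+ 2 * (th * A2 * dot x x) <= th ^+ 2 * (k / 4 * dot x x).
    by rewrite ler_pM2l// ler_wpM2r.
  have f5 : th * A1 * dot w w <= d / 2 * dot w w by rewrite ler_wpM2r.
  have f6 : gam * dot x x <= th ^+ 2 * k / 2 * dot x x by rewrite ler_wpM2r// !ge_min lexx ?orbT.
  have f7 : gam * dot v v <= th ^+ 3 / 2 * dot v v by rewrite ler_wpM2r// !ge_min lexx ?orbT.
  have f8 : gam * dot w w <= d / 2 * dot w w by rewrite ler_wpM2r// !ge_min lexx ?orbT.
  have f9 : gam * q ^+ 2 <= h * q ^+ 2 by rewrite ler_wpM2r// !ge_min lexx ?orbT.
  have hW : D * lam / kap ^+ 2 * dot (w *m S) w = lam / kap * (D / kap) * dot (w *m S) w.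
    by congr (_ * _); field; exact: lt0r_neq0.
  rewrite mulmxBl -!scalemxAl !(dotDl, dotDr, dotNl, dotNr, dotZl, dotZr).
  rewrite (dotC v (x *m H)) (dotC v (v *m Rm)) (dotC x (x *m H)).
  move: f5; rewrite /A1; clearbody gam k d; clear - X0 V0 W0 qq hR hSR hk hd cross e1 f2 f3 f4 f6 f7 f8 f9 hW.
  move: (dot x x) (dot v v) (dot w w) (dot v w) (dot x w) (dot w x) (dot (v *m Rm) x) (dot (x *m H) x) (dot (v *m Rm) v)
     (dot (v *m S) (v *m Rm)) (dot (w *m S) w) (dot (v *m S) w) (dot (w *m S) (v *m Rm)) (dot (x *m H) v) 
     X0 V0 W0 hR hSR hk hd cross e1 f2 f3 f4 f6 f7 f8 f9 hW => *.
  lra.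
Qed.

(** * Submanifolds and left-invariant fields *)

Lemma continuous_near (R : realType) (V W : normedModType R) (f : V -> W) x0 (y0 : W) (P : W -> Prop) :
  {for x0, continuous f} -> f x0 = y0 -> (\forall y \near y0, P y) -> \forall x \near x0, P (f x).
Proof. by move=> cf <- H; exact: cf. Qed.

Section affine.
Context {R : realType} {V W : normedModType R}.
Lemma affine_diff (l : V -> W) (c : W) : linear l -> continuous l ->
  forall y, differentiable (fun x => l x + c) y /\ 'd (fun x => l x + c) y = l :> (V -> W).
Proof.
move=> ll cl y.
pose L : {linear V -> W} := HB.pack l (GRing.isLinear.Build _ _ _ _ _ ll).
apply: (@differentiable_eps _ _ _ _ y L) => // e e0; apply: near_all => h.
have -> : l (h + y) = l h + l y by exact: (linearD L).
by rewrite opprD addrACA subrr addr0 addrK subrr normr0 mulr_ge0// ltW.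
Qed.
End affine.

Section charts.
Context {R : realType} {N n : nat}.
Implicit Types (S O : set 'rV[R]_N) (W : set 'rV[R]_n).

(** In contrast to [embedded_submanifold], the inverse chart is smooth on an ambient open set, so
    its differential acts on all ambient vectors. *)
Definition chart S O W (phi : 'rV[R]_n -> 'rV[R]_N) (chi : 'rV[R]_N -> 'rV[R]_n) : Prop :=
  [/\ open O, open W, smooth W phi, smooth O chi &
   (forall y, W y -> [/\ O (phi y), S (phi y) & chi (phi y) = y]) /\
   (forall x, O x -> S x -> W (chi x) /\ phi (chi x) = x)].

Lemma chart_exists S x0 : embedded_submanifold n S -> S x0 ->
  exists O W phi chi, chart S O W phi chi /\ O x0.
Proof.
move=> HS Sx0; have [ O [W [phi [chi [[oO Ox0] oW [sphi schi] [b1 b2 b3] chiK]]]]] := HS _ Sx0.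
have [ O' [X [oO' O'x0 sX EX]]] := schi x0 (conj Ox0 Sx0).
exists (O `&` O'), (W `&` phi @^-1` O'), phi, X; split => //.
have key y : W y -> O' (phi y) -> X (phi y) = y.
  move=> Wy O'y; rewrite EX ?chiK//; exact: b1.
split.
- exact: openI.
- rewrite openE => y [Wy Oy].
  have cphi : {for y, continuous phi} by apply: differentiable_continuous; exact: smooth_differentiable Wy.
  exact: (filterI (open_near oW Wy) (continuous_near cphi erefl (open_near oO' Oy))).
- by apply: smooth_sub sphi => y [].
- by apply: smooth_sub sX => y [].
split=> [y [Wy O'y]|x [Ox O'x] Sx].
  have [Oy Sy] := b1 _ Wy; split => //; exact: key.
have [y Wy xE] := b3 x (conj Ox Sx); rewrite -xE in O'x *.
by rewrite key.
Qed.

Section chart_theory.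
Variables (S O : set 'rV[R]_N) (W : set 'rV[R]_n) (phi : 'rV[R]_n -> 'rV[R]_N) (chi : 'rV[R]_N -> 'rV[R]_n).
Hypothesis ch : chart S O W phi chi.

Lemma chart_tangentK x v (c : R -> 'rV[R]_N) : O x -> c 0 = x -> is_derive (0 : R) 1 c v ->
  (\forall t \near (0 : R), S (c t)) -> 'd phi (chi x) ('d chi x v) = v.
Proof.
case: ch => oO oW sphi schi [HW HO] Ox c0 dc Sc.
have Sx : S x by rewrite -c0; exact: (nbhs_singleton Sc).
have [Wx phix] := HO _ Ox Sx.
have dchi : differentiable chi (c 0) by rewrite c0; exact: smooth_differentiable Ox.
have dphi : differentiable phi (chi (c 0)) by rewrite c0; exact: smooth_differentiable Wx.
have d1 := isd_comp dphi (isd_comp dchi dc).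
rewrite c0 in d1.
apply: isd_unique (d1) _.
have cc : {for (0 : R), continuous c} by exact: isd_continuous dc.
apply: isd_near dc.
have Oc : \forall t \near (0 : R), O (c t) by apply: (continuous_near cc c0); exact: open_near.
by apply: filterS2 Sc Oc => t St Ot; have [] := HO _ Ot St.
Qed.

Lemma chart_line_tangent y w : W y -> tangent_space S (phi y) ('d phi y w).
Proof.
case: ch => oO oW sphi schi [HW HO] Wy.
have cl : continuous (fun t : R => t *: w) by move=> t; apply: cvgZr_tmp; exact: cvg_id.
have ll : linear (fun t : R => t *: w) by move=> k s t; rewrite scalerDl scalerA.
have dA := affine_diff y ll cl.
have cA t : {for t, continuous (fun t : R => t *: w + y)} by apply: differentiable_continuous; case: (dA t).
exists (fun t => phi (t *: w + y)); split.
- exists ((fun t : R => t *: w + y) @^-1` W); split.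
  + by apply: open_comp => // t _; exact: cA.
  + by rewrite /preimage/= scale0r add0r.
  + by apply: (smooth_affine (l := fun t : R => t *: w)) => // t; case: (dA t).
  + by move=> t /HW[].
- by rewrite scale0r add0r.
- have := isd_comp (c := fun t : R => t *: w + y) (f := phi) (t := 0) (w := 1) (dc := w); rewrite scale0r add0r; apply.
    exact: smooth_differentiable Wy.
  apply: (isd_eq (isd_add (isd_scalel (isd_id (0 : R) 1) (isd_cst w (0 : R) 1)) (isd_cst y (0 : R) 1))).
  by rewrite scale0r scale1r add0r addr0.
Qed.
End chart_theory.

Section tangent.
Variables (S : set 'rV[R]_N).
Hypothesis HS : embedded_submanifold n S.

(** The definition of [tangent_space] asks for a smooth curve, whereas products and flows supply
    curves that are merely derivable at 0. Such a curve is replaced by a straight line in a chart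
    with the same velocity. *)
Lemma tangentP x v (c : R -> 'rV[R]_N) : c 0 = x -> is_derive (0 : R) 1 c v ->
  (\forall t \near (0 : R), S (c t)) -> tangent_space S x v.
Proof.
move=> c0 dc Sc; have Sx : S x by rewrite -c0; exact: (nbhs_singleton Sc).
have [ O [W [phi [chi [ch Ox]]]]] := chart_exists HS Sx.
have <- := chart_tangentK ch Ox c0 dc Sc.
have [_ _ _ _ [_ HO]] := ch; have [Wx {1}<-] := HO _ Ox Sx.
exact: (chart_line_tangent ch).
Qed.

Lemma tangent_curve x v : tangent_space S x v -> exists c : R -> 'rV[R]_N, [/\ c 0 = x, is_derive (0 : R) 1 c v & 
  \forall t \near (0 : R), S (c t)].
Proof.
move=> [c [[ O [oO O0 _ Sc]] c0 dc]]; exists c; split => //.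
by apply: filterS (open_near oO O0) => t; exact: Sc.
Qed.

Lemma tangent_set x v : tangent_space S x v -> S x.
Proof. by move=> /tangent_curve[c [<- _ /nbhs_singleton]]. Qed.

Lemma tangent_chartK O W phi chi x v : chart S O W phi chi -> O x -> tangent_space S x v ->
  'd phi (chi x) ('d chi x v) = v.
Proof. by move=> ch Ox /tangent_curve[c [c0 dc Sc]]; exact: (chart_tangentK ch Ox c0 dc Sc). Qed.

(** In a chart the tangent vectors at [x] are images under the differential of the parametrization,
    hence closed under linear combinations. *)
Lemma tangent_lin x k v w : tangent_space S x v -> tangent_space S x w ->
  tangent_space S x (k *: v + w).
Proof.
move=> tv tw; have Sx := tangent_set tv.
have [ O [W [phi [chi [ch Ox]]]]] := chart_exists HS Sx.
rewrite -(tangent_chartK ch Ox tv) -(tangent_chartK ch Ox tw) -linearP.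
have [_ _ _ _ [_ HO]] := ch; have [Wx {1}<-] := HO _ Ox Sx.
exact: (chart_line_tangent ch).
Qed.

Lemma tangent0 x : S x -> tangent_space S x 0.
Proof.
move=> Sx; apply: (tangentP (c := fun=> x) erefl (isd_cst _ _ _)).
by apply: near_all.
Qed.

(** All curves with velocity [v] give the same derivative, that of any ambient extension [F], so the
    choice made by [xget] is determined. *)
Lemma dmapE (U : normedModType R) (f F : 'rV[R]_N -> U) x v : tangent_space S x v ->
  differentiable F x -> (\forall y \near x, S y -> F y = f y) -> dmap S f x v = 'd F x v.
Proof.
move=> tv dF Ff.
have key c : curve_through S x v c -> is_derive (0 : R) 1 (f \o c) ('d F x v).
  move=> [[ O [oO O0 _ Sc]] c0 dc].
  have := isd_comp (c := c) (f := F) (t := 0) (w := 1) (dc := v); rewrite c0 => /(_ dF dc).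
  have cc : {for (0 : R), continuous c} by exact: isd_continuous dc.
  apply: isd_near.
  have nF : \forall t \near (0 : R), S (c t) -> F (c t) = f (c t) by exact: (continuous_near (P := fun z => S z -> F z = f z) cc c0 Ff).
  by apply: filterS2 nF (open_near oO O0) => t H Ot; apply: H; exact: Sc.
apply: xget_unique.
  by case: tv => c cc; exists c; split => //; exact: key.
by move=> w [c [cc dw]]; apply: isd_unique dw _; exact: key.
Qed.

Lemma dmap_curve (U : normedModType R) (f F : 'rV[R]_N -> U) x v (c : R -> 'rV[R]_N) :
  tangent_space S x v -> differentiable F x -> (\forall y \near x, S y -> F y = f y) ->
  c 0 = x -> is_derive (0 : R) 1 c v -> (\forall t \near (0 : R), S (c t)) ->
  is_derive (0 : R) 1 (f \o c) (dmap S f x v).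
Proof.
move=> tv dF Ff c0 dc Sc; rewrite (dmapE tv dF Ff).
have cc : {for (0 : R), continuous c} by exact: isd_continuous dc.
have := isd_comp (c := c) (f := F) (t := 0) (w := 1) (dc := v); rewrite c0 => /(_ dF dc).
apply: isd_near.
have nF := continuous_near (P := fun z => S z -> F z = f z) cc c0 Ff.
by apply: filterS2 nF Sc => t; exact.
Qed.

End tangent.
End charts.

Section pairs.
Context {R : realType} {V W : normedModType R}.
Lemma pairl_diff (y0 : W) (x : V) : differentiable (fun y => (y, y0)) x /\
  'd (fun y : V => (y, y0)) x = (fun y => (y, 0)) :> (V -> V * W).
Proof.
have cl : continuous (fun y : V => (y, 0 : W)) by move=> y; apply: cvg_pair; [exact: cvg_id|exact: cvg_cst].
have ll : linear (fun y : V => (y, 0 : W)).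
  by move=> k u v; apply/pair_equal_spec; split => //=; rewrite scaler0 addr0.
have := affine_diff (0, y0) ll cl x.
suff -> : (fun x0 : V => (x0, 0 : W) + (0, y0)) = (fun y => (y, y0)) by [].
by apply/funext => y; apply/pair_equal_spec; split => /=; rewrite ?addr0 ?add0r.
Qed.
Lemma pairr_diff (x0 : V) (y : W) : differentiable (fun y => (x0, y)) y /\
  'd (fun y : W => (x0, y)) y = (fun y => (0, y)) :> (W -> V * W).
Proof.
have cl : continuous (fun y : W => (0 : V, y)) by move=> z; apply: cvg_pair; [exact: cvg_cst|exact: cvg_id].
have ll : linear (fun y : W => (0 : V, y)).
  by move=> k u v; apply/pair_equal_spec; split => //=; rewrite scaler0 addr0.
have := affine_diff (x0, 0) ll cl y.
suff -> : (fun y : W => (0 : V, y) + (x0, 0)) = (fun y => (x0, y)) by [].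
by apply/funext => z; apply/pair_equal_spec; split => /=; rewrite ?addr0 ?add0r.
Qed.
End pairs.

(** * Left translations and left-invariant fields *)

Section lie_group.
Context {R : realType} {N n : nat} (G : closedLieGroup R N n).
Let HS := @lg_submanifold _ _ _ G.
Local Notation one := (lg_one G).
Local Notation LA := (lie_algebra G).

Lemma mul_right_ext g x : lg_set G g -> lg_set G x -> exists F : 'rV[R]_N -> 'rV[R]_N,
  differentiable F x /\ \forall y \near x, lg_set G y -> F y = lg_mul G g y.
Proof.
move=> Gg Gx; have [ O [M [oO O0 sM ME]]] := lg_mul_smooth (conj Gg Gx : (G `*` G) (g, x)).
have [d1 d2] := pairr_diff g x.
exists (fun y => M (g, y)); split.
  apply: (differentiable_comp (g := M) d1); exact: smooth_differentiable O0.
have cp : {for x, continuous (fun y : 'rV[R]_N => (g, y))} by exact: differentiable_continuous.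
by apply: filterS (continuous_near cp erefl (open_near oO O0)) => y Oy Gy; rewrite ME.
Qed.

(** A left-invariant field is the partial derivative of the multiplication in its second argument at
    the identity. A smooth ambient extension of the multiplication near (g0, one) therefore serves
    all [v] on one neighbourhood. *)
Lemma left_field_ext g0 : lg_set G g0 -> exists (O : set 'rV[R]_N) (D : 'rV[R]_N -> 'rV[R]_N -> 'rV[R]_N),
  [/\ open O, O g0, forall v, smooth O (D v), (forall g, O g -> linear (D^~ g)) &
   forall v g, O g -> lg_set G g -> LA v -> left_field G v g = D v g].
Proof.
move=> Gg; have [ O [M [oO O0 sM ME]]] := lg_mul_smooth (conj Gg (lg_oneP G) : (G `*` G) (g0, one)).
have dA (y : 'rV[R]_N) := pairl_diff one y.
exists ((fun y => (y, one)) @^-1` O), (fun v y => 'D_((0, v) : 'rV[R]_N * 'rV[R]_N) M (y, one)); split => //.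
- apply: open_comp => // y _; apply: differentiable_continuous; exact: (dA y).1.
- move=> v; apply: (smooth_affine (f := 'D_((0, v) : 'rV[R]_N * 'rV[R]_N) M) (A := fun y => (y, one)) (l := fun y => (y, 0))) => //;
    try by move=> y; case: (dA y).
  exact: smooth_derive.
- move=> g Og k v w; have dM : differentiable M (g, one) by exact: (smooth_differentiable sM Og).
  rewrite !deriveE// -linearP; congr ('d M _ _); apply/pair_equal_spec; split => //=.
  by rewrite scaler0 addr0.
- move=> v g Og Gg' Lv; have dM : differentiable M (g, one) by exact: (smooth_differentiable sM Og).
  have [d1 d2] := pairr_diff g one.
  have cp : {for one, continuous (fun y : 'rV[R]_N => (g, y))} by exact: differentiable_continuous.
  rewrite /left_field /dleft (dmapE (F := fun x => M (g, x)) Lv).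
  + have H : is_derive one v (fun y => (g, y)) ((0, v) : 'rV[R]_N * 'rV[R]_N).
      by apply: (isd_eq (isd_diff v d1)); rewrite d2.
    by rewrite deriveE//; apply: isd_diffE; [exact: (differentiable_comp d1 dM)|exact: (isd_comp dM H)].
  + exact: (differentiable_comp d1 dM).
  + apply: filterS (continuous_near (P := O) cp erefl (open_near oO Og)) => y Oy Gy; exact: ME.
Qed.

Lemma lie_algebra_lin k v w : LA v -> LA w -> LA (k *: v + w).
Proof. exact: (tangent_lin HS). Qed.

Lemma lie_algebra0 : LA 0.
Proof. exact: (tangent0 HS (lg_oneP G)). Qed.

Lemma left_field_lin k v w g : lg_set G g -> LA v -> LA w ->
  left_field G (k *: v + w) g = k *: left_field G v g + left_field G w g.
Proof.
move=> Gg Lv Lw; have [ O [D [oO Og _ lD DE]]] := left_field_ext Gg.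
by rewrite !DE//; [rewrite lD|exact: (tangent_lin HS)].
Qed.

Lemma left_field0 g : lg_set G g -> left_field G 0 g = 0.
Proof.
move=> Gg; have L0 : LA 0 by exact: (tangent0 HS (lg_oneP G)).
have := left_field_lin 1 Gg L0 L0; rewrite !scale1r addr0 => /eqP.
by rewrite -subr_eq0 opprD addNKr oppr_eq0 => /eqP.
Qed.

Lemma left_field_sum m (k : 'I_m -> R) (v : 'I_m -> 'rV[R]_N) g : lg_set G g -> (forall i, LA (v i)) ->
  left_field G (\sum_i k i *: v i) g = \sum_i k i *: left_field G (v i) g.
Proof.
move=> Gg Lv.
suff [_ ->] : LA (\sum_i k i *: v i) /\ 
  left_field G (\sum_i k i *: v i) g = \sum_i k i *: left_field G (v i) g by [].
elim/big_rec2: _ => [|i w y _ [Lw <-]].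
  by rewrite left_field0//; split => //; exact: (tangent0 HS (lg_oneP G)).
by split; [exact: lie_algebra_lin|rewrite left_field_lin].
Qed.

Lemma left_field_one v : LA v -> left_field G v one = v.
Proof.
move=> Lv; have did : differentiable (fun x : 'rV[R]_N => x) one by exact: (@ex_diff _ _ _ _ _ _ _ (is_diff_id one)).
rewrite /left_field /dleft (dmapE (F := fun x => x) Lv)//.
  exact: (isd_diffE did (isd_id one v)).
by apply: near_all => y Gy; rewrite lg_mul1.
Qed.

Lemma left_field_curve g v (c : R -> 'rV[R]_N) : lg_set G g -> c 0 = one -> is_derive (0 : R) 1 c v ->
  (\forall t \near (0 : R), lg_set G (c t)) -> is_derive (0 : R) 1 (fun t => lg_mul G g (c t)) (left_field G v g).
Proof.
move=> Gg c0 dc Gc; have Lv := tangentP HS c0 dc Gc.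
have [F [dF FE]] := mul_right_ext Gg (lg_oneP G).
exact: (dmap_curve Lv dF FE c0 dc Gc).
Qed.

Lemma left_field_tangent g v : lg_set G g -> LA v -> tangent_space G g (left_field G v g).
Proof.
move=> Gg /tangent_curve[c [c0 dc Gc]].
apply: (tangentP HS _ (left_field_curve Gg c0 dc Gc)); first by rewrite c0 lg_mulr1.
by apply: filterS Gc => t Gt; exact: lg_mulP.
Qed.

(** Translating the curve g c(t), of velocity 0, back by the inverse of [g] recovers c(t), which
    then has velocity 0 too. *)
Lemma left_field_inj g v : lg_set G g -> LA v -> left_field G v g = 0 -> v = 0.
Proof.
move=> Gg /tangent_curve[c [c0 dc Gc]] v0.
have d1 := left_field_curve Gg c0 dc Gc; rewrite v0 in d1.
have Gi := lg_invP Gg.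
have [F [dF FE]] := mul_right_ext Gi Gg.
have b0 : lg_mul G g (c 0) = g by rewrite c0 lg_mulr1.
have Gb : \forall t \near (0 : R), lg_set G (lg_mul G g (c t)).
  by apply: filterS Gc => t Gt; exact: lg_mulP.
have T0 : tangent_space G g 0 by exact: (tangent0 HS).
have := dmap_curve T0 dF FE b0 d1 Gb; rewrite (dmapE T0 dF FE) linear0 => d2.
apply: isd_unique dc _; apply: isd_near d2.
by apply: filterS Gc => t Gt /=; rewrite lg_mulA// lg_mulV// lg_mul1.
Qed.

Lemma left_field_vector_field v : LA v -> vector_field G (left_field G v).
Proof.
move=> Lv; split=> [g Gg|g Gg]; last exact: left_field_tangent.
have [ O [D [oO Og sD _ DE]]] := left_field_ext Gg.
by exists O, (D v); split => // y Oy Gy; rewrite -DE.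
Qed.

End lie_group.

(** * Connections restricted to left-invariant fields *)

Section connection.
Context {R : realType} {N n : nat}.
Variables (S : set 'rV[R]_N) (HS : embedded_submanifold n S).
Variables (nabla : ('rV[R]_N -> 'rV[R]_N) -> ('rV[R]_N -> 'rV[R]_N) -> ('rV[R]_N -> 'rV[R]_N)).
Hypothesis Hn : affine_connection S nabla.

Lemma smooth_on_cst (W : normedModType R) (c : W) : smooth_on S (fun=> c).
Proof. by move=> x Sx; exists setT, (fun=> c); split => //; [exact: openT|exact: smooth_cst]. Qed.

Lemma smooth_on_eq (W : normedModType R) (f g : 'rV[R]_N -> W) : (forall x, S x -> f x = g x) ->
  smooth_on S f -> smooth_on S g.
Proof.
move=> fg sf x Sx; have [ O [F [oO Ox sF FE]]] := sf x Sx.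
by exists O, F; split => // y Oy Sy; rewrite FE// fg.
Qed.

(* The connection is only specified on S; multiplying by the indicator function of S, which is smooth
   on S, shows that its value on S does not depend on the fields outside S. *)
Let chi (x : 'rV[R]_N) : R := if asbool (S x) then 1 else 0.
Let chi1 x : S x -> chi x = 1. Proof. by move=> Sx; rewrite /chi asboolT. Qed.
Let schi : smooth_on S chi.
Proof. by apply: (smooth_on_eq (f := fun=> 1 : R)); [move=> x Sx; rewrite chi1|exact: smooth_on_cst]. Qed.

Let chi_eq (X X' : 'rV[R]_N -> 'rV[R]_N) : (forall x, S x -> X x = X' x) ->
  (fun x => chi x *: X x) = (fun x => chi x *: X' x).
Proof.
move=> H; apply/funext => x; rewrite /chi; case: asboolP => [Sx|_]; first by rewrite H.
by rewrite !scale0r.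
Qed.

Let vf0 : vector_field S (fun=> 0).
Proof. by split=> [|x Sx]; [exact: smooth_on_cst|exact: (tangent0 HS)]. Qed.

Lemma conn_eql X X' Y x : vector_field S X -> vector_field S X' -> vector_field S Y ->
  (forall y, S y -> X y = X' y) -> S x -> nabla X Y x = nabla X' Y x.
Proof.
move=> vX vX' vY E Sx.
have := conn_linl Hn schi vX vf0 vY Sx.
have -> : (fun y => chi y *: X y + 0) = (fun y => chi y *: X' y + 0).
  by apply/funext => y; have /(congr1 (fun f => f y)) -> := chi_eq E.
by rewrite (conn_linl Hn schi vX' vf0 vY Sx) chi1// !scale1r => /addIr.
Qed.

Lemma conn_eqr X Y Y' x : vector_field S X -> vector_field S Y -> vector_field S Y' ->
  (forall y, S y -> Y y = Y' y) -> S x -> nabla X Y x = nabla X Y' x.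
Proof.
move=> vX vY vY' E Sx.
have := conn_leibniz Hn schi vX vY Sx; rewrite (chi_eq E) (conn_leibniz Hn schi vX vY' Sx) chi1// !scale1r E//.
by move=> /addrI.
Qed.

Lemma conn_scaler k X Y x : vector_field S X -> vector_field S Y -> S x ->
  nabla X (fun y => k *: Y y) x = k *: nabla X Y x.
Proof.
move=> vX vY Sx; rewrite (conn_leibniz Hn (smooth_on_cst k) vX vY Sx).
rewrite /deriv_along (dmapE (F := fun=> k) (vX.2 _ Sx))//; last exact: near_all.
by rewrite diff_cst scale0r add0r.
Qed.

End connection.

Section gnabla.
Context {R : realType} {N n : nat} (G : closedLieGroup R N n).
Variables (nabla : ('rV[R]_N -> 'rV[R]_N) -> ('rV[R]_N -> 'rV[R]_N) -> ('rV[R]_N -> 'rV[R]_N)).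
Hypothesis Hn : affine_connection G nabla.
Variable gnabla : 'rV[R]_N -> 'rV[R]_N -> 'rV[R]_N.
Hypothesis Hg : lie_algebra_connection G nabla gnabla.
Let HS := @lg_submanifold _ _ _ G.
Local Notation LA := (lie_algebra G).
Local Notation LF := (left_field G).

Lemma gnablaE v w : LA v -> LA w -> gnabla v w = nabla (LF v) (LF w) (lg_one G).
Proof.
move=> Lv Lw; have [L E] := Hg Lv Lw; rewrite -E; last exact: lg_oneP.
by rewrite [RHS](left_field_one L).
Qed.

Lemma vector_field_lin k (X : 'rV[R]_N -> 'rV[R]_N) v w : LA v -> LA w ->
  (forall y, lg_set G y -> X y = LF (k *: v + w) y) -> vector_field G X.
Proof.
move=> Lv Lw E; have Lkv : LA (k *: v + w) by exact: (tangent_lin HS).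
have [s t] := left_field_vector_field Lkv; split.
  by apply: smooth_on_eq s => x Gx; rewrite E.
by move=> x Gx; rewrite E//; exact: t.
Qed.

(** The field of a linear combination equals the combination of the fields only at points of G,
    which is why [conn_eql] is called for. *)
Lemma gnabla_linl k v v' w : LA v -> LA v' -> LA w ->
  gnabla (k *: v + v') w = k *: gnabla v w + gnabla v' w.
Proof.
move=> Lv Lv' Lw; have Lkv : LA (k *: v + v') by exact: (tangent_lin HS).
rewrite !gnablaE//.
have X := left_field_vector_field Lv; have X' := left_field_vector_field Lv'.
have Y := left_field_vector_field Lw.
have E y : lg_set G y -> k *: LF v y + LF v' y = LF (k *: v + v') y.
  by move=> Gy; rewrite left_field_lin.
have := lg_oneP G => G1.
rewrite -(conn_linl Hn (smooth_on_cst k) X X' Y)//.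
apply: (conn_eql HS Hn) => //; try exact: left_field_vector_field.
  exact: (vector_field_lin (k := k) Lv Lv').
by move=> y Gy; rewrite E.
Qed.

Lemma gnabla_linr k v w w' : LA v -> LA w -> LA w' ->
  gnabla v (k *: w + w') = k *: gnabla v w + gnabla v w'.
Proof.
move=> Lv Lw Lw'; have Lkw : LA (k *: w + w') by exact: (tangent_lin HS).
rewrite !gnablaE//; have G1 := lg_oneP G.
have vX := left_field_vector_field Lv; have vY := left_field_vector_field Lw.
have vY' := left_field_vector_field Lw'.
have L0 : LA 0 by exact: (tangent0 HS).
have vkY : vector_field G (fun y => k *: LF w y).
  apply: (vector_field_lin (k := k) Lw L0) => y Gy.
  by rewrite left_field_lin// left_field0// addr0.
rewrite -(conn_scaler Hn k vX vY G1) -(conn_addr Hn vX vkY vY' G1).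
apply: (conn_eqr Hn) => //; try exact: left_field_vector_field.
  apply: (vector_field_lin (k := k) Lw Lw') => y Gy.
  by rewrite left_field_lin.
by move=> y Gy; rewrite left_field_lin.
Qed.

Lemma gnabla_sum m (k : 'I_m -> R) (e : 'I_m -> 'rV[R]_N) : (forall i, LA (e i)) ->
  gnabla (\sum_i k i *: e i) (\sum_i k i *: e i) = \sum_i \sum_j (k i * k j) *: gnabla (e i) (e j).
Proof.
move=> Le.
have L0 : LA 0 by exact: (tangent0 HS (lg_oneP G)).
have Ls (s : seq 'I_m) : LA (\sum_(i <- s) k i *: e i).
  by elim/big_rec: _ => [|i w _ Lw]; [exact: lie_algebra0|exact: lie_algebra_lin].
have z0 (x : 'rV[R]_N) : x = 1 *: x + x -> x = 0.
  by rewrite scale1r => /eqP; rewrite -subr_eq0 opprD addNKr oppr_eq0 => /eqP.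
have lsum w : LA w -> gnabla (\sum_i k i *: e i) w = \sum_i k i *: gnabla (e i) w.
  move=> Lw; elim: (index_enum _) => [|i s IH].
    rewrite !big_nil; apply: z0; by rewrite -{1}(gnabla_linl 1 L0 L0 Lw) scaler0 addr0.
  by rewrite !big_cons gnabla_linl// IH.
have rsum v : LA v -> gnabla v (\sum_i k i *: e i) = \sum_i k i *: gnabla v (e i).
  move=> Lv; elim: (index_enum _) => [|i s IH].
    rewrite !big_nil; apply: z0; by rewrite -{1}(gnabla_linr 1 Lv L0 L0) scaler0 addr0.
  by rewrite !big_cons gnabla_linr// IH.
rewrite lsum; last exact: Ls.
apply: eq_bigr => i _; rewrite rsum// scaler_sumr; apply: eq_bigr => j _.
by rewrite scalerA.
Qed.
End gnabla.

Lemma cont_diff_post (R : realType) (V W W' : normedModType R) k (O : set V) (f : V -> W) 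
    (L : W -> W') c : open O -> linear L -> continuous L ->
  cont_diff k O f -> cont_diff k O (fun x => L (f x) + c).
Proof.
move=> oO ll cl; elim: k f c => [|k IH] f c /= H.
  move=> x Ox; apply: cvgD; last exact: cvg_cst.
  by apply: continuous_comp; [exact: H|exact: cl].
case: H => H1 H2.
have dl y := affine_diff c ll cl y.
have E x v : O x -> is_derive x v (fun x => L (f x) + c) (L ('D_v f x)).
  move=> Ox; have := isd_comp (f := fun y => L y + c) (dl (f x)).1 (isd_diff v (H1 _ Ox)).
  by rewrite (dl (f x)).2 deriveE//; exact: H1.
split=> [x Ox|v]; first exact: (differentiable_comp (g := fun y => L y + c) (H1 _ Ox) (dl _).1).
apply: (cont_diff_congr oO) (IH _ 0 (H2 v)) => x Ox.
by rewrite addr0; apply/esym; case: (E x v Ox).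
Qed.

Lemma mulmxr_linear (R : realType) m n (A : 'M[R]_(m, n)) : linear (fun x : 'rV[R]_m => x *m A).
Proof. by move=> k x y; rewrite mulmxDl scalemxAl. Qed.

Lemma mulmxr_continuous (R : realType) m n (A : 'M[R]_(m, n)) : continuous (fun x : 'rV[R]_m => x *m A).
Proof.
have [L L0 H] := mulmx_bound A.
by apply: (@lipschitz_continuous _ _ _ _ L) => x y; rewrite -mulmxBl.
Qed.

Lemma diff_rowE (R : realType) N (W : normedModType R) (f : 'rV[R]_N -> W) x v : differentiable f x ->
  'd f x v = \sum_j v 0 j *: 'D_(delta_mx 0 j) f x.
Proof.
move=> df; rewrite {1}[v]row_basisE linear_sum; apply: eq_bigr => j _.
by rewrite linearZ deriveE.
Qed.

Lemma sum_delta_mx2 (R : realType) n (F : 'I_n -> 'I_n -> R) i j :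
  \sum_k \sum_l (delta_mx 0 i : 'rV[R]_n) 0 k * (delta_mx 0 j : 'rV[R]_n) 0 l * F k l = F i j.
Proof.
rewrite (bigD1 i)//= [X in _ + X]big1 => [|k ki]; last first.
  by apply: big1 => l _; rewrite mxE eqxx (negbTE ki) !mul0r.
rewrite addr0 (bigD1 j)//= big1 => [|l lj]; first by rewrite !mxE !eqxx !mul1r addr0.
by rewrite [delta_mx 0 j 0 l]mxE eqxx (negbTE lj) mulr0 mul0r.
Qed.

Lemma local_min_derive (R : realType) (f : R -> R) l : is_derive (0 : R) 1 f l ->
  (\forall t \near (0 : R), f 0 <= f t) -> l = 0.
Proof.
move=> dl fm; apply/eqP/negPn/negP => l0.
have df : differentiable f 0 by apply/derivable1_diffP; case: dl.
have dE h : 'd f 0 h = h * l.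
  have {1}-> : h = h *: (1 : R) by rewrite /GRing.scale/= mulr1.
  by rewrite linearZ (isd_diffE df dl).
have l2 : 0 < `|l| / 2 by rewrite divr_gt0 ?normr_gt0.
have /near_normP[e1 e10 H1] := diff_eps df l2.
have /near_normP[e2 e20 H2] := fm.
pose s := Num.min e1 e2 / 2.
have s0 : 0 < s by rewrite divr_gt0// lt_min e10.
have se : s < Num.min e1 e2 by rewrite ltr_pdivrMr// mulr_natr mulr2n ltrDr lt_min e10.
have [se1 se2] : s < e1 /\ s < e2 by move: se; rewrite lt_min => /andP.
(* A step against the sign of [l] lowers the linear part by s times the absolute value of [l], and
   the remainder is at most half of that. *)
pose h := - (s * Num.sg l).
have nh : `|h| = s by rewrite normrN normrM normr_sg l0 mulr1 gtr0_norm.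
have := H1 h; rewrite subr0 nh => /(_ se1).
have := H2 h; rewrite subr0 nh => /(_ se2).
rewrite addr0 dE => h2 /ler_normlP[h1 h3].
have lh : h * l = - (s * `|l|) by rewrite mulNr -mulrA normrEsg.
rewrite lh in h1 h3.
have : 0 < s * `|l| by rewrite mulr_gt0 ?normr_gt0.
move: h1 h2 h3; rewrite (mulrAC `|l|) [`|l| * s]mulrC; move: (f h) (f 0) (s * `|l|) => A B C; lra.
Qed.

(** * Left-invariant frames and the chart at the minimum of psi *)

Section basis.
Context {R : realType} {N n : nat} (G : closedLieGroup R N n).
Variables (ip : 'rV[R]_N -> 'rV[R]_N -> R) (e : 'I_n -> 'rV[R]_N).
Hypothesis hip : inner_product_on (lie_algebra G) ip.
Hypothesis he : orthonormal_basis (lie_algebra G) ip e.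
Local Notation LA := (lie_algebra G).

Lemma in_basis_lie w : LA (in_basis e w).
Proof.
have [Le _ _] := he; rewrite /in_basis; elim/big_rec: _ => [|i x _ Lx]; first exact: lie_algebra0.
exact: lie_algebra_lin.
Qed.

Lemma ip_sum m (k : 'I_m -> R) (v : 'I_m -> 'rV[R]_N) z : (forall i, LA (v i)) -> LA z ->
  ip (\sum_i k i *: v i) z = \sum_i k i * ip (v i) z.
Proof.
move=> Lv Lz.
suff [_ ->] : LA (\sum_i k i *: v i) /\ ip (\sum_i k i *: v i) z = \sum_i k i * ip (v i) z by [].
elim/big_rec2: _ => [|i y w _ [Lw E]].
  split; first exact: lie_algebra0.
  have L0 := lie_algebra0 G.
  by have := ip_lin hip (-1) L0 L0 Lz; rewrite scaler0 addr0 mulN1r addNr.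
by split; [exact: lie_algebra_lin|rewrite (ip_lin hip)// E].
Qed.

Lemma ip_in_basis w j : ip (in_basis e w) (e j) = w 0 j.
Proof.
case: he => Le Oe _; rewrite /in_basis ip_sum//.
rewrite (bigD1 j)//= Oe eqxx mulr1 big1 ?addr0// => i ij.
by rewrite Oe (negbTE ij) mulr0.
Qed.

Lemma in_basis_inj w : in_basis e w = 0 -> w = 0.
Proof.
move=> w0; apply/rowP => j; rewrite -ip_in_basis w0 mxE.
have L0 := lie_algebra0 G; have [Le _ _] := he.
by have := ip_lin hip (-1) L0 L0 (Le j); rewrite scaler0 addr0 mulN1r addNr.
Qed.

Lemma left_field_in_basis w g : lg_set G g ->
  left_field G (in_basis e w) g = \sum_i w 0 i *: left_field G (e i) g.
Proof. by move=> Gg; rewrite left_field_sum//; case: he. Qed.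

(** An affine change of coordinates takes an arbitrary chart to one where [gs] is the origin and the
    frame there is the standard basis. Positions and velocities are then expressed in the same
    orthonormal basis, and the linearized kinematics read x' = v. *)
Lemma normal_chart gs : lg_set G gs -> exists O W phi chi (X : 'I_n -> 'rV[R]_n -> 'rV[R]_n),
  [/\ chart G O W phi chi, O gs, chi gs = 0,
    forall i, [/\ nice (X i) 0, X i 0 = delta_mx 0 i & 
      \forall y \near (0 : 'rV[R]_n), 'd phi y (X i y) = left_field G (e i) (phi y)] & 
      W 0 /\ phi 0 = gs].
Proof.
move=> Gs; have [ O [W [phi0 [chi0 [ch Os]]]]] := chart_exists (@lg_submanifold _ _ _ G) Gs.
case: (ch) => oO oW sphi schi [HW HO].
have [Le _ _] := he.
pose y0 := chi0 gs; have [Wy0 phiy0] := HO _ Os Gs; rewrite -/y0 in Wy0 phiy0.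
(* Rows are the frame at [gs] read in the chart. The matrix is invertible because left translation
   and the chart differential are injective on tangent vectors. *)
pose A : 'M[R]_n := \matrix_i ('d chi0 gs (left_field G (e i) gs)).
have AE w : w *m A = 'd chi0 gs (left_field G (in_basis e w) gs).
  rewrite left_field_in_basis// linear_sum mulmx_sum_row; apply: eq_bigr => i _.
  by rewrite linearZ rowK.
have Au : A \in unitmx.
  rewrite -row_free_unit -kermx_eq0; apply/rowV0P => w /sub_kermxP wA.
  apply: in_basis_inj; have Lw := in_basis_lie w.
  apply: (left_field_inj Gs Lw).
  rewrite -(tangent_chartK ch Os (left_field_tangent Gs Lw)) -AE wA.
  exact: linear0.
pose phi y := phi0 (y *m A + y0).
pose chi z := chi0 z *m invmx A + - (y0 *m invmx A).
have dA y := affine_diff y0 (mulmxr_linear A) (@mulmxr_continuous _ _ _ A) y.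
have cA : continuous (fun y : 'rV[R]_n => y *m A + y0).
  by move=> y; apply: differentiable_continuous; exact: (dA y).1.
pose W' := (fun y : 'rV[R]_n => y *m A + y0) @^-1` W.
have ch' : chart G O W' phi chi.
  split => //.
  - by apply: open_comp => // y _; exact: cA.
  - exact: (smooth_affine oW (fun y => (dA y).1) (fun y => (dA y).2) sphi).
  - move=> k; exact: (cont_diff_post _ oO (mulmxr_linear (invmx A)) (@mulmxr_continuous _ _ _ (invmx A)) (schi k)).
  split=> [y Wy|x Ox Gx].
    have [H1 H2 H3] := HW _ Wy; split => //.
    by rewrite /chi /phi H3 mulmxDl mulmxK// addrK.
  have [H1 H2] := HO _ Ox Gx.
  have E : chi x *m A + y0 = chi0 x by rewrite /chi mulmxDl mulNmx !mulmxKV// subrK.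
  by rewrite /W' /phi /preimage/= E.
have chis : chi gs = 0 by rewrite /chi subrr.
have [_ _ sphi' schi' [HW' HO']] := ch'.
have [W0 phi00] := HO' _ Os Gs; rewrite chis in W0 phi00.
have [OD [D [oD ODs sD lD DE]]] := left_field_ext Gs.
(* [left_field] is controlled only on G, so the frame is written through its ambient extension [D]
   to obtain maps that are [nice] at the origin. *)
pose X i y : 'rV[R]_n := \sum_j D (e i) (phi y) 0 j *: 'D_(delta_mx 0 j) chi (phi y).
have oW' : open W' by case: ch'.
have nphi : nice phi 0 by exact: smooth_row_nice W0 sphi'.
have XE i y : W' y -> OD (phi y) -> X i y = 'd chi (phi y) (left_field G (e i) (phi y)).
  move=> Wy ODy; have [Oy Gy _] := HW' _ Wy.
  by rewrite (diff_rowE _ (smooth_differentiable schi' Oy)) (DE _ _ ODy Gy (Le i)).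
have near_good : \forall y \near (0 : 'rV[R]_n), W' y /\ OD (phi y).
  have := continuous_near (nice_continuous nphi) phi00 (open_near oD ODs).
  by apply: filterS2 (open_near oW' W0) => y.
exists O, W', phi, chi, X; split => // i; split.
- apply: nice_sum => j; apply: nice_scale.
    apply: nice_coord; apply: (nice_comp (f := D (e i)) nphi); rewrite phi00.
    exact: smooth_row_nice ODs (sD _).
  apply: (nice_comp (f := 'D_(delta_mx 0 j) chi) nphi); rewrite phi00.
  exact: smooth_row_nice Os (smooth_derive _ schi').
- rewrite XE ?phi00//.
  have dchi0 : differentiable chi0 gs by exact: smooth_differentiable Os.
  have dchi : differentiable chi gs by exact: smooth_differentiable Os.
  have dL := affine_diff (- (y0 *m invmx A)) (mulmxr_linear (invmx A)) (@mulmxr_continuous _ _ _ (invmx A)) (chi0 gs).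
  rewrite (isd_diffE dchi (isd_comp dL.1 (isd_diff (left_field G (e i) gs) dchi0))) dL.2.
  have -> : 'd chi0 gs (left_field G (e i) gs) = row i A by rewrite rowK.
  by rewrite rowE mulmxK.
- apply: filterS near_good => y [Wy ODy]; have [Oy Gy chiK] := HW' _ Wy.
  rewrite XE//.
  have := tangent_chartK ch' Oy (left_field_tangent Gy (Le i)).
  by rewrite chiK.
Qed.

Variables (nabla : ('rV[R]_N -> 'rV[R]_N) -> ('rV[R]_N -> 'rV[R]_N) -> ('rV[R]_N -> 'rV[R]_N)).
Variable met : 'rV[R]_N -> 'rV[R]_N -> 'rV[R]_N -> R.
Hypothesis hn : levi_civita G met nabla.
Variables (psi : 'rV[R]_N -> R) (gs : 'rV[R]_N).
Hypothesis hpsi : smooth_on G psi.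
Hypothesis Gs : lg_set G gs.
Hypothesis psi_min : \forall g \near within G (nbhs gs), psi gs <= psi g.
Hypothesis psi_hess : hessian_posdef_at G nabla psi gs.

(* [gr i] represents the derivative of psi along the left-invariant field of [e i].  The matrix H is
   symmetric because the connection is torsion free and dpsi vanishes at gs. *)
Lemma local_model : exists O W phi chi (X : 'I_n -> 'rV[R]_n -> 'rV[R]_n) (p : 'rV[R]_n -> R)
    (gr : 'I_n -> 'rV[R]_n -> R) (H : 'M[R]_n),
  [/\ [/\ chart G O W phi chi, O gs, chi gs = 0, W 0 & phi 0 = gs],
   [/\ nice p 0, p 0 = 0, forall x, 'd p 0 x = 0 & \forall y \near (0 : 'rV[R]_n), psi (phi y) = psi gs + p y],
    forall i, [/\ nice (X i) 0, X i 0 = delta_mx 0 i & 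
      \forall y \near (0 : 'rV[R]_n), 'd phi y (X i y) = left_field G (e i) (phi y)],
    forall i, [/\ nice (gr i) 0, gr i 0 = 0, forall x, 'd (gr i) 0 x = (x *m H) 0 i & 
      \forall y \near (0 : 'rV[R]_n), 'd p y (X i y) = gr i y] &
    H^T = H /\ forall x : 'rV[R]_n, x != 0 -> 0 < dot (x *m H) x].
Proof.
have [ O [W [phi [chi [X [ch Os chis HX [W0 phi0]]]]]]] := normal_chart Gs.
have [OD [D [oD ODs sD lD DE]]] := left_field_ext Gs.
have [OP [P [oP OPs sP PE]]] := hpsi Gs.
have [Le _ _] := he; have HS := @lg_submanifold _ _ _ G.
case: (ch) => oO oW sphi schi [HW HO].
have nphi : nice phi 0 by exact: smooth_row_nice W0 sphi.
have dP z : OP z -> differentiable P z by move=> Oz; exact: smooth_differentiable Oz.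
have nearP z : OP z -> \forall y \near z, lg_set G y -> P y = psi y.
  by move=> Oz; apply: filterS (open_near oP Oz) => y; exact: PE.
have dpsiE z v : OP z -> tangent_space G z v -> dmap G psi z v = 'd P z v.
  by move=> Oz tv; apply: (dmapE tv) => //; [exact: dP|exact: nearP].
(* Fermat's rule along a curve in G through the minimum. *)
have crit v : tangent_space G gs v -> 'd P gs v = 0.
  move=> /tangent_curve[c [c0 dc Gc]].
  have dPc : differentiable P (c 0) by rewrite c0; exact: dP.
  have := isd_comp dPc dc; rewrite c0 => d1.
  apply: (local_min_derive d1).
  have cc : {for (0 : R), continuous c} by exact: isd_continuous dc.
  have n1 := continuous_near (P := fun y => lg_set G y -> P y = psi y) cc c0 (nearP _ OPs).
  have n2 := continuous_near (P := fun y => lg_set G y -> psi gs <= psi y) cc c0 psi_min.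
  rewrite c0 PE//.
  by near=> t; rewrite (near n1 t)// ?(near n2 t)//; near: t; exact: Gc.
(* An ambient extension of the derivative of psi along the i-th frame field. *)
pose Ga i z := \sum_j D (e i) z 0 j *: 'D_(delta_mx 0 j) P z.
have nGa i : nice (Ga i) gs.
  apply: nice_sum => j; apply: nice_mul.
    by apply: nice_coord; exact: smooth_row_nice ODs (sD _).
  exact: smooth_row_nice OPs (smooth_derive _ sP).
have GaE i z : OP z -> OD z -> lg_set G z -> Ga i z = 'd P z (left_field G (e i) z).
  by move=> Pz Dz Gz; rewrite DE// diff_rowE//; exact: dP.
have dGaE (w v : 'rV[R]_n) : deriv_along G (left_field G (in_basis e v)) (deriv_along G (left_field G (in_basis e w)) psi) gs =
    \sum_i \sum_j w 0 i * v 0 j * 'd (Ga i) gs (left_field G (e j) gs).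
  have Lw := in_basis_lie w; have Lv := in_basis_lie v.
  have nS : nice (fun z => \sum_i w 0 i *: Ga i z) gs.
    by apply: nice_sum => i; apply: nice_mul => //; exact: nice_cst.
  rewrite /deriv_along.
  rewrite (dmapE (F := fun z => \sum_i w 0 i *: Ga i z) (left_field_tangent Gs Lv)).
  - have d1 := isd_sum (index_enum 'I_n) (fun i (_ : predT i) => isd_scale (w 0 i) 
      (isd_diff (left_field G (in_basis e v) gs) (nice_differentiable (nGa i)))).
    rewrite (isd_diffE (nice_differentiable nS) d1); apply: eq_bigr => i _.
    rewrite left_field_in_basis// linear_sum scaler_sumr; apply: eq_bigr => j _.
    by rewrite linearZ /GRing.scale/= mulrA.
  - exact: nice_differentiable nS.
  - apply: filterS2 (open_near oP OPs) (open_near oD ODs) => z Pz Dz Gz.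
    rewrite dpsiE//; last exact: left_field_tangent.
    rewrite left_field_in_basis// linear_sum; apply: eq_bigr => i _.
    by rewrite GaE// linearZ.
(* Iterated frame derivatives of psi. At the critical point the connection term of the Hessian
   vanishes, so these are its entries. *)
pose H : 'M[R]_n := \matrix_(j, i) 'd (Ga i) gs (left_field G (e j) gs).
have eE i : in_basis e (delta_mx 0 i) = e i.
  rewrite /in_basis (bigD1 i)//= mxE !eqxx scale1r big1 ?addr0// => j ji.
  by rewrite mxE eqxx (negbTE ji) scale0r.
have HE i j : H j i = deriv_along G (left_field G (e j)) (deriv_along G (left_field G (e i)) psi) gs.
  have := dGaE (delta_mx 0 i) (delta_mx 0 j); rewrite !eE => ->.
  by rewrite sum_delta_mx2 mxE.
have hc := lc_connection hn.
pose p y := P (phi y) - psi gs.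
pose gr i y := Ga i (phi y).
have np : nice p 0.
  apply: nice_sub; last exact: nice_cst.
  by apply: (nice_comp nphi); rewrite phi0; exact: smooth_row_nice OPs sP.
have dphi0 : differentiable phi 0 by exact: nice_differentiable.
have dp y v : OP (phi y) -> differentiable phi y -> is_derive y v p ('d P (phi y) ('d phi y v)).
  move=> Oy dy; have := isd_sub (isd_comp (dP _ Oy) (isd_diff v dy)) (isd_cst (psi gs) y v).
  by rewrite subr0.
have ngr i : nice (gr i) 0 by apply: (nice_comp nphi); rewrite phi0.
have near_good : \forall y \near (0 : 'rV[R]_n), [/\ W y, OD (phi y) & OP (phi y)].
  have c1 := continuous_near (nice_continuous nphi) phi0 (open_near oD ODs).
  have c2 := continuous_near (nice_continuous nphi) phi0 (open_near oP OPs).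
  by apply: filterS3 (open_near oW W0) c1 c2 => y.
exists O, W, phi, chi, X, p, gr, H; split => //.
- split => //.
  + by rewrite /p phi0 PE// subrr.
  + move=> x; have OP0 : OP (phi 0) by rewrite phi0.
    rewrite (isd_diffE (nice_differentiable np) (dp 0 x OP0 dphi0)) phi0 crit//.
    by rewrite -phi0; exact: (chart_line_tangent ch).
  + apply: filterS near_good => y [Wy _ Py]; have [_ Gy _] := HW _ Wy.
    by rewrite /p addrC subrK PE.
- move=> i; split => //.
  + by rewrite /gr phi0 GaE// crit//; exact: left_field_tangent.
  + move=> x; have dGa : differentiable (Ga i) (phi 0) by rewrite phi0; exact: nice_differentiable.
    rewrite (isd_diffE (nice_differentiable (ngr i)) (isd_comp dGa (isd_diff x dphi0))) phi0.
    rewrite {1}[x]row_basisE linear_sum linear_sum mxE; apply: eq_bigr => j _.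
    have EX : 'd phi 0 (delta_mx 0 j) = left_field G (e j) gs.
      by have [_ X0 /nbhs_singleton] := HX j; rewrite X0 phi0.
    by rewrite linearZ EX linearZ mxE.
  + have [_ _ Xn] := HX i.
    apply: filterS2 near_good Xn => y [Wy Dy Py] XE; have [_ Gy _] := HW _ Wy.
    have dy : differentiable phi y by exact: smooth_differentiable Wy.
    have dpy : differentiable p y.
      by apply: differentiableB => //; apply: (differentiable_comp dy); exact: dP.
    by rewrite (isd_diffE dpy (dp y (X i y) Py dy)) XE /gr GaE.
- split.
    apply/matrixP => i j; rewrite mxE !HE.
    have vi := left_field_vector_field (Le i); have vj := left_field_vector_field (Le j).
    have := lc_torsion_free hn vi vj hpsi Gs; rewrite {1}/deriv_along dpsiE//.
      rewrite crit; first by move/esym/eqP; rewrite subr_eq0 => /eqP ->.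
      have := tangent_lin HS (-1) ((conn_field hc vj vi).2 _ Gs) ((conn_field hc vi vj).2 _ Gs).
      by rewrite scaleN1r addrC.
    have := tangent_lin HS (-1) ((conn_field hc vj vi).2 _ Gs) ((conn_field hc vi vj).2 _ Gs).
    by rewrite scaleN1r addrC.
  move=> x x0; have Lx := in_basis_lie x; have vx := left_field_vector_field Lx.
  have xn0 : left_field G (in_basis e x) gs != 0.
    apply: contra x0 => /eqP x0; apply/eqP; apply: in_basis_inj; exact: (left_field_inj Gs Lx).
  have := psi_hess vx xn0; rewrite /hessian [X in _ - X]/deriv_along.
  have tn := (conn_field hc vx vx).2 _ Gs.
  rewrite dpsiE// crit// subr0 dGaE /dot.
  have -> // : \sum_i (x *m H) 0 i * x 0 i = \sum_i \sum_j x 0 i * x 0 j * 'd (Ga i) gs (left_field G (e j) gs).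
  apply: eq_bigr => i _; rewrite mxE mulr_suml; apply: eq_bigr => j _.
  by rewrite mxE mulrC mulrA.
Unshelve. all: by end_near. Qed.
End basis.

(** * Caratheodory solutions *)

Section almost_everywhere.
Context {R : realType}.
Local Notation mu := (@lebesgue_measure R).
Lemma ae_mono (P Q : R -> Prop) : (forall t, P t -> Q t) -> {ae mu, forall t, P t} -> {ae mu, forall t, Q t}.
Proof. by move=> PQ; apply: negligibleS => t /= nQ /PQ. Qed.
Lemma ae_mono2 (P Q S : R -> Prop) : (forall t, P t -> Q t -> S t) -> {ae mu, forall t, P t} ->
  {ae mu, forall t, Q t} -> {ae mu, forall t, S t}.
Proof.
move=> PQ hP hQ; apply: negligibleS (negligibleU hP hQ) => t /= nS.
by apply/not_andP => -[Pt Qt]; apply: nS; exact: PQ.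
Qed.
Lemma ae_all (P : R -> Prop) : (forall t, P t) -> {ae mu, forall t, P t}.
Proof. by move=> H; apply: negligibleS (negligible_set0 mu) => t; exact. Qed.
End almost_everywhere.

Section absolute_continuity.
Context {R : realType} {V : normedModType R}.
Implicit Types (x y : R -> V) (a b c : R).

Lemma ac_sub x y a b : abs_continuous a b x -> abs_continuous a b y ->
  abs_continuous a b (fun t => x t - y t).
Proof.
move=> hx hy e e0; have e2 : 0 < e / 2 by rewrite divr_gt0.
have [d1 d10 H1] := hx _ e2; have [d2 d20 H2] := hy _ e2.
exists (Num.min d1 d2); first by rewrite lt_min d10.
move=> m l r lr tI; rewrite lt_min => /andP[s1 s2].
have := ltrD (H1 m l r lr tI s1) (H2 m l r lr tI s2); rewrite -splitr -big_split/=.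
apply: le_lt_trans; apply: ler_sum => k _.
by rewrite opprD addrACA -opprD; exact: ler_normB.
Qed.

Lemma lipschitz_ac x a b L : (forall s t, a <= s -> s <= t -> t <= b -> `|x t - x s| <= L * (t - s)) ->
  abs_continuous a b x.
Proof.
move=> H e e0; have L1 : 0 < `|L| + 1 by rewrite ltr_wpDl.
exists (e / (`|L| + 1)); first by rewrite divr_gt0.
move=> m l r lr _; rewrite ltr_pdivlMr// => hs; apply: le_lt_trans hs.
rewrite mulr_suml; apply: ler_sum => k _; have [h1 h2 h3] := lr k.
apply: le_trans (H _ _ h1 h2 h3) _; rewrite mulrC ler_wpM2l ?subr_ge0//.
by rewrite (le_trans (ler_norm L))// lerDl.
Qed.

Lemma ac_congr x y a b : (forall t, a <= t <= b -> x t = y t) -> abs_continuous a b x -> abs_continuous a b y.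
Proof.
move=> xy h e e0; have [d d0 H] := h e e0; exists d => // m l r lr tI hs.
have := H m l r lr tI hs; congr (_ < _); apply: eq_bigr => k _.
have [h1 h2 h3] := lr k.
by rewrite !xy// ?h1 ?h3 ?(le_trans h1) ?(le_trans h2).
Qed.

(** Each interval is cut at [c]; a piece that falls on the wrong side degenerates to a point and
    contributes nothing. *)
Lemma ac_glue x a b c : a <= c -> c <= b -> abs_continuous a c x -> abs_continuous c b x -> abs_continuous a b x.
Proof.
move=> ac cb hx hy e e0; have e2 : 0 < e / 2 by rewrite divr_gt0.
have [d1 d10 H1] := hx _ e2; have [d2 d20 H2] := hy _ e2.
exists (Num.min d1 d2); first by rewrite lt_min d10.
move=> m l r lr tI; rewrite lt_min => /andP[s1 s2].
have T (F : 'I_m -> set R) : (forall k, F k `<=` `]l k, r k[%classic) -> trivIset setT F.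
  move=> FS i j _ _ [z [zi zj]]; apply: (tI i j) => //; exists z; split; exact: FS.
pose l1 k := Num.min (l k) c; pose r1 k := Num.min (r k) c.
pose l2 k := Num.max (l k) c; pose r2 k := Num.max (r k) c.
have A1 k : [/\ a <= l1 k, l1 k <= r1 k & r1 k <= c].
  have [h1 h2 h3] := lr k; rewrite /l1 /r1; split; last by rewrite ge_min lexx orbT.
    by rewrite le_min h1.
  by rewrite le_min !ge_min h2 lexx orbT.
have A2 k : [/\ c <= l2 k, l2 k <= r2 k & r2 k <= b].
  have [h1 h2 h3] := lr k; rewrite /l2 /r2; split; first by rewrite le_max lexx orbT.
    by rewrite ge_max !le_max h2 lexx orbT.
  by rewrite ge_max h3.
have B1 : trivIset setT (fun k => `]l1 k, r1 k[%classic).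
  apply: T => k z /=; rewrite !in_itv/= /l1 /r1 lt_min gt_min => /andP[/orP[->|h1] /andP[-> h2]] //.
  by have := lt_trans h1 h2; rewrite ltxx.
have B2 : trivIset setT (fun k => `]l2 k, r2 k[%classic).
  apply: T => k z /=; rewrite !in_itv/= /l2 /r2 gt_max lt_max => /andP[/andP[-> h2] /orP[->|h1]] //.
  by have := lt_trans h1 h2; rewrite ltxx.
have C1 : \sum_k (r1 k - l1 k) < d1.
  apply: le_lt_trans s1; apply: ler_sum => k _; have [h1 h2 h3] := lr k.
  by rewrite /l1 /r1; case: (leP (r k) c) => h4; case: (leP (l k) c) => h5; lra.
have C2 : \sum_k (r2 k - l2 k) < d2.
  apply: le_lt_trans s2; apply: ler_sum => k _; have [h1 h2 h3] := lr k.
  by rewrite /l2 /r2; case: (leP (r k) c) => h4; case: (leP (l k) c) => h5; lra.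
have := ltrD (H1 m l1 r1 A1 B1 C1) (H2 m l2 r2 A2 B2 C2); rewrite -splitr -big_split/=.
apply: le_lt_trans; apply: ler_sum => k _; have [h1 h2 h3] := lr k.
rewrite /l1 /r1 /l2 /r2; case: (leP (r k) c) => h4; case: (leP (l k) c) => h5.
- by rewrite lerDl.
- by have := lt_le_trans h5 (le_trans h2 h4); rewrite ltxx.
- by rewrite -[x (r k) - x (l k)](subrKA (x c)) addrC; exact: ler_normD.
- by rewrite lerDr.
Qed.

Lemma ac_continuous x a b t : a < t -> t < b -> abs_continuous a b x -> {for t, continuous x}.
Proof.
move=> at_ tb h; apply/cvgrPdist_lt => e e0; have [d d0 H] := h e e0.
pose d' := Num.min d (Num.min (t - a) (b - t)).
have d'0 : 0 < d' by rewrite !lt_min d0 !subr_gt0 at_.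
apply: (near_normP t _).2; exists d' => // s; rewrite !lt_min => /and3P[s1 s2 s3].
have T (u v : R) : trivIset [set: 'I_1] (fun=> `]u, v[%classic) by move=> i j _ _ _; rewrite !ord1.
have [st|ts] := leP s t.
  have := H 1%N (fun=> s) (fun=> t); rewrite !big_ord1; apply => //.
  - move=> _; split => //; last exact: ltW.
    by move: s2; rewrite ltr_norml => /andP[? _]; lra.
  - by rewrite distrC ger0_norm ?subr_ge0// in s1.
rewrite distrC; have := H 1%N (fun=> t) (fun=> s); rewrite !big_ord1; apply => //.
- move=> _; split => //; [exact: ltW|exact: ltW|].
  by move: s3; rewrite ltr_norml => /andP[_ ?]; lra.
- by rewrite gtr0_norm ?subr_gt0// in s1.
Qed.
End absolute_continuity.

Section solutions.
Context {R : realType} {K : nat}.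
Local Notation V := 'rV[R]_K.
Local Notation mu := (@lebesgue_measure R).
Variables (M : set V) (f : R -> V -> V).
Hypothesis flip : forall x0, M x0 -> ulip M x0 f.
Variables (t0 : R) (x0 : V).

Lemma solution_continuous J x t : solution M f t0 x0 J x -> J t -> {for t, continuous x}.
Proof.
move=> [[oJ iJ Jt0] _ _ acJ _] Jt; have [e e0 He] := open_norm oJ Jt.
have h1 : t - e / 2 < t + e / 2 by lra.
apply: (@ac_continuous _ _ _ (t - e / 2) (t + e / 2)); [lra|lra|].
apply: acJ; first exact: ltW.
by move=> s /=; rewrite in_itv/= => /andP[? ?]; apply: He; rewrite ltr_norml; apply/andP; split; lra.
Qed.

(** On a window of radius [d] around [t] the difference of the two solutions has derivative at most
    [L] times its supremum [m] almost everywhere. With [L * d <= 1/2] this gives [m <= m / 2]. The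
    Lipschitz bound is used only along M, where both solutions stay. *)
Lemma solution_local_unique J x J' y t : solution M f t0 x0 J x -> solution M f t0 x0 J' y ->
  J t -> J' t -> x t = y t -> exists2 d, 0 < d & forall s, `|s - t| < d -> x s = y s.
Proof.
move=> sx sy Jt J't xy.
have cx := solution_continuous sx Jt; have cy := solution_continuous sy J't.
case: sx => -[oJ iJ _] Mx _ acx dx; case: sy => -[oJ' iJ' _] My _ acy dy.
have [e [L [e0 L0 _ HL]]] := flip (Mx _ Jt).
have [d1 d10 D1] := continuous_norm cx e0; have [d2 d20 D2] := continuous_norm cy e0.
have [d3 d30 D3] := open_norm oJ Jt; have [d4 d40 D4] := open_norm oJ' J't.
pose dm := Num.min (Num.min d1 d2) (Num.min d3 d4).
have dm0 : 0 < dm by rewrite !lt_min d10 d20 d30 d40.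
pose d := Num.min (dm / 2) (2 * (L + 1))^-1.
have L1 : 0 < 2 * (L + 1) by lra.
have d0 : 0 < d by rewrite lt_min invr_gt0 L1 divr_gt0.
have ddm : d < dm by rewrite gt_min ltr_pdivrMr// mulr_natr mulr2n ltrDr dm0.
have Ld : L * d <= 2^-1.
  have : d * (2 * (L + 1)) <= 1 by rewrite -ler_pdivlMr// mul1r ge_min lexx orbT.
  by move: d0; lra.
have nr s : `|s - t| <= d -> [/\ J s, J' s, `|x s - x t| < e & `|y s - x t| < e].
  move=> /le_lt_trans/(_ ddm); rewrite !lt_min => /andP[/andP[h1 h2] /andP[h3 h4]].
  by split; [exact: D3|exact: D4|exact: D1|rewrite xy; exact: D2].
pose w s := x s - y s.
pose A := [set z | exists2 s, `|s - t| <= d & z = `|w s|].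
have A0 : A 0 by exists t; rewrite ?subrr ?normr0 ?(ltW d0)// /w xy subrr normr0.
have hA : has_sup A.
  split; first by exists 0.
  exists (e + e) => z [s /nr[_ _ h1 h2] ->].
  rewrite /w -[x s](subrK (x t)) -addrA -(opprB (y s)); apply: le_trans (ler_normB _ _) _.
  by rewrite lerD// ltW.
pose m := sup A.
have m0 : 0 <= m by apply: sup_upper_bound.
have wm s : `|s - t| <= d -> `|w s| <= m by move=> sd; apply: sup_upper_bound => //; exists s.
have wt : w t = 0 by rewrite /w xy subrr.
have key a b : a <= b -> `|a - t| <= d -> `|b - t| <= d -> `|w b - w a| <= L * m * (b - a).
  move=> ab ad bd.
  have Iab s : a <= s <= b -> `|s - t| <= d.
    move: ad bd; rewrite !ler_norml => /andP[? ?] /andP[? ?] /andP[? ?]; apply/andP; split; lra.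
  apply: ac_lipschitz => //; first exact: mulr_ge0.
    by apply: ac_sub; [apply: acx|apply: acy] => // s /=; rewrite in_itv/= => /Iab/nr[].
  apply: ae_mono2 dx dy => s dxs dys /Iab sd; have [Js J's xe ye] := nr _ sd.
  exists (f s (x s) - f s (y s)); first exact: isd_sub (dxs Js) (dys J's).
  apply: le_trans (HL s _ _ (Mx _ Js) (My _ J's) xe ye) _.
  by rewrite ler_wpM2l//; exact: wm.
have half s : `|s - t| <= d -> `|w s| <= m / 2.
  move=> sd; have td : `|t - t| <= d by rewrite subrr normr0 ltW.
  have : `|w s| <= L * m * `|s - t|.
    have [st|ts] := leP s t.
      by have := key _ _ st sd td; rewrite wt sub0r normrN [`|s - t|]distrC [`|t - s|]ger0_norm ?subr_ge0.
    by have := key _ _ (ltW ts) td sd; rewrite wt subr0 [`|s - t|]gtr0_norm ?subr_gt0.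
  move/le_trans; apply; rewrite mulrAC mulrC ler_wpM2l//; apply: le_trans Ld.
  exact: ler_wpM2l.
have m_le : m <= m / 2.
  by apply: ge_sup; [exists 0|move=> z [s sd ->]; exact: half].
have mz : m <= 0 by lra.
exists d => // s /ltW sd; apply/eqP; rewrite -subr_eq0 -normr_le0.
by apply: le_trans mz; exact: wm.
Qed.

Lemma solution_unique J x J' y t : solution M f t0 x0 J x -> solution M f t0 x0 J' y ->
  J t -> J' t -> x t = y t.
Proof.
move=> sx sy Jt J't; have [[_ iJ Jt0] _ xt0 _ _] := sx; have [[_ iJ' J't0] _ yt0 _ _] := sy.
(* Either the solutions agree at [s], hence around it, or they differ throughout a neighbourhood and
   the premise [x r = y r] is impossible there. *)
have step s : J s -> J' s -> exists2 d, 0 < d & forall r r', `|r - s| < d -> `|r' - s| < d -> 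
    x r = y r -> x r' = y r'.
  move=> Js J's; have [E|E] := eqVneq (x s) (y s).
    have [d d0 H] := solution_local_unique sx sy Js J's E.
    by exists d => // r r' _ rs _; exact: H.
  have e0 : 0 < `|x s - y s| / 2 by rewrite divr_gt0 ?normr_gt0 ?subr_eq0.
  have [d1 d10 H1] := continuous_norm (solution_continuous sx Js) e0.
  have [d2 d20 H2] := continuous_norm (solution_continuous sy J's) e0.
  exists (Num.min d1 d2); first by rewrite lt_min d10.
  move=> r r'; rewrite lt_min => /andP[r1 r2] _ Er; exfalso.
  have := ltrD (H1 _ r1) (H2 _ r2); rewrite -splitr -Er distrC.
  by move=> /(le_lt_trans (ler_distD (x r) (x s) (y s))); rewrite ltxx.
have [tt|tt] := leP t0 t.
  apply: (itv_induction (P := fun s => x s = y s) tt); first by rewrite xt0.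
  move=> s ts; have [d d0 H] := step s (iJ _ _ Jt0 Jt _ ts) (iJ' _ _ J't0 J't _ ts).
  exists d => // r r' _ rs sr' _ dr dr'; apply: H; rewrite ltr_norml; apply/andP; split; lra.
(* [itv_induction] moves forward only, so earlier times are reached by reversing time. *)
have mm : - t0 <= - t by rewrite lerN2 ltW.
have := itv_induction (P := fun s => x (- s) = y (- s)) mm; rewrite !opprK; apply; first by rewrite xt0.
move=> s /andP[s1 s2]; have ts : t <= - s <= t0 by apply/andP; split; lra.
have [d d0 H] := step _ (iJ _ _ Jt Jt0 _ ts) (iJ' _ _ J't J't0 _ ts).
exists d => // r r' _ rs sr' _ dr dr'; apply: H; rewrite ltr_norml; apply/andP; split; lra.
Qed.

(** By uniqueness all solutions with the given initial value glue to one on the union of their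
    intervals. It extends [y0], so it is enough to establish [P] for extensions of a single known
    solution. *)
Lemma maximal_solution_exists J0 y0 (P : set R -> (R -> V) -> Prop) :
  solution M f t0 x0 J0 y0 ->
  (forall J x, (forall t, J0 t -> J t /\ x t = y0 t) -> P J x) ->
  the_maximal_solution M f t0 x0 P.
Proof.
move=> s0 HP.
pose Jm := [set t | exists J y, solution M f t0 x0 J y /\ J t].
pose xm t := xget 0 [set v | exists J y, [/\ solution M f t0 x0 J y, J t & v = y t]].
have xmE J y t : solution M f t0 x0 J y -> J t -> xm t = y t.
  move=> sy Jt; apply: xget_unique; first by exists J, y.
  by move=> v [J' [y' [sy' J't ->]]]; exact: solution_unique sy' sy J't Jt.
have JJm J y t : solution M f t0 x0 J y -> J t -> Jm t by move=> sy Jt; exists J, y.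
have Jmt0 : Jm t0 by case: (s0) => -[_ _ ?] _ _ _ _; exact: JJm s0 _.
(* One solution reaching [s] is selected for each [s]; outside [Jm] the value is a dummy. *)
have sel : forall s, exists Jy : set R * (R -> V), Jm s -> solution M f t0 x0 Jy.1 Jy.2 /\ Jy.1 s.
  move=> s; have [[J [y [sy Js]]]|nJ] := pselect (Jm s); first by exists (J, y).
  by exists (set0, fun=> 0).
have [F HF] := choice sel.
have Fint s t : Jm s -> (t0 <= t <= s \/ s <= t <= t0) -> (F s).1 t.
  move=> /HF[[[_ iJ Jt0] _ _ _ _] Js] [ts|ts]; first exact: (iJ _ _ Jt0 Js).
  exact: (iJ _ _ Js Jt0).
have sm : solution M f t0 x0 Jm xm.
  split.
  - split => //.
      rewrite openE => t [J [y [sy Jt]]]; have [[oJ _ _] _ _ _ _] := sy.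
      by apply: filterS (open_near oJ Jt) => s Js; exact: JJm sy Js.
    move=> a b Ja Jb c /andP[ac cb].
    have [ct|tc] := leP c t0.
      by apply: (JJm _ _ _ (HF a Ja).1); apply: Fint => //; right; rewrite ac.
    by apply: (JJm _ _ _ (HF b Jb).1); apply: Fint => //; left; rewrite cb ltW.
  - by move=> t [J [y [sy Jt]]]; rewrite (xmE _ _ _ sy Jt); case: sy => _ My _ _ _; exact: My.
  - by have [[_ _ Jt0] _ E _ _] := s0; rewrite (xmE _ _ _ s0 Jt0).
  - move=> a b ab abJ.
    have Ja : Jm a by apply: abJ; rewrite /= in_itv/= lexx.
    have Jb : Jm b by apply: abJ; rewrite /= in_itv/= lexx ab.
    have acF s c d : Jm s -> c <= d -> (forall t, c <= t <= d -> (F s).1 t) -> abs_continuous c d xm.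
      move=> Js cd H; have [sF _] := HF s Js.
      apply: (ac_congr (x := (F s).2)); first by move=> t tcd; rewrite (xmE _ _ _ sF)//; exact: H.
      by case: sF => _ _ _ acF _; apply: acF => // t /=; rewrite in_itv/=; exact: H.
    have [bt|tb] := leP b t0.
      by apply: (acF a) => // t /andP[h1 h2]; apply: Fint => //; right; rewrite h1 (le_trans h2).
    have [ta|at_] := leP t0 a.
      by apply: (acF b) => // t /andP[h1 h2]; apply: Fint => //; left; rewrite h2 (le_trans ta).
    apply: (@ac_glue _ _ _ _ _ t0); [exact: ltW|exact: ltW| |].
      by apply: (acF a); rewrite ?(ltW at_)// => t h; apply: Fint => //; right.
    by apply: (acF b); rewrite ?(ltW tb)// => t h; apply: Fint => //; left.
  (* Infinitely many solutions may enter the union, and their null sets must stay countable in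
     number. Only the solutions selected at rational times are used: every time in [Jm] lies between
     [t0] and such a rational. *)
  - have : {ae mu, forall t, forall k, forall q : rat, pickle q = k -> Jm (ratr q) -> (F (ratr q)).1 t ->
        is_derive t 1 (F (ratr q)).2 (f t ((F (ratr q)).2 t))}.
      apply: ae_lebesgue_nat => k.
      have [[q [qk Jq]]|nq] := pselect (exists q : rat, pickle q = k /\ Jm (ratr q)).
        have [[_ _ _ _ dq] _] := HF _ Jq.
        apply: ae_mono dq => t dt q' q'k _ Ft.
        have E : q' = q by apply: (pcan_inj pickleK); rewrite q'k.
        by rewrite E in Ft *; exact: dt.
      by apply: ae_all => t q qk Jq; exfalso; apply: nq; exists q.
    apply: ae_mono => t H Jt.
    have [J [y [sy Jyt]]] := Jt; have [[oJ _ _] _ _ _ _] := sy.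
    have [e e0 He] := open_norm oJ Jyt.
    have [q Jq tq] : exists2 q : rat, Jm (ratr q) & (t0 <= t <= ratr q \/ ratr q <= t <= t0).
      have [tt|tt] := leP t0 t.
        have [|q] := @rat_in_itvoo R t (t + e); first by rewrite ltrDl.
        rewrite in_itv/= => /andP[q1 q2]; exists q; last by left; rewrite ltW.
        by apply: (JJm _ _ _ sy); apply: He; rewrite ltr_norml; apply/andP; split; lra.
      have [|q] := @rat_in_itvoo R (t - e) t; first by rewrite ltrBlDr ltrDl.
      rewrite in_itv/= => /andP[q1 q2]; exists q; last by right; rewrite (ltW q2) ltW.
      by apply: (JJm _ _ _ sy); apply: He; rewrite ltr_norml; apply/andP; split; lra.
    have Ft := Fint _ _ Jq tq; have [sF _] := HF _ Jq.
    have := H (pickle q) q erefl Jq Ft; rewrite -(xmE _ _ _ sF Ft).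
    have [[oF _ _] _ _ _ _] := sF.
    apply: isd_near; apply: filterS (open_near oF Ft) => s Fs.
    by rewrite (xmE _ _ _ sF Fs).
exists Jm, xm; split.
- split => // J' y sy JmJ' _; apply/seteqP; split => // t J't; exact: JJm sy J't.
- move=> J' y [sy maxy].
  have J'm : J' `<=` Jm by move=> t; exact: JJm sy.
  have E : Jm = J' by apply: (maxy _ _ sm) => // t J't; rewrite (xmE _ _ _ sy).
  by split => // t; rewrite E => J't; rewrite (xmE _ _ _ sy).
- apply: HP => t J0t; split; [exact: JJm s0 J0t|exact: xmE s0 J0t].
Qed.
End solutions.

(** * The system in a chart *)

Section ulip_rows.
Context {R : realType} {T : Type} {V : normedModType R}.
Lemma ulip_coord m (S : set V) x0 (f : T -> V -> 'rV[R]_m) j : ulip S x0 f -> ulip S x0 (fun t x => f t x 0 j).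
Proof.
move=> [e [L [e0 L0 H1 H2]]]; exists e, L; split => // [t x Sx xe|t x y Sx Sy xe ye].
  by apply: le_trans (coord_le_norm _ _) _; exact: H1.
have -> : f t x 0 j - f t y 0 j = (f t x - f t y) 0 j by rewrite !mxE.
by apply: le_trans (coord_le_norm _ _) _; exact: H2.
Qed.
Lemma ulip_row m (S : set V) x0 (f : T -> V -> 'rV[R]_m) : (forall j, ulip S x0 (fun t x => f t x 0 j)) -> ulip S x0 f.
Proof.
move=> H; have := ulip_sum (index_enum 'I_m) predT (fun j => ulip_scale (H j) (ulip_cst S x0 (delta_mx 0 j : 'rV[R]_m))).
by apply: ulip_congr => t x _; rewrite -row_basisE.
Qed.
Lemma ulip_mulmx m k (S : set V) x0 (f : T -> V -> 'rV[R]_m) (A : 'M[R]_(m, k)) : ulip S x0 f ->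
  ulip S x0 (fun t x => f t x *m A).
Proof.
move=> uf; apply: ulip_row => j.
have := ulip_sum (index_enum 'I_m) predT (fun i => ulip_mul (ulip_coord i uf) (ulip_cst S x0 (A i j))).
by apply: ulip_congr => t x _; rewrite mxE.
Qed.
End ulip_rows.

Lemma nice_mulmx (R : realType) (V : normedModType R) m k (f : V -> 'rV[R]_m) (A : 'M[R]_(m, k)) x0 : 
  nice f x0 -> nice (fun x => f x *m A) x0.
Proof.
move=> nf; apply: nice_row => j.
have := nice_sum (index_enum 'I_m) predT (fun i => nice_mul (nice_coord i nf) (nice_cst (A i j) x0)).
by apply: nice_near; apply: near_all => x; rewrite mxE.
Qed.

Lemma isd_mulmx (R : realType) (V : normedModType R) m k (f : V -> 'rV[R]_m) (A : 'M[R]_(m, k)) x v df :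
  is_derive x v f df -> is_derive x v (fun y => f y *m A) (df *m A).
Proof.
move=> H; have := isd_comp (f := fun y => y *m A + 0) (affine_diff 0 (mulmxr_linear A) (@mulmxr_continuous _ _ _ A) (f x)).1 H.
rewrite (affine_diff 0 (mulmxr_linear A) (@mulmxr_continuous _ _ _ A) (f x)).2.
by apply: isd_near; apply: near_all => y; rewrite addr0.
Qed.

Section state_vectors.
Context {R : realType} {N n : nat}.
Local Notation K := (N + N + (n + 1))%N.

Lemma st_gE (g v : 'rV[R]_N) (w : 'rV[R]_n) eta : st_g (st g v w eta) = g.
Proof. by rewrite /st_g /st !row_mxKl. Qed.
Lemma st_vE (g v : 'rV[R]_N) (w : 'rV[R]_n) eta : st_v (st g v w eta) = v.
Proof. by rewrite /st_v /st row_mxKl row_mxKr. Qed.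
Lemma st_wE (g v : 'rV[R]_N) (w : 'rV[R]_n) eta : st_w (st g v w eta) = w.
Proof. by rewrite /st_w /st row_mxKr row_mxKl. Qed.
Lemma st_etaE (g v : 'rV[R]_N) (w : 'rV[R]_n) eta : st_eta (st g v w eta) = eta.
Proof. by rewrite /st_eta /st !row_mxKr mxE eqxx mulr1n. Qed.
Definition stE := (st_gE, st_vE, st_wE, st_etaE).

Lemma stK (x : 'rV[R]_K) : st (st_g x) (st_v x) (st_w x) (st_eta x) = x.
Proof.
rewrite /st /st_g /st_v /st_w /st_eta hsubmxK.
have -> : (rsubmx (rsubmx x) 0 0)%:M = rsubmx (rsubmx x) :> 'M[R]_1 by rewrite -mx11_scalar.
by rewrite !hsubmxK.
Qed.

Lemma st_coord_ind (Q : 'I_K -> Prop) : (forall j, Q (lshift (n + 1) (lshift N j))) ->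
  (forall j, Q (lshift (n + 1) (rshift N j))) -> (forall j, Q (rshift (N + N) (lshift 1 j))) ->
  Q (rshift (N + N) (rshift n ord0)) -> forall k, Q k.
Proof.
move=> h1 h2 h3 h4 k; case: (split_ordP k) => [i ->|i ->]; case: (split_ordP i) => [j ->|j ->] //.
by rewrite (ord1 j).
Qed.

Lemma st_c1 (g v : 'rV[R]_N) (w : 'rV[R]_n) eta j : st g v w eta 0 (lshift (n + 1) (lshift N j)) = g 0 j.
Proof. by rewrite /st !row_mxEl. Qed.
Lemma st_c2 (g v : 'rV[R]_N) (w : 'rV[R]_n) eta j : st g v w eta 0 (lshift (n + 1) (rshift N j)) = v 0 j.
Proof. by rewrite /st row_mxEl row_mxEr. Qed.
Lemma st_c3 (g v : 'rV[R]_N) (w : 'rV[R]_n) eta j : st g v w eta 0 (rshift (N + N) (lshift 1 j)) = w 0 j.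
Proof. by rewrite /st row_mxEr row_mxEl. Qed.
Lemma st_c4 (g v : 'rV[R]_N) (w : 'rV[R]_n) eta : st g v w eta 0 (rshift (N + N) (rshift n ord0)) = eta.
Proof. by rewrite /st !row_mxEr mxE eqxx mulr1n. Qed.

Lemma st_g_coord (x : 'rV[R]_K) j : st_g x 0 j = x 0 (lshift (n + 1) (lshift N j)).
Proof. by rewrite !mxE. Qed.
Lemma st_v_coord (x : 'rV[R]_K) j : st_v x 0 j = x 0 (lshift (n + 1) (rshift N j)).
Proof. by rewrite !mxE. Qed.
Lemma st_w_coord (x : 'rV[R]_K) j : st_w x 0 j = x 0 (rshift (N + N) (lshift 1 j)).
Proof. by rewrite !mxE. Qed.
Lemma st_eta_coord (x : 'rV[R]_K) : st_eta x = x 0 (rshift (N + N) (rshift n ord0)).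
Proof. by rewrite /st_eta !mxE. Qed.

Lemma st_add (g v g' v' : 'rV[R]_N) (w w' : 'rV[R]_n) eta eta' :
  st g v w eta + st g' v' w' eta' = st (g + g') (v + v') (w + w') (eta + eta').
Proof.
apply/rowP; apply: st_coord_ind => [j|j|j|]; rewrite mxE.
- by rewrite !st_c1 mxE.
- by rewrite !st_c2 mxE.
- by rewrite !st_c3 mxE.
- by rewrite !st_c4.
Qed.

Lemma st_scale k (g v : 'rV[R]_N) (w : 'rV[R]_n) eta : k *: st g v w eta = st (k *: g) (k *: v) (k *: w) (k * eta).
Proof.
apply/rowP; apply: st_coord_ind => [j|j|j|]; rewrite mxE.
- by rewrite !st_c1 mxE.
- by rewrite !st_c2 mxE.
- by rewrite !st_c3 mxE.
- by rewrite !st_c4.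
Qed.

Lemma st0 : st 0 0 0 0 = 0 :> 'rV[R]_K.
Proof. by apply/rowP; apply: st_coord_ind => [j|j|j|]; rewrite ?st_c1 ?st_c2 ?st_c3 ?st_c4 !mxE. Qed.

Lemma st_sum (I : Type) (r : seq I) (g v : I -> 'rV[R]_N) (w : I -> 'rV[R]_n) eta :
  \sum_(i <- r) st (g i) (v i) (w i) (eta i) =
  st (\sum_(i <- r) g i) (\sum_(i <- r) v i) (\sum_(i <- r) w i) (\sum_(i <- r) eta i).
Proof.
elim: r => [|i r IH]; first by rewrite !big_nil st0.
by rewrite !big_cons IH st_add.
Qed.

Section ulip.
Context {T : Type} {V : normedModType R} (S : set V) (x0 : V).
Lemma ulip_st (g v : T -> V -> 'rV[R]_N) (w : T -> V -> 'rV[R]_n) eta :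
  ulip S x0 g -> ulip S x0 v -> ulip S x0 w -> ulip S x0 eta ->
  ulip S x0 (fun t x => st (g t x) (v t x) (w t x) (eta t x)).
Proof.
move=> ug uv uw ue; apply: ulip_row; apply: st_coord_ind => [j|j|j|].
- by apply: ulip_congr (ulip_coord j ug) => t x _; rewrite st_c1.
- by apply: ulip_congr (ulip_coord j uv) => t x _; rewrite st_c2.
- by apply: ulip_congr (ulip_coord j uw) => t x _; rewrite st_c3.
- by apply: ulip_congr ue => t x _; rewrite st_c4.
Qed.
Lemma ulip_st_g (f : T -> V -> 'rV[R]_K) : ulip S x0 f -> ulip S x0 (fun t x => st_g (f t x)).
Proof. by move=> uf; apply: ulip_row => j; apply: ulip_congr (ulip_coord _ uf) => t x _; rewrite st_g_coord. Qed.
Lemma ulip_st_v (f : T -> V -> 'rV[R]_K) : ulip S x0 f -> ulip S x0 (fun t x => st_v (f t x)).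
Proof. by move=> uf; apply: ulip_row => j; apply: ulip_congr (ulip_coord _ uf) => t x _; rewrite st_v_coord. Qed.
Lemma ulip_st_w (f : T -> V -> 'rV[R]_K) : ulip S x0 f -> ulip S x0 (fun t x => st_w (f t x)).
Proof. by move=> uf; apply: ulip_row => j; apply: ulip_congr (ulip_coord _ uf) => t x _; rewrite st_w_coord. Qed.
Lemma ulip_st_eta (f : T -> V -> 'rV[R]_K) : ulip S x0 f -> ulip S x0 (fun t x => st_eta (f t x)).
Proof. by move=> uf; apply: ulip_congr (ulip_coord _ uf) => t x _; rewrite st_eta_coord. Qed.
End ulip.

Section nice.
Context {V : normedModType R} (x0 : V).
Lemma nice_st (g v : V -> 'rV[R]_N) (w : V -> 'rV[R]_n) eta :
  nice g x0 -> nice v x0 -> nice w x0 -> nice eta x0 ->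
  nice (fun x => st (g x) (v x) (w x) (eta x)) x0.
Proof.
move=> ug uv uw ue; apply: nice_row; apply: st_coord_ind => [j|j|j|].
- by apply: nice_near (nice_coord j ug); apply: near_all => x; rewrite st_c1.
- by apply: nice_near (nice_coord j uv); apply: near_all => x; rewrite st_c2.
- by apply: nice_near (nice_coord j uw); apply: near_all => x; rewrite st_c3.
- by apply: nice_near ue; apply: near_all => x; rewrite st_c4.
Qed.
Lemma nice_st_g (f : V -> 'rV[R]_K) : nice f x0 -> nice (fun x => st_g (f x)) x0.
Proof. by move=> uf; apply: nice_row => j; apply: nice_near (nice_coord _ uf); apply: near_all => x; rewrite st_g_coord. Qed.
Lemma nice_st_v (f : V -> 'rV[R]_K) : nice f x0 -> nice (fun x => st_v (f x)) x0.
Proof. by move=> uf; apply: nice_row => j; apply: nice_near (nice_coord _ uf); apply: near_all => x; rewrite st_v_coord. Qed.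
Lemma nice_st_w (f : V -> 'rV[R]_K) : nice f x0 -> nice (fun x => st_w (f x)) x0.
Proof. by move=> uf; apply: nice_row => j; apply: nice_near (nice_coord _ uf); apply: near_all => x; rewrite st_w_coord. Qed.
Lemma nice_st_eta (f : V -> 'rV[R]_K) : nice f x0 -> nice (fun x => st_eta (f x)) x0.
Proof. by move=> uf; apply: nice_near (nice_coord _ uf); apply: near_all => x; rewrite st_eta_coord. Qed.
End nice.

Section isd.
Context {V : normedModType R} (x u : V).
Lemma isd_st (g v : V -> 'rV[R]_N) (w : V -> 'rV[R]_n) eta dg dv dw de :
  is_derive x u g dg -> is_derive x u v dv -> is_derive x u w dw -> is_derive x u eta de ->
  is_derive x u (fun x => st (g x) (v x) (w x) (eta x)) (st dg dv dw de).
Proof.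
move=> ug uv uw ue; apply: isd_mx => i; rewrite (ord1 i); apply: st_coord_ind => [j|j|j|].
- by rewrite st_c1; apply: isd_near (isd_coord 0 j ug); apply: near_all => y; rewrite st_c1.
- by rewrite st_c2; apply: isd_near (isd_coord 0 j uv); apply: near_all => y; rewrite st_c2.
- by rewrite st_c3; apply: isd_near (isd_coord 0 j uw); apply: near_all => y; rewrite st_c3.
- by rewrite st_c4; apply: isd_near ue; apply: near_all => y; rewrite st_c4.
Qed.
Lemma isd_st_g (f : V -> 'rV[R]_K) df : is_derive x u f df -> is_derive x u (fun x => st_g (f x)) (st_g df).
Proof. by move=> uf; apply: isd_mx => i j; rewrite (ord1 i) st_g_coord; apply: isd_near (isd_coord 0 _ uf); apply: near_all => y; rewrite st_g_coord. Qed.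
Lemma isd_st_v (f : V -> 'rV[R]_K) df : is_derive x u f df -> is_derive x u (fun x => st_v (f x)) (st_v df).
Proof. by move=> uf; apply: isd_mx => i j; rewrite (ord1 i) st_v_coord; apply: isd_near (isd_coord 0 _ uf); apply: near_all => y; rewrite st_v_coord. Qed.
Lemma isd_st_w (f : V -> 'rV[R]_K) df : is_derive x u f df -> is_derive x u (fun x => st_w (f x)) (st_w df).
Proof. by move=> uf; apply: isd_mx => i j; rewrite (ord1 i) st_w_coord; apply: isd_near (isd_coord 0 _ uf); apply: near_all => y; rewrite st_w_coord. Qed.
Lemma isd_st_eta (f : V -> 'rV[R]_K) df : is_derive x u f df -> is_derive x u (fun x => st_eta (f x)) (st_eta df).
Proof. by move=> uf; rewrite st_eta_coord; apply: isd_near (isd_coord 0 _ uf); apply: near_all => y; rewrite st_eta_coord. Qed.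
End isd.
End state_vectors.

Lemma isd_scale_fun (R : realType) (V : normedModType R) m (k : V -> R) (f : V -> 'rV[R]_m) x u dk df :
  is_derive x u k dk -> is_derive x u f df -> 
  is_derive x u (fun y => k y *: f y) (k x *: df + dk *: f x).
Proof.
move=> hk hf; apply: isd_mx => i j; rewrite (ord1 i).
have := isd_mul hk (isd_coord 0 j hf); rewrite !mxE.
by apply: isd_near; apply: near_all => y; rewrite mxE.
Qed.

Section coordinates.
Context {R : realType} {N n : nat} (G : closedLieGroup R N n).
Variables (ip : 'rV[R]_N -> 'rV[R]_N -> R) (e : 'I_n -> 'rV[R]_N).
Hypothesis hip : inner_product_on (lie_algebra G) ip.
Hypothesis he : orthonormal_basis (lie_algebra G) ip e.
Local Notation LA := (lie_algebra G).

Lemma in_basisE w : in_basis e w = w *m (\matrix_i e i).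
Proof. by rewrite mulmx_sum_row; apply: eq_bigr => i _; rewrite rowK. Qed.

Lemma in_basis_lin k v w : in_basis e (k *: v + w) = k *: in_basis e v + in_basis e w.
Proof. by rewrite !in_basisE mulmxDl scalemxAl. Qed.

(** Coordinates with respect to [e] are extended to a linear map on the ambient space by a
    pseudo-inverse, so that they can be applied to a state before it is known to be tangent. *)
Lemma coordinates_exist : exists P : 'M[R]_(N, n), (forall w, in_basis e w *m P = w) /\
  forall v, LA v -> in_basis e (v *m P) = v.
Proof.
pose E := \matrix_i e i : 'M[R]_(n, N).
have fE : row_free E.
  rewrite -kermx_eq0; apply/rowV0P => w /sub_kermxP wE.
  by apply: (in_basis_inj hip he); rewrite in_basisE.
exists (pinvmx E); have K w : in_basis e w *m pinvmx E = w by rewrite in_basisE mulmxKp.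
split => // v Lv; have [_ _ sp] := he; have [w ->] := sp v Lv.
by rewrite -[\sum_i _]/(in_basis e w) K.
Qed.

Lemma ip_coords v w : ip (in_basis e v) (in_basis e w) = dot v w.
Proof.
have [Le _ _] := he; have Lw := in_basis_lie he w; have Lv := in_basis_lie he v.
rewrite {1}/in_basis (ip_sum hip)//; apply: eq_bigr => i _; congr (_ * _).
by rewrite (ip_sym hip)//; exact: (ip_in_basis hip he).
Qed.

Variables (nabla : ('rV[R]_N -> 'rV[R]_N) -> ('rV[R]_N -> 'rV[R]_N) -> ('rV[R]_N -> 'rV[R]_N)).
Hypothesis hn : affine_connection G nabla.
Variable gnabla : 'rV[R]_N -> 'rV[R]_N -> 'rV[R]_N.
Hypothesis hg : lie_algebra_connection G nabla gnabla.
Variable Rd : 'rV[R]_N -> 'rV[R]_N.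
Hypothesis hRd : sym_psd_endo LA ip Rd.

Lemma Rd_in_basis w : Rd (in_basis e w) = \sum_i w 0 i *: Rd (e i).
Proof.
have [Le _ _] := he; have L0 := lie_algebra0 G; rewrite /in_basis.
suff [_ ->] : LA (\sum_i w 0 i *: e i) /\ Rd (\sum_i w 0 i *: e i) = \sum_i w 0 i *: Rd (e i) by [].
elim/big_rec2: _ => [|i y z _ [Lz E]].
  split => //; have := endo_lin hRd (-1) L0 L0.
  by rewrite scaler0 addr0 scaleN1r addNr.
by split; [exact: lie_algebra_lin|rewrite (endo_lin hRd)// E].
Qed.

Lemma dissipation_matrix : exists Rm : 'M[R]_n, [/\ Rm^T = Rm,
  forall w : 'rV[R]_n, 0 <= dot (w *m Rm) w & forall w, Rd (in_basis e w) = in_basis e (w *m Rm)].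
Proof.
have [P [K1 K2]] := coordinates_exist; have [Le _ _] := he.
pose Rm := \matrix_i (Rd (e i) *m P) : 'M[R]_n.
have RE w : Rd (in_basis e w) = in_basis e (w *m Rm).
  have -> : w *m Rm = Rd (in_basis e w) *m P.
    rewrite Rd_in_basis mulmx_suml mulmx_sum_row; apply: eq_bigr => i _.
    by rewrite rowK scalemxAl.
  by rewrite K2//; apply: (endo_stable hRd); exact: (in_basis_lie he).
have sym v w : dot (v *m Rm) w = dot v (w *m Rm).
  by rewrite -!ip_coords -!RE (endo_sym hRd)//; exact: (in_basis_lie he).
exists Rm; split => //.
- apply/matrixP => i j; rewrite mxE.
  have Q k l : Rm k l = dot (delta_mx 0 k *m Rm) (delta_mx 0 l) by rewrite dotC dot_delta -rowE [RHS]mxE.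
  by rewrite !Q sym dotC.
- move=> w; rewrite -ip_coords -RE; apply: (endo_psd hRd); exact: (in_basis_lie he).
Qed.

Lemma gnabla_coords : exists Gam : 'I_n -> 'I_n -> 'rV[R]_n,
  (forall v, gnabla (in_basis e v) (in_basis e v) = in_basis e (\sum_i \sum_j (v 0 i * v 0 j) *: Gam i j)) /\
  \sum_i gnabla (e i) (e i) = in_basis e (\sum_i Gam i i).
Proof.
have [P [K1 K2]] := coordinates_exist; have [Le _ _] := he.
have Lg i j : LA (gnabla (e i) (e j)) by have [] := hg (Le i) (Le j).
exists (fun i j => gnabla (e i) (e j) *m P); split.
  move=> v; rewrite (gnabla_sum hn hg)// in_basisE mulmx_suml; apply: eq_bigr => i _.
  rewrite mulmx_suml; apply: eq_bigr => j _.
  by rewrite -scalemxAl -in_basisE K2.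
rewrite in_basisE mulmx_suml; apply: eq_bigr => i _.
by rewrite -in_basisE K2.
Qed.

Variables (psi : 'rV[R]_N -> R) (alpha : R -> R) (u U : R -> 'rV[R]_n).
Hypothesis hpsi : smooth_on G psi.
Hypothesis ha : smooth setT alpha.
Variables Cu : R.
Hypothesis ub : forall t, `|u t| <= Cu.
Hypothesis Ub : forall t, `|U t| <= Cu.

(** This is the Lipschitz condition behind uniqueness. Each term that is meaningful only on M is
    replaced by an ambient expression in coordinates that agrees with it on M near [x0]; for fixed
    [om] the inputs are just bounded coefficients. *)
Lemma closed_loop_ulip a lam b kap h om x0 : state_space G x0 ->
  ulip (state_space G) x0 (closed_loop G gnabla Rd e psi alpha u U a lam b kap h om).
Proof.
move=> [Gx0 Lx0]; have [P [K1 K2]] := coordinates_exist; have [Le _ _] := he.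
have [Gam [GE1 GE2]] := gnabla_coords; have [Rm [_ _ RE]] := dissipation_matrix.
set S := state_space G.
have [OD [D [oD ODx sD lD DE]]] := left_field_ext Gx0.
have [OP [F [oP OPx sF FE]]] := hpsi Gx0.
have uid : ulip S x0 (fun (_ : R) x => x) by apply: nice_ulip; exact: nice_id.
have ug := ulip_st_g uid; have uv := ulip_st_v uid; have uw := ulip_st_w uid; have ue := ulip_st_eta uid.
have uc := ulip_mulmx P uv.
have cg : {for x0, continuous (fun x : 'rV[R]_(N + N + (n + 1)) => st_g x)}.
  by apply: nice_continuous; apply: nice_st_g; exact: nice_id.
have nD := continuous_near cg erefl (open_near oD ODx).
have nP := continuous_near cg erefl (open_near oP OPx).
have Gset (x : 'rV[R]_(N + N + (n + 1))) : S x -> setT (st_g x) by [].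
have uD i : ulip S x0 (fun (_ : R) x => D (e i) (st_g x)).
  apply: (ulip_comp (S' := setT) (f := fun _ => D (e i)) (g := fun x => st_g x)) => //.
  by apply: nice_ulip; exact: smooth_row_nice ODx (sD _).
have upsi : ulip S x0 (fun (_ : R) x => psi (st_g x)).
  apply: (ulip_near (f := fun (_ : R) x => F (st_g x))).
    by apply: filterS nP => x Ox t [Gx _]; rewrite FE.
  apply: (ulip_comp (S' := setT) (f := fun _ => F) (g := fun x => st_g x)) => //.
  by apply: nice_ulip; exact: smooth_row_nice OPx sF.
have uA : ulip S x0 (fun (_ : R) x => alpha (psi (st_g x) - st_eta x)).
  apply: (ulip_comp (S' := setT) (f := fun _ => alpha) (g := fun x => psi (st_g x) - st_eta x)) => //.
    exact: ulip_subr.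
  by apply: nice_ulip; exact: (smooth_real_nice openT).
have uu : ulip S x0 (fun t _ => u (om * t)) by apply: ulip_bounded => t; exact: ub.
have uU : ulip S x0 (fun t _ => U (om * t)) by apply: ulip_bounded => t; exact: Ub.
have cst (c : R) : ulip S x0 (fun (_ : R) _ => c) by exact: ulip_cst.
have cstv m (c : 'rV[R]_m) : ulip S x0 (fun (_ : R) _ => c) by exact: ulip_cst.
have ub' f : ulip S x0 f -> ulip S x0 (fun (t : R) x => in_basis e (f t x)).
  by move=> uf; apply: ulip_congr (ulip_mulmx (\matrix_i e i) uf) => t x _; rewrite in_basisE.
apply: ulip_st.
- apply: (ulip_near (f := fun (_ : R) x => \sum_i (st_v x *m P) 0 i *: D (e i) (st_g x))).
    apply: filterS nD => x Ox t [Gx Lx].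
    rewrite -{2}(K2 _ Lx) -[dleft _ _ _ _]/(left_field G (in_basis e (st_v x *m P)) (st_g x)).
    rewrite (left_field_in_basis he)//; apply: eq_bigr => i _; by rewrite DE.
  by apply: ulip_sum => i; apply: ulip_scale => //; exact: ulip_coord.
- apply: ulip_add; [apply: ulip_add|].
  + apply: ulip_subr; [apply: ulip_subr|].
    * apply: ulip_opp.
      apply: (ulip_congr (f := fun (_ : R) x => in_basis e (\sum_i \sum_j ((st_v x *m P) 0 i * (st_v x *m P) 0 j) *: Gam i j))).
        by move=> t x [_ Lx]; rewrite -GE1 K2.
      apply: ub'; apply: ulip_sum => i; apply: ulip_sum => j; apply: ulip_scale => //.
      by apply: ulip_mul; exact: ulip_coord.
    * apply: (ulip_congr (f := fun (_ : R) x => in_basis e (st_v x *m P *m Rm))).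
        by move=> t x [_ Lx]; rewrite -RE K2.
      by apply: ub'; exact: ulip_mulmx.
    * apply: ulip_scale => //; apply: ulip_subr; first exact: ub'.
      by apply: ulip_scale; [exact: ulip_mul|exact: ub'].
  + apply: ulip_scale; last exact: ub'.
    by apply: ulip_mul => //; exact: ulip_mul.
  + apply: ulip_scale => //; apply: ulip_mul => //.
    by apply: ulip_congr (ulip_mul uA uA) => t x _; rewrite expr2.
- apply: ulip_add.
    apply: ulip_opp; apply: ulip_scale => //; apply: ulip_subr => //.
    by apply: ulip_scale => //; exact: ulip_mul.
  apply: ulip_scale => //; apply: ulip_mul => //; exact: ulip_mul.
- by apply: ulip_add; [apply: ulip_opp; exact: ulip_mul|exact: ulip_mul].
Qed.
End coordinates.

(** * Periodic inputs and their primitives *)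

Section periodic.
Context {R : realType} (T : R).
Hypothesis T0 : 0 < T.

Lemma periodic_nat (A : Type) (f : R -> A) : (forall t, f (t + T) = f t) -> forall k t, f (t + k%:R * T) = f t.
Proof.
move=> fT; elim=> [|k IH] t; first by rewrite mul0r addr0.
by rewrite -[k.+1]addn1 natrD mulrDl mul1r addrA fT IH.
Qed.

Lemma periodic_reduce (A : Type) (f : R -> A) : (forall t, f (t + T) = f t) ->
  forall t, exists2 s, 0 <= s <= T & f s = f t.
Proof.
move=> fT; have pos t : 0 <= t -> exists2 s, 0 <= s <= T & f s = f t.
  move=> t0; have t0' : 0 <= t / T by rewrite divr_ge0// ltW.
  have /andP[h1 h2] := truncn_itv t0'; set k := Num.truncn (t / T) in h1 h2.
  rewrite ler_pdivlMr// in h1; rewrite ltr_pdivrMr// -[k.+1]addn1 natrD mulrDl mul1r in h2.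
  exists (t - k%:R * T); first by apply/andP; split; lra.
  by rewrite -(periodic_nat fT k) subrK.
move=> t; pose k := Num.bound (`|t| / T).
have kb : `|t| < k%:R * T.
  by rewrite -ltr_pdivrMr//; apply: archi_boundP; rewrite divr_ge0// ltW.
have [|s h1 h2] := pos (t + k%:R * T); last by exists s; rewrite // h2 periodic_nat.
have := ler_norm (- t); rewrite normrN; lra.
Qed.

Lemma periodic_bounded (f : R -> R) : continuous f -> (forall t, f (t + T) = f t) ->
  exists2 B, 0 <= B & forall t, `|f t| <= B.
Proof.
move=> cf fT.
have cn : continuous (fun t => `|f t|) by move=> t; apply: continuous_comp; [exact: cf|exact: norm_continuous].
have [c _ H] := EVT_max (ltW T0) (continuous_subspaceT cn).
exists `|f c| => // t; have [s s01 <-] := periodic_reduce fT t.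
by apply: H; rewrite in_itv.
Qed.

(** The increment of [P] over one period is constant in time and vanishes at 0. Hence [P] is
    periodic, and its bound holds for all times. *)
Lemma periodic_primitive_bounded (c P : R -> R) : (forall t, c (t + T) = c t) ->
  (forall t : R, is_derive t 1 P (c t)) -> P T = P 0 -> exists2 B, 0 <= B & forall t, `|P t| <= B.
Proof.
move=> cT dP PT; apply: periodic_bounded.
  by move=> t; exact: isd_continuous (dP t).
move=> t; apply/eqP; rewrite -subr_eq0; apply/eqP.
have dD (s : R) : is_derive s 1 (fun s => P (s + T) - P s) 0.
  have d1 : is_derive s 1 (fun s : R => s + T) 1.
    by apply: (isd_eq (isd_add (isd_id s 1) (isd_cst T s 1))); rewrite addr0.
  have dPs : differentiable P (s + T) by apply/derivable1_diffP; case: (dP (s + T)).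
  apply: (isd_eq (isd_sub (isd_comp (f := P) (c := fun s : R => s + T) dPs d1) (dP s))).
  by rewrite (isd_diffE dPs (dP _)) cT subrr.
have H : forall s : R, P (s + T) - P s = P (0 + T) - P 0.
  by move=> s; have := is_derive_0_is_cst s 0 dD.
by rewrite H add0r PT subrr.
Qed.
End periodic.

Section input.
Context {R : realType} {n : nat}.
Local Notation mu := (@lebesgue_measure R).
Variables (T : R) (hT : 0 < T) (u : R -> 'rV[R]_n).
Hypothesis u_meas : forall i, lebesgue_measurable_fun (fun t => u t 0 i).
Hypothesis u_bounded : exists C : R, forall t i, `|u t 0 i| <= C.
Variables (U : R -> 'rV[R]_n) (hU : zero_mean_antiderivative T u U).
Hypothesis U_orth : forall i j : 'I_n,
  T^-1 * lebesgue_integral_on 0 T (fun t => U t 0 i * U t 0 j) = (i == j)%:R.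

Lemma antiderivative_bounds : exists Cu : R, [/\ 0 <= Cu, forall t, `|u t| <= Cu, forall t, `|U t| <= Cu,
  forall s t, `|U t - U s| <= Cu * `|t - s| & {ae mu, forall t, is_derive (t : R) 1 U (u t)}].
Proof.
have [C HC] := u_bounded; case: hU => UT UE _.
have C0 : 0 <= `|C| by [].
have uC t i : `|u t 0 i| <= `|C| by apply: le_trans (HC t i) (ler_norm _).
have lipi i s t : s <= t -> `|U t 0 i - U s 0 i| <= `|C| * (t - s).
  by move=> st; rewrite UE//; exact: lebesgue_integral_on_bound.
have lip s t : `|U t - U s| <= `|C| * `|t - s|.
  apply: norm_le_coord => [|j]; first exact: mulr_ge0.
  rewrite !mxE; have [st|ts] := leP s t.
    by rewrite [`|t - s|]ger0_norm ?subr_ge0//; exact: lipi.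
  by rewrite distrC [`|t - s|]distrC [`|s - t|]gtr0_norm ?subr_gt0//; apply: lipi; exact: ltW.
exists (`|C| + (`|U 0| + `|C| * T)); have B0 : 0 <= `|U 0| + `|C| * T by rewrite addr_ge0// mulr_ge0// ltW.
split.
- exact: addr_ge0.
- move=> t; apply: (@le_trans _ _ `|C|); last by rewrite lerDl.
  by apply: norm_le_coord => // j; exact: uC.
- move=> t; have [s /andP[s0 sT] <-] := periodic_reduce hT UT t.
  apply: (@le_trans _ _ (`|U 0| + `|C| * T)); last by rewrite lerDr.
  rewrite -[U s](subrK (U 0)) addrC; apply: le_trans (ler_normD _ _) _; rewrite lerD2l.
  by apply: le_trans (lip 0 s) _; rewrite subr0 [`|s|]ger0_norm// ler_wpM2l.
- move=> s t; apply: le_trans (lip _ _) _; rewrite ler_wpM2r// lerDl//.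
(* The coordinates are indexed by naturals so that [ae_lebesgue_nat] intersects their null sets. *)
- have : {ae mu, forall t, forall k, forall i : 'I_n, i = k :> nat -> is_derive (t : R) 1 (fun s => U s 0 i) (u t 0 i)}.
    apply: ae_lebesgue_nat => k.
    have [kn|nk] := ltnP k n; last by apply: ae_all => t i ik; move: (ltn_ord i); rewrite ik ltnNge nk.
    apply: ae_mono (ae_is_derive_antiderivative (u_meas (Ordinal kn)) (fun t => uC t _) (fun s t => UE s t (Ordinal kn))).
    by move=> t H i ik; have -> : i = Ordinal kn by exact: val_inj.
  apply: ae_mono => t H; apply: isd_mx => i j; rewrite (ord1 i); exact: H erefl.
Qed.

(* The zero-mean coefficients [U^i] and [U^i U^j - delta_ij] of the transformed system. *)
Definition oscillation (k : 'I_n + 'I_n * 'I_n) (t : R) : R :=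
  match k with inl i => U t 0 i | inr ij => U t 0 ij.1 * U t 0 ij.2 - (ij.1 == ij.2)%:R end.

(** The primitives return to their initial value after a period: for U^i because U has zero mean,
    for the products by [U_orth]. *)
Lemma oscillation_primitive : exists (C : 'I_n + 'I_n * 'I_n -> R -> R) (Cb : R),
  [/\ forall k, continuous (oscillation k), forall k t, `|oscillation k t| <= Cb, 
   forall k (t : R), is_derive t 1 (C k) (oscillation k t) & forall k t, `|C k t| <= Cb].
Proof.
have [Cu [Cu0 _ _ Ulip _]] := antiderivative_bounds; case: hU => UT UE Um.
have cU i : continuous (fun t => U t 0 i).
  apply: (@lipschitz_continuous _ _ _ _ Cu) => s t; apply: le_trans (Ulip _ _).
  by have := coord_le_norm (U s - U t) i; rewrite !mxE.
have co k : continuous (oscillation k).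
  case: k => [i|[i j]] t /=; first exact: cU.
  by apply: cvgB; [apply: cvgM; exact: cU|exact: cvg_cst].
have oT k t : oscillation k (t + T) = oscillation k t by case: k => [i|[i j]] /=; rewrite UT.
have step k : exists CB : (R -> R) * R, [/\ forall t, `|oscillation k t| <= CB.2, 
   forall (t : R), is_derive t 1 CB.1 (oscillation k t) & forall t, `|CB.1 t| <= CB.2].
  have [B1 B10 HB1] := periodic_bounded hT (co k) (oT k).
  have [P dP PT] : exists2 P : R -> R, (forall t : R, is_derive t 1 P (oscillation k t)) & P T = P 0.
    case: k {co oT HB1} => [i|[i j]] /=.
      have [P [dP PE]] := continuous_primitive (cU i); exists P => //.
      by have := PE 0 T (ltW hT); rewrite Um => /esym/eqP; rewrite subr_eq0 => /eqP.
    have cij : continuous (fun t => U t 0 i * U t 0 j) by move=> t; apply: cvgM; exact: cU.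
    have [P [dP PE]] := continuous_primitive cij.
    exists (fun t => P t - (i == j)%:R * t).
      move=> t; apply: (isd_eq (isd_sub (dP t) (isd_mull (i == j)%:R (isd_id t 1)))).
      by rewrite mulr1.
    have := U_orth i j; rewrite PE ?(ltW hT)// => /(congr1 (fun x => T * x)).
    rewrite mulrA divff ?lt0r_neq0// mul1r => h; rewrite mulr0 subr0.
    move: h; lra.
  have [B2 B20 HB2] := periodic_primitive_bounded hT (oT k) dP PT.
  exists (P, B1 + B2); split => //= t; first by rewrite (le_trans (HB1 t))// lerDl.
  by rewrite (le_trans (HB2 t))// lerDr.
have [F HF] := choice step.
have B0 k : 0 <= (F k).2 by have [h _ _] := HF k; exact: le_trans (h 0).
have Bs k : (F k).2 <= \sum_l (F l).2 by rewrite (bigD1 k)//= lerDl; apply: sumr_ge0.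
exists (fun k => (F k).1), (\sum_l (F l).2); split => // k t; have [h1 h2 h3] := HF k.
- exact: le_trans (h1 t) (Bs k).
- exact: h2.
- exact: le_trans (h3 t) (Bs k).
Qed.
End input.

(** * Averaged and oscillating parts of the transformed system *)

Section chart_system.
Context {R : realType} {n : nat}.
Local Notation K := (n + n + (n + 1))%N.
Variables (X : 'I_n -> 'rV[R]_n -> 'rV[R]_n) (p : 'rV[R]_n -> R) (gr : 'I_n -> 'rV[R]_n -> R).
Variables (H Rm : 'M[R]_n) (Gam : 'I_n -> 'I_n -> 'rV[R]_n).
Variables (alpha : R -> R) (a lam b kap h : R) (U : R -> 'rV[R]_n).

Definition amp (z : 'rV[R]_K) : R := alpha (p (st_g z) - st_eta z).
Definition damp (z : 'rV[R]_K) : R := derive1 alpha (p (st_g z) - st_eta z).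
Definition grow (z : 'rV[R]_K) : 'rV[R]_n := \row_j gr j (st_g z).
Definition quad (v : 'rV[R]_n) : 'rV[R]_n := \sum_i \sum_j (v 0 i * v 0 j) *: Gam i j.
(** Time derivative of [p (st_g z) - st_eta z], the argument of alpha, when the configuration moves
    with velocity [v] in the frame. *)
Definition rate (z : 'rV[R]_K) (v : 'rV[R]_n) : R :=
  dot v (grow z) + h * st_eta z - h * p (st_g z).

(* The closed loop in the transformed variables: the terms in [omega u] cancel since U' = u. *)
Definition chart_field (s : R) (z : 'rV[R]_K) : 'rV[R]_K :=
  let v := st_v z + (lam * amp z) *: U s in
  st (\sum_i v 0 i *: X i (st_g z))
     (- quad v - v *m Rm - b *: st_w z + (lam ^+ 2 * amp z ^+ 2) *: (\sum_i Gam i i)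
      - (lam * (damp z * rate z v)) *: U s)
     (- (a *: st_w z) - (kap * (damp z * rate z v)) *: U s)
     (- (h * st_eta z) + h * p (st_g z)).

(** The mean of [chart_field] over a period. The quadratic term in U has mean [(lam * amp z) ^+ 2]
    times the sum of the [Gam i i], which cancels the mu term. The part of [rate] linear in U,
    multiplied by U, has mean [lam * amp z] times [grow z], whence the gradient terms. *)
Definition averaged_field (z : 'rV[R]_K) : 'rV[R]_K :=
  st (\sum_i st_v z 0 i *: X i (st_g z))
     (- quad (st_v z) - st_v z *m Rm - b *: st_w z - (lam ^+ 2 * (amp z * damp z)) *: grow z)
     (- (a *: st_w z) - (kap * lam * (amp z * damp z)) *: grow z)
     (- (h * st_eta z) + h * p (st_g z)).

(** Coefficients of the expansion in U: [inl] gathers what is linear in U^i, [inr] what multiplies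
    U^i U^j - delta_ij. *)
Definition oscillating_field (k : 'I_n + 'I_n * 'I_n) (z : 'rV[R]_K) : 'rV[R]_K :=
  match k with
  | inl i =>
    st ((lam * amp z) *: X i (st_g z))
       ((- (lam * amp z)) *: (\sum_j st_v z 0 j *: (Gam i j + Gam j i))
        + (- (lam * amp z)) *: row i Rm + (- (lam * (damp z * rate z (st_v z)))) *: delta_mx 0 i)
       ((- (kap * (damp z * rate z (st_v z)))) *: delta_mx 0 i)
       0
  | inr ij =>
    st 0
       ((- (lam ^+ 2 * amp z ^+ 2)) *: Gam ij.1 ij.2
        + (- (lam ^+ 2 * (amp z * damp z) * gr ij.2 (st_g z))) *: delta_mx 0 ij.1)
       ((- (kap * lam * (amp z * damp z) * gr ij.2 (st_g z))) *: delta_mx 0 ij.1)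
       0
  end.

Lemma quad_add (v w : 'rV[R]_n) (c : R) : quad (v + c *: w) =
  quad v + c *: (\sum_i w 0 i *: (\sum_j v 0 j *: (Gam i j + Gam j i))) + c ^+ 2 *: quad w.
Proof.
rewrite /quad.
have -> : \sum_i w 0 i *: (\sum_j v 0 j *: (Gam i j + Gam j i)) =
   \sum_i \sum_j (w 0 i * v 0 j) *: Gam i j + \sum_i \sum_j (v 0 i * w 0 j) *: Gam i j.
  rewrite [X in _ = _ + X]exchange_big -big_split/=; apply: eq_bigr => i _.
  rewrite -big_split scaler_sumr; apply: eq_bigr => j _ /=.
  by rewrite scalerA scalerDr [v 0 j * _]mulrC.
rewrite scalerDr !scaler_sumr -!big_split/=; apply: eq_bigr => i _.
rewrite !scaler_sumr -!big_split/=; apply: eq_bigr => j _.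
rewrite !mxE !scalerA -!scalerDl; congr (_ *: _); ring.
Qed.

Lemma chart_field_split s z :
  averaged_field z + \sum_k oscillation U k s *: oscillating_field k z = chart_field s z.
Proof.
pose A := amp z; pose A' := damp z; pose xi := st_v z; pose w := U s; pose E := rate z xi.
have basis : \sum_i w 0 i *: delta_mx 0 i = w by rewrite -row_basisE.
have rateE : rate z (xi + (lam * A) *: w) = E + lam * A * dot w (grow z).
  by rewrite /E /rate dotDl dotZl; ring.
pose S2 := \sum_i w 0 i *: (\sum_j xi 0 j *: (Gam i j + Gam j i)).
(* Subtracting the mean delta_ij from the products leaves a diagonal sum, which is the share already
   present in [averaged_field]. *)
have kron (V : lmodType R) (F : 'I_n -> 'I_n -> V) :
    \sum_i \sum_j (w 0 i * w 0 j - (i == j)%:R) *: F i j = \sum_i \sum_j (w 0 i * w 0 j) *: F i j - \sum_i F i i.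
  rewrite -sumrB; apply: eq_bigr => i _.
  have -> : F i i = \sum_j (i == j)%:R *: F i j.
    rewrite (bigD1 i)//= eqxx scale1r big1 ?addr0// => j ji.
    by rewrite eq_sym (negbTE ji) scale0r.
  by rewrite -sumrB; apply: eq_bigr => j _; rewrite scalerBl.
have gsum c : \sum_i \sum_j (w 0 i * w 0 j - (i == j)%:R) *: ((- (c * gr j (st_g z))) *: (delta_mx 0 i : 'rV[R]_n)) =
   (- c) *: (dot w (grow z) *: w) + c *: grow z.
  rewrite kron; congr (_ + _).
    set d := dot w _; rewrite -[in RHS]basis !scaler_sumr; apply: eq_bigr => i _.
    rewrite 2!scalerA /d /dot mulr_suml mulr_sumr scaler_suml; apply: eq_bigr => j _.
    by rewrite scalerA mxE; congr (_ *: _); ring.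
  rewrite -sumrN [grow z]row_basisE scaler_sumr; apply: eq_bigr => i _.
  by rewrite scaleNr opprK scalerA mxE.
rewrite big_sumType/= -(pair_bigA _ (fun i j => (w 0 i * w 0 j - (i == j)%:R) *: oscillating_field (inr (i, j)) z))/=.
under eq_bigr do rewrite st_scale.
under [X in _ + (_ + X)]eq_bigr do under eq_bigr do rewrite st_scale.
under [X in _ + (_ + X)]eq_bigr do rewrite st_sum.
rewrite !st_sum !st_add /chart_field -/A -/A' -/xi -/w rateE; congr st.
- rewrite [X in _ + (_ + X)]big1 ?addr0; last by move=> i _; rewrite big1// => j _; rewrite scaler0.
  rewrite -big_split; apply: eq_bigr => i _ /=.
  by rewrite scalerA -scalerDl !mxE [w 0 i * _]mulrC.
- rewrite quad_add -/S2 mulmxDl -scalemxAl.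
  have -> : \sum_i w 0 i *: ((- (lam * A)) *: (\sum_j xi 0 j *: (Gam i j + Gam j i)) + (- (lam * A)) *: row i Rm 
       + (- (lam * (A' * E))) *: delta_mx 0 i) = (- (lam * A)) *: S2 + (- (lam * A)) *: (w *m Rm) + (- (lam * (A' * E))) *: w.
    rewrite mulmx_sum_row -[X in _ + _ *: X]basis !scaler_sumr -!big_split/=; apply: eq_bigr => i _.
    by rewrite !scalerDr !scalerA ![w 0 i * - _]mulrC.
  have -> : \sum_i \sum_j (w 0 i * w 0 j - (i == j)%:R) *: ((- (lam ^+ 2 * A ^+ 2)) *: Gam i j + 
       (- (lam ^+ 2 * (A * A') * gr j (st_g z))) *: delta_mx 0 i) = 
      (- (lam ^+ 2 * A ^+ 2)) *: (quad w - \sum_i Gam i i) + 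
      ((- (lam ^+ 2 * (A * A'))) *: (dot w (grow z) *: w) + (lam ^+ 2 * (A * A')) *: grow z).
    rewrite -gsum -kron scaler_sumr -big_split; apply: eq_bigr => i _ /=.
    rewrite scaler_sumr -big_split; apply: eq_bigr => j _ /=.
    by rewrite scalerDr; congr (_ + _); rewrite !scalerA [in LHS]mulrC.
  move: (quad xi) (quad w) (\sum_i Gam i i) (xi *m Rm) (w *m Rm) (dot w (grow z)) (grow z) => q1 q2 q3 r1 r2 d1 g1.
  clearbody S2 A A' E w; apply/rowP => l; rewrite !mxE; ring.
- have -> : \sum_i w 0 i *: ((- (kap * (A' * E))) *: delta_mx 0 i) = (- (kap * (A' * E))) *: w.
    rewrite -[in RHS]basis scaler_sumr; apply: eq_bigr => i _.
    by rewrite !scalerA mulrC.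
  rewrite gsum.
  move: (dot w (grow z)) (grow z) => d1 g1.
  clearbody A A' E w; apply/rowP => l; rewrite !mxE; ring.
- by rewrite !big1 ?addr0// => i _; rewrite ?big1 ?mulr0// => j _; rewrite mulr0.
Qed.

Hypothesis nX : forall i, nice (X i) 0.
Hypothesis X0 : forall i, X i 0 = delta_mx 0 i.
Hypothesis np : nice p 0.
Hypothesis p0 : p 0 = 0.
Hypothesis dp0 : forall x, 'd p 0 x = 0.
Hypothesis ngr : forall i, nice (gr i) 0.
Hypothesis gr0 : forall i, gr i 0 = 0.
Hypothesis dgr0 : forall i x, 'd (gr i) 0 x = (x *m H) 0 i.
Hypothesis ha : smooth setT alpha.

Let st_g0 : st_g (0 : 'rV[R]_K) = 0. Proof. by rewrite -st0 st_gE. Qed.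
Let st_v0 : st_v (0 : 'rV[R]_K) = 0. Proof. by rewrite -st0 st_vE. Qed.
Let st_w0 : st_w (0 : 'rV[R]_K) = 0. Proof. by rewrite -st0 st_wE. Qed.
Let st_eta0 : st_eta (0 : 'rV[R]_K) = 0. Proof. by rewrite -st0 st_etaE. Qed.

Let ng : nice (fun z : 'rV[R]_K => st_g z) 0. Proof. by apply: nice_st_g; exact: nice_id. Qed.
Let nv : nice (fun z : 'rV[R]_K => st_v z) 0. Proof. by apply: nice_st_v; exact: nice_id. Qed.
Let nw : nice (fun z : 'rV[R]_K => st_w z) 0. Proof. by apply: nice_st_w; exact: nice_id. Qed.
Let ne : nice (fun z : 'rV[R]_K => st_eta z) 0. Proof. by apply: nice_st_eta; exact: nice_id. Qed.
Let npg : nice (fun z : 'rV[R]_K => p (st_g z)) 0.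
Proof. by apply: (nice_comp ng); rewrite st_g0. Qed.
Let nXg i : nice (fun z : 'rV[R]_K => X i (st_g z)) 0.
Proof. by apply: (nice_comp ng); rewrite st_g0. Qed.
Let ngrg i : nice (fun z : 'rV[R]_K => gr i (st_g z)) 0.
Proof. by apply: (nice_comp ng); rewrite st_g0. Qed.

Lemma nice_amp : nice amp 0.
Proof.
apply: (nice_comp (f := alpha) (nice_sub npg ne)).
exact: (smooth_real_nice openT).
Qed.

Lemma nice_damp : nice damp 0.
Proof.
apply: (nice_comp (f := derive1 alpha) (nice_sub npg ne)).
have -> : derive1 alpha = 'D_1 alpha by apply/funext => x; rewrite derive1E.
by apply: (smooth_real_nice openT) => //; exact: smooth_derive.
Qed.

Lemma nice_grow : nice grow 0.
Proof.
apply: nice_row => j; apply: nice_near (ngrg j); apply: near_all => z; by rewrite mxE.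
Qed.

Let nv_coord j : nice (fun z : 'rV[R]_K => st_v z 0 j) 0. Proof. exact: nice_coord. Qed.

Let nice_rate : nice (fun z => rate z (st_v z)) 0.
Proof.
apply: nice_sub; [apply: nice_add|].
- by apply: nice_sum => j; apply: nice_mul => //; apply: nice_coord; exact: nice_grow.
- by apply: nice_mul => //; exact: nice_cst.
- by apply: nice_mul => //; exact: nice_cst.
Qed.

Let nice_eta : nice (fun z : 'rV[R]_K => - (h * st_eta z) + h * p (st_g z)) 0.
Proof. by apply: nice_add; [apply: nice_opp|]; apply: nice_mul => //; exact: nice_cst. Qed.

Lemma nice_averaged : nice averaged_field 0.
Proof.
have nc (c : R) : nice (fun _ : 'rV[R]_K => c) 0 by exact: nice_cst.
apply: nice_st => //.
- by apply: nice_sum => i; exact: nice_scale.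
- apply: nice_sub; [apply: nice_sub; [apply: nice_sub|]|].
  + apply: nice_opp; apply: nice_sum => i; apply: nice_sum => j.
    by apply: nice_scalel; exact: nice_mul.
  + exact: nice_mulmx.
  + exact: nice_scale.
  + apply: nice_scale; last exact: nice_grow.
    by apply: nice_mul => //; apply: nice_mul; [exact: nice_amp|exact: nice_damp].
- apply: nice_sub; first by apply: nice_opp; exact: nice_scale.
  apply: nice_scale; last exact: nice_grow.
  by apply: nice_mul => //; apply: nice_mul; [exact: nice_amp|exact: nice_damp].
Qed.

Lemma nice_oscillating k : nice (oscillating_field k) 0.
Proof.
have nc (c : R) : nice (fun _ : 'rV[R]_K => c) 0 by exact: nice_cst.
have nA := nice_amp; have nA' := nice_damp; have nE := nice_rate.
case: k => [i|[i j]]; apply: nice_st; try exact: nice_cst.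
- by apply: nice_scale => //; exact: nice_mul.
- apply: nice_add; [apply: nice_add|].
  + apply: nice_scale; first by apply: nice_opp; exact: nice_mul.
    by apply: nice_sum => j; exact: nice_scalel.
  + by apply: nice_scalel; apply: nice_opp; exact: nice_mul.
  + by apply: nice_scalel; apply: nice_opp; apply: nice_mul => //; exact: nice_mul.
- by apply: nice_scalel; apply: nice_opp; apply: nice_mul => //; exact: nice_mul.
- apply: nice_add; apply: nice_scalel; apply: nice_opp.
    apply: nice_mul => //; apply: nice_near (nice_mul nA nA); apply: near_all => z; by rewrite expr2.
  by apply: nice_mul => //; apply: nice_mul => //; exact: nice_mul.
- by apply: nice_scalel; apply: nice_opp; apply: nice_mul => //; apply: nice_mul => //; exact: nice_mul.
Qed.

Lemma averaged0 : averaged_field 0 = 0.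
Proof.
have -> : averaged_field 0 = st 0 0 0 0; last exact: st0.
have g0 : grow 0 = 0 by apply/rowP => j; rewrite !mxE st_g0 gr0.
rewrite /averaged_field g0 st_v0 st_w0 st_eta0 st_g0 p0 mul0mx !scaler0 !subr0 !mulr0 oppr0 addr0.
rewrite big1; last by move=> i _; rewrite mxE scale0r.
rewrite /quad big1 ?oppr0// => i _; rewrite big1// => j _.
by rewrite !mxE mul0r scale0r.
Qed.

(** The term [quad] is of second order and [p] has a critical point at 0, so neither contributes. As
    [grow] vanishes at 0, the factor in front of it enters only through its value there. *)
Lemma diff_averaged x : 'd averaged_field 0 x =
  st (st_v x) (- (st_v x *m Rm) - b *: st_w x - (lam ^+ 2 * (alpha 0 * derive1 alpha 0)) *: (st_g x *m H))
     (- (a *: st_w x) - (kap * lam * (alpha 0 * derive1 alpha 0)) *: (st_g x *m H)) (- (h * st_eta x)).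
Proof.
apply: isd_diffE; first exact: nice_differentiable nice_averaged.
have dg := isd_st_g (isd_id (0 : 'rV[R]_K) x); have dv := isd_st_v (isd_id (0 : 'rV[R]_K) x).
have dw := isd_st_w (isd_id (0 : 'rV[R]_K) x); have de := isd_st_eta (isd_id (0 : 'rV[R]_K) x).
have dX i := isd_diff x (nice_differentiable (nXg i)).
have dP : is_derive (0 : 'rV[R]_K) x (fun z => p (st_g z)) 0.
  have dp : differentiable p (st_g (0 : 'rV[R]_K)) by rewrite st_g0; exact: nice_differentiable.
  by apply: (isd_eq (isd_comp dp dg)); rewrite st_g0.
have dG : is_derive (0 : 'rV[R]_K) x grow (st_g x *m H).
  apply: isd_mx => i j; rewrite (ord1 i).
  have dgj : differentiable (gr j) (st_g (0 : 'rV[R]_K)) by rewrite st_g0; exact: nice_differentiable.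
  have := isd_comp dgj dg; rewrite st_g0 dgr0.
  by apply: isd_near; apply: near_all => z; rewrite mxE.
have dAA := isd_diff x (nice_differentiable (nice_mul nice_amp nice_damp)).
have g0 : grow 0 = 0 by apply/rowP => j; rewrite !mxE st_g0 gr0.
have A0 : amp 0 * damp 0 = alpha 0 * derive1 alpha 0 by rewrite /amp /damp st_g0 st_eta0 p0 subr0.
have dAG c : is_derive (0 : 'rV[R]_K) x (fun z => (c * (amp z * damp z)) *: grow z) 
    ((c * (alpha 0 * derive1 alpha 0)) *: (st_g x *m H)).
  by apply: (isd_eq (isd_scale_fun (isd_mull c dAA) dG)); rewrite g0 scaler0 addr0 A0.
have dQ : is_derive (0 : 'rV[R]_K) x (fun z => quad (st_v z)) 0.
  have H1 := isd_sum (index_enum 'I_n) (fun i (_ : predT i) => isd_sum (index_enum 'I_n) (fun j (_ : predT j) =>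
    isd_scale_fun (isd_mul (isd_coord 0 i dv) (isd_coord 0 j dv)) (isd_cst (Gam i j) 0 x))).
  apply: (isd_eq H1); rewrite big1// => i _; rewrite big1// => j _.
  by rewrite scaler0 add0r st_v0 [(0 : 'rV[R]_n) 0 i]mxE [(0 : 'rV[R]_n) 0 j]mxE mul0r mulr0 addr0 scale0r.
apply: isd_st.
- have H1 := isd_sum (index_enum 'I_n) (fun i (_ : predT i) => isd_scale_fun (isd_coord 0 i dv) (dX i)).
  apply: (isd_eq H1); rewrite [RHS]row_basisE; apply: eq_bigr => i _.
  by rewrite st_v0 mxE scale0r add0r st_g0 X0.
- apply: (isd_eq (isd_sub (isd_sub (isd_sub (isd_opp dQ) (isd_mulmx Rm dv)) (isd_scale b dw)) (dAG (lam ^+ 2)))).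
  by rewrite oppr0 sub0r.
- apply: (isd_eq (isd_add (isd_opp (isd_mull h de)) (isd_mull h dP))).
  by rewrite mulr0 addr0.
Qed.

Hypothesis Hs : H^T = H.
Hypothesis Hp : forall x : 'rV[R]_n, x != 0 -> 0 < dot (x *m H) x.
Hypothesis Rs : Rm^T = Rm.
Hypothesis Rp : forall x : 'rV[R]_n, 0 <= dot (x *m Rm) x.
Hypotheses (a0 : 0 < a) (lam0 : 0 < lam) (b0 : 0 < b) (kap0 : 0 < kap) (h0 : 0 < h).
Hypothesis alpha_pos : 0 < alpha 0 * derive1 alpha 0.
Hypothesis gains : 0 < a * lam - b * kap.
Variables (C : 'I_n + 'I_n * 'I_n -> R -> R) (Cb : R).
Hypothesis ccont : forall k, continuous (oscillation U k).
Hypothesis cb : forall k t, `|oscillation U k t| <= Cb.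
Hypothesis Cd : forall k (t : R), is_derive t 1 (C k) (oscillation U k t).
Hypothesis CB : forall k t, `|C k t| <= Cb.

Lemma chart_stability (rmax : R) : 0 < rmax -> exists r1 s0 : R, [/\ 0 < r1, r1 <= rmax, 0 < s0,
  (forall eps, 0 < eps -> exists om0 del : R, [/\ 0 < om0, 0 < del &
     forall om t0 z0, om0 <= om -> `|z0| <= del -> exists (z : R -> 'rV[R]_K) (d : R),
       [/\ 0 < d, z t0 = z0,
        forall t, t0 - d < t -> `|z t| < r1 /\ is_derive t 1 z (chart_field (om * t) (z t)) &
        forall t, t0 <= t -> `|z t| <= eps]]) &
  (forall eps, 0 < eps -> exists om0 Del : R, [/\ 0 < om0, 0 < Del &
     forall om t0 z0, om0 <= om -> `|z0| <= s0 -> exists (z : R -> 'rV[R]_K) (d : R),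
       [/\ 0 < d, z t0 = z0,
        forall t, t0 - d < t -> `|z t| < r1 /\ is_derive t 1 z (chart_field (om * t) (z t)) &
        forall t, t0 + Del <= t -> `|z t| <= eps]])].
Proof.
move=> rmax0.
have [B [m [M [gam [lB sB [m0 gam0] [Bm BM] Bl]]]]] := lyapunov_exists Hs Hp Rs Rp a0 lam0 b0 kap0 h0 alpha_pos gains.
(* The linearization of the averaged field is exactly the linear system of [lyapunov_exists], with
   [alpha 0 * derive1 alpha 0] in the role of [be]. *)
have Blyap x : B x ('d averaged_field 0 x) <= - gam * `|x| ^+ 2 by rewrite diff_averaged.
have := averaging_stability nice_averaged nice_oscillating averaged0 ccont cb Cd CB lB sB m0 Bm BM gam0 Blyap rmax0.
move=> [r1 [s0 [r10 r1m s00 H1 H2]]]; exists r1, s0; split => // eps eps0.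
- have [om0 [del [p0' d0 HH]]] := H1 eps eps0; exists om0, del; split => // om t0 z0 oo zd.
  have [z [d [dd zt0 Hz Hb]]] := HH om t0 z0 oo zd; exists z, d; split => // t /Hz[h1 h2].
  by split => //; rewrite -chart_field_split.
- have [om0 [del [p0' d0 HH]]] := H2 eps eps0; exists om0, del; split => // om t0 z0 oo zd.
  have [z [d [dd zt0 Hz Hb]]] := HH om t0 z0 oo zd; exists z, d; split => // t /Hz[h1 h2].
  by split => //; rewrite -chart_field_split.
Qed.
End chart_system.

Lemma near_forall_fin (R : realType) (V : normedModType R) (I : finType) (P : I -> V -> Prop) (x0 : V) :
  (forall i, \forall x \near x0, P i x) -> \forall x \near x0, forall i, P i x.
Proof. by move=> H; exact: filter_forall. Qed.

Lemma enorm_le (R : realType) K (x : 'rV[R]_K) : enorm x <= (K%:R + 1) * `|x|.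
Proof.
have c0 : 0 <= (K%:R + 1) * `|x| by rewrite mulr_ge0// addr_ge0.
rewrite -[leRHS](ger0_norm c0) -sqrtr_sqr ler_wsqrtr//.
have -> : \sum_i x 0 i ^+ 2 = dot x x by apply: eq_bigr => i _; rewrite expr2.
apply: le_trans (dot_le_norm x) _; rewrite exprMn ler_wpM2r ?exprn_ge0//.
have : 0 <= K%:R :> R by []. nra.
Qed.

Lemma norm_le_enorm (R : realType) K (x : 'rV[R]_K) : `|x| <= enorm x.
Proof.
rewrite -[leLHS]ger0_norm// -sqrtr_sqr ler_wsqrtr//.
have -> : \sum_i x 0 i ^+ 2 = dot x x by apply: eq_bigr => i _; rewrite expr2.
exact: norm_le_dot.
Qed.

Lemma linear_bound (R : realType) n (W : normedModType R) (f : 'rV[R]_n -> W) : linear f ->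
  exists2 L : R, 0 <= L & forall x, `|f x| <= L * `|x|.
Proof.
move=> lf; pose F : {linear 'rV[R]_n -> W} := HB.pack f (GRing.isLinear.Build _ _ _ _ _ lf).
exact: (linear_row_bound F).
Qed.

Lemma diff_derive1 (R : realType) (f : R -> R) x v : differentiable f x -> 'd f x v = derive1 f x * v.
Proof.
move=> df; have {1}-> : v = v *: (1 : R) by rewrite /GRing.scale/= mulr1.
by rewrite linearZ /GRing.scale/= mulrC derive1E deriveE.
Qed.

(** * Lifting chart solutions to the state space *)

Section reconstruction.
Context {R : realType} {N n : nat} (G : closedLieGroup R N n).
Local Notation KN := (N + N + (n + 1))%N.
Local Notation Kn := (n + n + (n + 1))%N.
Local Notation mu := (@lebesgue_measure R).
Variables (ip : 'rV[R]_N -> 'rV[R]_N -> R) (e : 'I_n -> 'rV[R]_N).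
Hypothesis hip : inner_product_on (lie_algebra G) ip.
Hypothesis he : orthonormal_basis (lie_algebra G) ip e.
Variables (Rd : 'rV[R]_N -> 'rV[R]_N) (gnabla : 'rV[R]_N -> 'rV[R]_N -> 'rV[R]_N).
Variables (Rm : 'M[R]_n) (Gam : 'I_n -> 'I_n -> 'rV[R]_n).
Hypothesis RE : forall w, Rd (in_basis e w) = in_basis e (w *m Rm).
Hypothesis GE1 : forall v, gnabla (in_basis e v) (in_basis e v) = in_basis e (quad Gam v).
Hypothesis GE2 : \sum_i gnabla (e i) (e i) = in_basis e (\sum_i Gam i i).
Variables (psi : 'rV[R]_N -> R) (alpha : R -> R) (u U : R -> 'rV[R]_n).
Variables (a lam b kap h : R) (gs : 'rV[R]_N).
Hypothesis ha : smooth setT alpha.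
Variables (phi : 'rV[R]_n -> 'rV[R]_N) (X : 'I_n -> 'rV[R]_n -> 'rV[R]_n) (p : 'rV[R]_n -> R) (gr : 'I_n -> 'rV[R]_n -> R).

(* The identities of [local_model] that hold near the origin of the chart. *)
Definition adapted (y : 'rV[R]_n) : Prop :=
  [/\ lg_set G (phi y) /\ differentiable phi y, forall i, 'd phi y (X i y) = left_field G (e i) (phi y),
   psi (phi y) = psi gs + p y, differentiable p y & forall i, 'd p y (X i y) = gr i y].

Definition unchart (z : 'rV[R]_Kn) : 'rV[R]_KN :=
  st (phi (st_g z)) (in_basis e (st_v z)) (st_w z) (st_eta z + psi gs).

Definition forced (w : 'rV[R]_n) : 'rV[R]_KN := st 0 (lam *: in_basis e w) (kap *: w) 0.

Let A (z : 'rV[R]_Kn) := amp p alpha z.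
(** The original state whose transformed variables are [unchart z]; [s] stands for [om * t].
    Separating the summand with U makes the time regularity of the lift visible. *)
Definition lift_state (s : R) (z : 'rV[R]_Kn) : 'rV[R]_KN := unchart z + A z *: forced (U s).

Lemma lift_stateE s z : lift_state s z = st (phi (st_g z)) (in_basis e (st_v z + (lam * A z) *: U s))
  (st_w z + (kap * A z) *: U s) (st_eta z + psi gs).
Proof.
rewrite /lift_state /unchart /forced st_scale st_add scaler0 mulr0 !addr0; congr st.
  by rewrite !in_basisE mulmxDl -!scalemxAl scalerA mulrC.
by rewrite scalerA mulrC.
Qed.

Lemma lift_transformed om t z : adapted (st_g z) ->
  change_of_variables e psi alpha U lam kap om t (lift_state (om * t) z) = unchart z.
Proof.
move=> [_ _ psiE _ _]; rewrite lift_stateE /change_of_variables !stE psiE.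
have -> : psi gs + p (st_g z) - (st_eta z + psi gs) = p (st_g z) - st_eta z by ring.
rewrite -/(amp p alpha z) -/(A z) /unchart !in_basisE mulmxDl -scalemxAl.
by rewrite addrK addrK.
Qed.

Lemma lift_in_state_space s z : adapted (st_g z) -> state_space G (lift_state s z).
Proof.
by move=> [[Gy _] _ _ _ _]; rewrite lift_stateE; split; rewrite !stE//; exact: (in_basis_lie he).
Qed.

(** Differentiating [U (om * s)] restores the terms in [om * u], and differentiating the amplitude
    cancels the terms in [damp * rate] of [chart_field]. This works at each time where U has
    derivative u at [om * t]. *)
Lemma lift_derive om t (z : R -> 'rV[R]_Kn) : adapted (st_g (z t)) ->
  is_derive (om * t) 1 U (u (om * t)) ->
  is_derive t 1 z (chart_field X p gr Rm Gam alpha a lam b kap h U (om * t) (z t)) ->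
  is_derive t 1 (fun s => lift_state (om * s) (z s))
    (closed_loop G gnabla Rd e psi alpha u U a lam b kap h om t (lift_state (om * t) (z t))).
Proof.
move=> [[Gy dphi] XE psiE dp grE] dU dz.
set cf := chart_field _ _ _ _ _ _ _ _ _ _ _ _ _ _ in dz.
pose v := st_v (z t) + (lam * A (z t)) *: U (om * t).
pose rt := rate p gr h (z t) v.
pose dA := damp p alpha (z t) * rt.
have dUs : is_derive t 1 (fun s => U (om * s)) (om *: u (om * t)).
  have dfU : differentiable U (om * t) by apply/derivable1_diffP; case: dU.
  have d1 : is_derive t 1 (fun s : R => om * s) (om *: (1 : R)) by exact: isd_scale (isd_id t 1).
  by apply: (isd_eq (isd_comp (f := U) (c := fun s => om * s) dfU d1)); rewrite linearZ (isd_diffE dfU dU).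
have dg := isd_st_g dz; have dv := isd_st_v dz; have dw := isd_st_w dz; have de := isd_st_eta dz.
rewrite /cf !stE -/v in dg dv dw de.
have dphiy : is_derive t 1 (fun s => phi (st_g (z s))) (left_field G (in_basis e v) (phi (st_g (z t)))).
  apply: (isd_eq (isd_comp (f := phi) (c := fun s => st_g (z s)) dphi dg)); rewrite (left_field_in_basis he)// linear_sum.
  by apply: eq_bigr => i _; rewrite linearZ XE.
have dAs : is_derive t 1 (fun s => A (z s)) dA.
  have dal : differentiable alpha (p (st_g (z t)) - st_eta (z t)).
    by apply: (smooth_differentiable ha).
  apply: (isd_eq (isd_comp (f := alpha) (c := fun s => p (st_g (z s)) - st_eta (z s)) dal
    (isd_sub (isd_comp (f := p) (c := fun s => st_g (z s)) dp dg) de))).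
  rewrite diff_derive1// /dA /damp; congr (_ * _).
  have -> : 'd p (st_g (z t)) (\sum_i v 0 i *: X i (st_g (z t))) = dot v (grow gr (z t)).
    by rewrite linear_sum; apply: eq_bigr => i _; rewrite linearZ grE [X in _ = _ * X]mxE.
  rewrite /rt /rate; ring.
have E : (fun s => lift_state (om * s) (z s)) = (fun s => st (phi (st_g (z s))) 
    ((st_v (z s) + (lam * A (z s)) *: U (om * s)) *m (\matrix_i e i)) (st_w (z s) + (kap * A (z s)) *: U (om * s)) (st_eta (z s) + psi gs)).
  by apply/funext => s; rewrite lift_stateE in_basisE.
rewrite E; have dAU c := isd_scale_fun (isd_mull c dAs) dUs.
apply: (isd_eq (isd_st dphiy (isd_mulmx _ (isd_add dv (dAU lam))) (isd_add dw (dAU kap)) (isd_add de (isd_cst (psi gs) t 1)))).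
rewrite lift_stateE /closed_loop !stE psiE.
have -> : psi gs + p (st_g (z t)) - (st_eta (z t) + psi gs) = p (st_g (z t)) - st_eta (z t) by ring.
rewrite -/(amp p alpha (z t)) -/(A (z t)) -/v RE GE1 GE2 -/rt -/dA.
congr st.
- rewrite !in_basisE !scalemxAl -!mulNmx -!mulmxDl !scalemxAl -!mulNmx -!mulmxDl; congr (_ *m _).
  move: (quad Gam v) (v *m Rm) (\sum_i Gam i i) => q1 q2 q3; rewrite /dA.
  apply/rowP => l; rewrite !mxE /A; ring.
- by rewrite /dA; apply/rowP => l; rewrite !mxE /A; ring.
- by ring.
Qed.

Variables (rmax L0 L1 L2 LU : R).
Hypothesis Hgood : forall z : 'rV[R]_Kn, `|z| < rmax -> adapted (st_g z).
Hypothesis unchart_lip : forall z z', `|z| < rmax -> `|z'| < rmax -> `|unchart z - unchart z'| <= L0 * `|z - z'|.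
Hypothesis amp_bounded : forall z, `|z| < rmax -> `|A z| <= L1.
Hypothesis amp_lip : forall z z', `|z| < rmax -> `|z'| < rmax -> `|A z - A z'| <= L1 * `|z - z'|.
Hypothesis field_bounded : forall s z, `|z| < rmax -> `|chart_field X p gr Rm Gam alpha a lam b kap h U s z| <= L2.
Hypothesis L00 : 0 <= L0.
Hypothesis L10 : 0 <= L1.
Hypothesis Ub : forall t, `|U t| <= LU.
Hypothesis Ulip : forall s t, `|U t - U s| <= LU * `|t - s|.
Hypothesis Uae : {ae mu, forall t, is_derive (t : R) 1 U (u t)}.

(** With bounded velocity of [z] and Lipschitz U the lift is Lipschitz in time, hence absolutely
    continuous, although u is only measurable. The equation fails at most on the scaled null set of
    [negligible_scale]. *)
Lemma lift_solution om t0 d (z : R -> 'rV[R]_Kn) : 0 < om -> 0 < d ->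
  (forall t, t0 - d < t -> `|z t| < rmax /\ 
     is_derive t 1 z (chart_field X p gr Rm Gam alpha a lam b kap h U (om * t) (z t))) ->
  solution (state_space G) (closed_loop G gnabla Rd e psi alpha u U a lam b kap h om) t0
    (lift_state (om * t0) (z t0)) [set t | t0 - d < t] (fun t => lift_state (om * t) (z t)).
Proof.
move=> om0 d0 Hz; split => //.
- split; last by rewrite /= ltrBlDr ltrDl.
    exact: open_gt.
  by move=> s t /= hs ht r /andP[sr _]; exact: lt_le_trans sr.
- by move=> t /Hz[zr _]; apply: lift_in_state_space; exact: Hgood.
- move=> s0 s1 s01 Hs.
  have [LQ LQ0 HQ] : exists2 L, 0 <= L & forall x, `|forced x| <= L * `|x|.
    apply: linear_bound => k x y; rewrite /forced in_basis_lin st_scale st_add !scaler0 mulr0 !addr0.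
    by congr st; rewrite scalerDr !scalerA mulrC.
  have QB x y : forced x - forced y = forced (x - y).
    rewrite /forced -scaleN1r st_scale st_add !scaler0 mulr0 !addr0 !in_basisE mulmxBl !scaleN1r.
    by congr st; rewrite scalerBr.
  apply: (@lipschitz_ac _ _ _ _ _ (L0 * L2 + (L1 * L2 * (LQ * LU) + L1 * (LQ * (LU * om))))) => s t h1 h2 h3.
  have Js r : s <= r <= t -> t0 - d < r.
    by move=> /andP[r1 r2]; apply: Hs; rewrite /= in_itv/= (le_trans h1)// (le_trans r2).
  have Is : s <= s <= t by rewrite lexx h2.
  have It : s <= t <= t by rewrite lexx h2.
  have [zs _] := Hz s (Js s Is).
  have [zt _] := Hz t (Js t It).
  have zst : `|z t - z s| <= L2 * (t - s).
    have := mean_value_ineq (f := z) (df := fun t => chart_field X p gr Rm Gam alpha a lam b kap h U (om * t) (z t))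
       (phi := fun t => L2 * t) (dphi := fun=> L2) h2.
    rewrite mulrBr; apply.
    + by move=> r /Js/Hz[].
    + by move=> r _; apply: (isd_eq (isd_mull L2 (isd_id r 1))); rewrite mulr1.
    + by move=> r /Js/Hz[zr _]; exact: field_bounded.
  have ts : 0 <= t - s by rewrite subr_ge0.
  have Qt : `|forced (U (om * t))| <= LQ * LU by apply: le_trans (HQ _) _; rewrite ler_wpM2l.
  have Qst : `|forced (U (om * t)) - forced (U (om * s))| <= LQ * (LU * om * (t - s)).
    rewrite QB; apply: le_trans (HQ _) _; rewrite ler_wpM2l//.
    apply: le_trans (Ulip _ _) _; rewrite -mulrBr normrM gtr0_norm// ger0_norm//.
    by rewrite mulrA.
  have -> : lift_state (om * t) (z t) - lift_state (om * s) (z s) = (unchart (z t) - unchart (z s)) + 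
     ((A (z t) - A (z s)) *: forced (U (om * t)) + A (z s) *: (forced (U (om * t)) - forced (U (om * s)))).
    rewrite /lift_state scalerBl scalerBr.
    by rewrite [_ + (_ - A (z s) *: forced (U (om * s)))]addrA subrK opprD addrACA.
  apply: le_trans (ler_normD _ _) _; rewrite mulrDl; apply: lerD.
    by apply: le_trans (unchart_lip zt zs) _; rewrite -mulrA ler_wpM2l.
  apply: le_trans (ler_normD _ _) _; rewrite mulrDl !normrZ; apply: lerD.
    have -> : L1 * L2 * (LQ * LU) * (t - s) = L1 * (L2 * (t - s)) * (LQ * LU) by ring.
    rewrite ler_pM//; apply: le_trans (amp_lip zt zs) _; by rewrite ler_wpM2l.
  rewrite -mulrA ler_pM//; first exact: amp_bounded.
  by rewrite -[leRHS]mulrA.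
- have := negligible_scale om0 Uae; apply: ae_mono => t dU t0t.
  have [zr dz] := Hz t t0t; apply: lift_derive => //; exact: Hgood.
Qed.
End reconstruction.

(** * Practical stability *)

Lemma near_and (R : realType) (V : normedModType R) (P Q : V -> Prop) (x0 : V) :
  (\forall x \near x0, P x) -> (\forall x \near x0, Q x) -> \forall x \near x0, P x /\ Q x.
Proof. by move=> hP hQ; apply: filterS2 hP hQ. Qed.

Lemma near_mono (R : realType) (V : normedModType R) (P Q : V -> Prop) (x0 : V) :
  (forall x, P x -> Q x) -> (\forall x \near x0, P x) -> \forall x \near x0, Q x.
Proof. by move=> PQ; exact: filterS. Qed.

Theorem theorem1 (R : realType) (N n : nat) (G : closedLieGroup R N n)
    (ip : 'rV[R]_N -> 'rV[R]_N -> R)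
    (hip : inner_product_on (lie_algebra G) ip)
    (Rd : 'rV[R]_N -> 'rV[R]_N)
    (hRd : sym_psd_endo (lie_algebra G) ip Rd)
    (psi : 'rV[R]_N -> R) (hpsi : smooth_on G psi)
    (T : R) (hT : 0 < T)
    (u : R -> 'rV[R]_n)
    (u_meas : forall i, lebesgue_measurable_fun (fun t => u t 0 i))
    (u_bounded : exists C : R, forall t i, `|u t 0 i| <= C)
    (u_periodic : forall t, u (t + T) = u t)
    (u_zero_mean : forall i,
       lebesgue_integral_on 0 T (fun t => u t 0 i) = 0)
    (U : R -> 'rV[R]_n) (hU : zero_mean_antiderivative T u U)
    (U_orth : forall i j : 'I_n,
       T^-1 * lebesgue_integral_on 0 T (fun t => U t 0 i * U t 0 j)
       = (i == j)%:R)
    (alpha : R -> R) (alpha_smooth : smooth setT alpha)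
    (alpha_incr : forall s t : R, s < t ->
       alpha s * derive1 alpha s < alpha t * derive1 alpha t)
    (alpha_pos : forall s : R, 0 < alpha s * derive1 alpha s)
    (a lam b kap h : R)
    (ha : 0 < a) (hlam : 0 < lam) (hb : 0 < b) (hkap : 0 < kap) (hh : 0 < h)
    (hgains : 0 < a * lam - b * kap)
    (e : 'I_n -> 'rV[R]_N) (he : orthonormal_basis (lie_algebra G) ip e)
    (nabla : ('rV[R]_N -> 'rV[R]_N) -> ('rV[R]_N -> 'rV[R]_N) ->
             ('rV[R]_N -> 'rV[R]_N))
    (hnabla : levi_civita G (left_metric G ip) nabla)
    (gnabla : 'rV[R]_N -> 'rV[R]_N -> 'rV[R]_N)
    (hgnabla : lie_algebra_connection G nabla gnabla)
    (gs : 'rV[R]_N) (hgs : lg_set G gs)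
    (psi_min : \forall g \near within G (nbhs gs), psi gs <= psi g)
    (psi_hess : hessian_posdef_at G nabla psi gs) :
  locally_practically_uniformly_asymptotically_stable (state_space G)
    (closed_loop G gnabla Rd e psi alpha u U a lam b kap h)
    (change_of_variables e psi alpha U lam kap)
    (st gs 0 0 (psi gs)).
Proof.
have hc := lc_connection hnabla.
have [Cu [Cu0 ub Ub Ulip Uae]] := antiderivative_bounds hT u_meas u_bounded hU.
have [C [Cb [ccont cb Cd CB]]] := oscillation_primitive hT u_meas u_bounded hU U_orth.
have [P [K1 K2]] := coordinates_exist hip he.
have [Gam [GE1 GE2]] := gnabla_coords hip he hc hgnabla.
have [Rm [Rs Rp RE]] := dissipation_matrix hip he hRd.
have [Oc [W [phi [chi [X [p [gr [H [[ch Os chis W0 phi0] [np p0 dp0 npsi] HX Hgr [Hs Hp]]]]]]]]]] :=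
  local_model hip he hnabla hpsi hgs psi_min psi_hess.
have [oO oW sphi schi [HW HO]] := ch.
have nX i : nice (X i) 0 by case: (HX i).
have X0 i : X i 0 = delta_mx 0 i by case: (HX i).
have ngr i : nice (gr i) 0 by case: (Hgr i).
have gr0 i : gr i 0 = 0 by case: (Hgr i).
have dgr0 i x : 'd (gr i) 0 x = (x *m H) 0 i by case: (Hgr i).
pose M := state_space G; pose xs := st gs 0 0 (psi gs) : 'rV[R]_(N + N + (n + 1)).
pose Psi := unchart e psi gs phi.
pose F := chart_field X p gr Rm Gam alpha a lam b kap h U.
have [eg eg0 Hg] : exists2 eg, 0 < eg & forall y, `|y| < eg -> adapted G e psi gs phi X p gr y.
  have n1 : \forall y \near (0 : 'rV[R]_n), forall i, 'd phi y (X i y) = left_field G (e i) (phi y).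
    by apply: near_forall_fin => i; case: (HX i).
  have n2 : \forall y \near (0 : 'rV[R]_n), forall i, 'd p y (X i y) = gr i y.
    by apply: near_forall_fin => i; case: (Hgr i).
  have [n3 _] := np.
  have nall : \forall y \near (0 : 'rV[R]_n), adapted G e psi gs phi X p gr y.
    apply: near_mono (near_and (near_and n1 n2) (near_and (near_and n3 npsi) (open_near oW W0))).
    move=> y [[y1 y2] [[y3 y4] Wy]]; split => //.
    by have [_ Gy _] := HW _ Wy; split => //; exact: smooth_differentiable Wy.
  have [eg eg0 Hg] := (near_normP _ _).1 nall.
  exists eg; first exact: eg0.
  move=> y yg; have yg' : `|y - 0| < eg by rewrite subr0.
  exact: (Hg y yg').
have st_g_norm (z : 'rV[R]_(n + n + (n + 1))) : `|st_g z| <= `|z|.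
  by apply: norm_le_coord => // j; rewrite st_g_coord; exact: coord_le_norm.
have nid : nice (fun z : 'rV[R]_(n + n + (n + 1)) => z) 0 by exact: nice_id.
have sg0 : st_g (0 : 'rV[R]_(n + n + (n + 1))) = 0 by rewrite -st0 st_gE.
have nPsi : nice Psi 0.
  apply: nice_st.
  - apply: (nice_comp (nice_st_g nid)); rewrite sg0; exact: smooth_row_nice W0 sphi.
  - by apply: nice_near (nice_mulmx (\matrix_i e i) (nice_st_v nid)); apply: near_all => z; rewrite in_basisE.
  - exact: nice_st_w.
  - by apply: nice_add; [exact: nice_st_eta|exact: nice_cst].
have [_ [e2 [L2 [e20 L20 _ PsiL]]]] := nPsi.
have [_ [e3 [L3 [e30 L30 AB AL]]]] := nice_amp np alpha_smooth.
have uF : ulip setT 0 F.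
  have uu := ulip_add (nice_ulip R setT (nice_averaged Rm Gam a lam b kap h nX np ngr alpha_smooth))
    (ulip_sum (index_enum _) predT (fun k => ulip_scale (ulip_bounded setT 0 (cb k)) 
      (nice_ulip R setT (nice_oscillating Rm Gam lam kap h nX np ngr alpha_smooth k)))).
  by apply: ulip_congr uu => s z _; rewrite /F -chart_field_split.
have [e4 [L4 [e40 L40 FB _]]] := uF.
(* Within this radius the chart identities and all Lipschitz bounds hold together, and
   [chart_stability] is asked to keep solutions inside it. *)
pose rmax := Num.min (Num.min eg e2) (Num.min e3 e4).
have rmax0 : 0 < rmax by rewrite !lt_min eg0 e20 e30 e40.
have rg (z : 'rV[R]_(n + n + (n + 1))) : `|z| < rmax -> [/\ adapted G e psi gs phi X p gr (st_g z), `|z - 0| < e2, `|z - 0| < e3 & `|z - 0| < e4].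
  rewrite !lt_min subr0 => /andP[/andP[h1 h2] /andP[h3 h4]].
  exact: (And4 (Hg _ (le_lt_trans (st_g_norm z) h1)) h2 h3 h4).
have alpha00 := alpha_pos 0.
have [r1 [s0 [r10 r1m s00 Hstab Hattr]]] := chart_stability Gam nX X0 np p0 dp0 ngr gr0 dgr0 alpha_smooth
  Hs Hp Rs Rp ha hlam hb hkap hh alpha00 hgains ccont cb Cd CB rmax0.
(* The inverse of Psi on the part of M lying over the chart domain. *)
pose Z (x : 'rV[R]_(N + N + (n + 1))) : 'rV[R]_(n + n + (n + 1)) :=
  st (chi (st_g x)) (st_v x *m P) (st_w x) (st_eta x - psi gs).
have Zxs : Z xs = 0 by rewrite /Z /xs !stE chis mul0mx subrr st0.
have nZ : nice Z xs.
  have nid' : nice (fun x : 'rV[R]_(N + N + (n + 1)) => x) xs by exact: nice_id.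
  apply: nice_st.
  - apply: (nice_comp (nice_st_g nid')); rewrite stE; exact: smooth_row_nice Os schi.
  - by apply: nice_mulmx; exact: nice_st_v.
  - exact: nice_st_w.
  - by apply: nice_sub; [exact: nice_st_eta|exact: nice_cst].
have [_ [e5 [L5 [e50 L50 _ ZL]]]] := nZ.
have [e6 e60 Hc] : exists2 e6, 0 < e6 & forall x : 'rV[R]_(N + N + (n + 1)), `|x - xs| < e6 -> Oc (st_g x).
  apply/(near_normP _ _).1.
  have cg : {for xs, continuous (fun x : 'rV[R]_(N + N + (n + 1)) => st_g x)}.
    by apply: nice_continuous; apply: nice_st_g; exact: nice_id.
  by apply: (continuous_near cg (st_gE _ _ _ _)); exact: open_near.
have PsiZ x : M x -> Oc (st_g x) -> Psi (Z x) = x.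
  move=> [Gx Lx] Ox; have [_ phiK] := HO _ Ox Gx.
  by rewrite /Psi /unchart /Z !stE phiK K2// subrK stK.
have Psi0 : Psi 0 = xs.
  rewrite /Psi /unchart -{1}[in st_v _]st0 -{1}[in st_w _]st0 -{1}[in st_eta _]st0 sg0 !stE phi0 add0r.
  by rewrite in_basisE mul0mx.
(* Conversion factor of [enorm_le] from the maximum norm to the Euclidean norm. *)
pose c0 : R := (N + N + (n + 1))%:R + 1.
have c00 : 0 < c0 by rewrite ltr_wpDl.
have Psi_enorm z : `|z| < rmax -> enorm (Psi z - xs) <= c0 * (L2 + 1) * `|z|.
  move=> zr; apply: le_trans (enorm_le _) _; rewrite -mulrA ler_pM2l//.
  have [_ z2 _ _] := rg _ zr; have := PsiL tt z 0 I I z2; rewrite subrr normr0 e20 => /(_ isT).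
  rewrite Psi0 subr0 => /le_trans; apply; rewrite ler_wpM2r// lerDl//.
(* Both stability properties now reduce to a chart solution [z] from [Z xt0]: its lift solves the
   closed loop, extends to the maximal solution, and has transformed variables [Psi (z t)]. *)
have key om t0 xt0 z d (Q : set R -> (R -> 'rV[R]_(N + N + (n + 1))) -> Prop) : 0 < om -> M xt0 -> Oc (st_g xt0) ->
    0 < d -> z t0 = Z xt0 ->
    (forall t, t0 - d < t -> `|z t| < r1 /\ is_derive (t : R) 1 z (F (om * t) (z t))) ->
    (forall J x, (forall t, t0 - d < t -> J t /\ change_of_variables e psi alpha U lam kap om t (x t) = Psi (z t)) -> Q J x) ->
    from_transformed (state_space G) (closed_loop G gnabla Rd e psi alpha u U a lam b kap h)
      (change_of_variables e psi alpha U lam kap) om t0 xt0 Q.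
  move=> om0 Mx Ox d0 zt0 Hz HQ.
  have Hz' t : t0 - d < t -> `|z t| < rmax /\ is_derive (t : R) 1 z (F (om * t) (z t)).
    by move=> /Hz[z1 z2]; split => //; exact: lt_le_trans r1m.
  have gz t : t0 - d < t -> adapted G e psi gs phi X p gr (st_g (z t)) by move=> /Hz'[/rg[gzt _ _ _] _]; exact: gzt.
  have t0d : t0 - d < t0 by rewrite ltrBlDr ltrDl.
  pose lift := lift_state e psi alpha U lam kap gs phi p.
  have sol : solution M (closed_loop G gnabla Rd e psi alpha u U a lam b kap h om) t0
      (lift (om * t0) (z t0)) [set t | t0 - d < t] (fun t => lift (om * t) (z t)).
    apply: (lift_solution he RE GE1 GE2 alpha_smooth (rmax := rmax) (L0 := L2) (L1 := L3) (L2 := L4) (LU := Cu)) om0 d0 Hz'.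
    + by move=> y /rg[gy _ _ _]; exact: gy.
    + by move=> y y' /rg[_ y2 _ _] /rg[_ y2' _ _]; exact: (PsiL tt _ _ I I y2 y2').
    + by move=> y /rg[_ _ y3 _]; exact: (AB tt _ I y3).
    + by move=> y y' /rg[_ _ y3 _] /rg[_ _ y3' _]; exact: (AL tt _ _ I I y3 y3').
    + by move=> s y /rg[_ _ _ y4]; exact: (FB s y I y4).
    + exact: L20.
    + exact: L30.
    + exact: Ub.
    + exact: Ulip.
    + exact: Uae.
  exists (lift (om * t0) (z t0)); split.
  - by apply: (lift_in_state_space he); exact: gz.
  - by rewrite (lift_transformed _ _ _ _ _ _ (gz _ t0d)) zt0 -/Psi PsiZ.
  - apply: (maximal_solution_exists _ sol) => [x0 Mx0|J x HJ].
      exact: (closed_loop_ulip hip he hc hgnabla hRd hpsi alpha_smooth ub Ub).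
    apply: HQ => t t0t; have [Jt ->] := HJ t t0t; split => //.
    by rewrite (lift_transformed _ _ _ _ _ _ (gz _ t0t)).
pose rho1 := Num.min e5 e6.
have rho10 : 0 < rho1 by rewrite lt_min e50.
have L51 : 0 < L5 + 1 by rewrite ltr_wpDl.
have L21 : 0 < L2 + 1 by rewrite ltr_wpDl.
have cL : 0 < c0 * (L2 + 1) by rewrite mulr_gt0.
have Z_norm x : `|x - xs| < rho1 -> Oc (st_g x) /\ `|Z x| <= (L5 + 1) * `|x - xs|.
  rewrite lt_min => /andP[x5 x6]; split; first exact: Hc.
  have xs5 : `|xs - xs| < e5 by rewrite subrr normr0.
  have := ZL tt x xs I I x5 xs5; rewrite Zxs subr0 => /le_trans; apply.
  by rewrite ler_wpM2r// lerDl.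
(* Points of M whose chart coordinates lie within the basin radius [s0]. *)
pose S := [set x | M x /\ `|x - xs| < Num.min rho1 (s0 / (L5 + 1))].
have S0 : 0 < Num.min rho1 (s0 / (L5 + 1)) by rewrite lt_min rho10 divr_gt0.
exists S; split.
- by move=> x [].
- by split; [split; rewrite /xs !stE//; exact: lie_algebra0|rewrite subrr normr0].
- apply: (near_normP xs (fun x => M x -> S x)).2; exists (Num.min rho1 (s0 / (L5 + 1))) => //.
split.
- move=> eps eps0; have eps1 : 0 < eps / (c0 * (L2 + 1)) by rewrite divr_gt0.
  have [om0 [del [om00 del0 Hd]]] := Hstab _ eps1.
  exists om0, (Num.min (rho1 / 2) (del / (L5 + 1))); split => //.
    by rewrite lt_min !divr_gt0.
  move=> om t0 xt0 omo Mx; rewrite le_min => /andP[x1 x2].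
  have xn := norm_le_enorm (xt0 - xs).
  have [|Ox Zx] := Z_norm xt0.
    by apply: le_lt_trans xn (le_lt_trans x1 _); rewrite ltr_pdivrMr// mulr_natr mulr2n ltrDr.
  have Zd : `|Z xt0| <= del.
    apply: le_trans Zx _; rewrite mulrC -ler_pdivlMr//; exact: le_trans xn x2.
  have [z [d [d0 zt0 Hz zb]]] := Hd om t0 (Z xt0) omo Zd.
  apply: (key om t0 xt0 z d) => //; first exact: lt_le_trans omo.
  move=> J x HJ t tt0; have t0t : t0 - d < t by rewrite ltrBlDr (le_lt_trans tt0)// ltrDl.
  have [Jt ->] := HJ t t0t; split => //.
  have [zr _] := Hz t t0t; apply: le_trans (Psi_enorm _ (lt_le_trans zr r1m)) _.
  by rewrite mulrC -ler_pdivlMr//; exact: zb.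
- move=> r eps r0 eps0; have eps1 : 0 < eps / (c0 * (L2 + 1)) by rewrite divr_gt0.
  have [om0 [Del [om00 Del0 Hd]]] := Hattr _ eps1.
  (* The chart solution never leaves the ball of radius [r1]; this is the image of that bound under
     [Psi]. *)
  exists om0, Del, (c0 * (L2 + 1) * r1); split => //; first exact: mulr_gt0.
  move=> om t0 xt0 omo [Mx]; rewrite lt_min => /andP[x1 x2] _.
  have [Ox Zx] := Z_norm _ x1.
  have Zd : `|Z xt0| <= s0.
    by apply: le_trans Zx _; rewrite mulrC -ler_pdivlMr//; exact: ltW.
  have [z [d [d0 zt0 Hz zb]]] := Hd om t0 (Z xt0) omo Zd.
  apply: (key om t0 xt0 z d) => //; first exact: lt_le_trans omo.
  move=> J x HJ; split => t tt0.
    have t0t : t0 - d < t by rewrite ltrBlDr (le_lt_trans tt0)// ltrDl.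
    have [Jt ->] := HJ t t0t; split => //.
    have [zr _] := Hz t t0t; apply: le_trans (Psi_enorm _ (lt_le_trans zr r1m)) _.
    by rewrite ler_pM2l// ltW.
  have t0t : t0 - d < t by apply: lt_le_trans tt0; rewrite ltrD2l; lra.
  have [Jt ->] := HJ t t0t.
  have [zr _] := Hz t t0t; apply: le_trans (Psi_enorm _ (lt_le_trans zr r1m)) _.
  by rewrite mulrC -ler_pdivlMr//; exact: zb.
Qed.
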